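(* For integers $p\ge2$, $n\ge 2$ let $$a_{p,n}=1-p^{-2/(n-1)}c_{p,n},\qquad b_{p,n}=\frac{2}{n-1}\,p^{-2/(n-1)}c_{p,n},$$ $$c_{p,n}=\Big(\frac{n-1}{2}\,B\Big(\frac12,\frac{n-1}{2}\Big)\sqrt{1-p^{-2/(n-1)}}\Big)^{2/(n-1)},$$ where $B(s,t)$ is the Beta function, and let $I(\cdot)$ denote the indicator. 1. Suppose $L_1,\ldots,L_p$ are i.i.d. uniformly distributed unit vectors over $S^{n-1}\subset\mathbb{R}^n$, and let $U$ be an arbitrary random unit vector in $\mathbb{R}^n$ independent of $(L_1,\ldots,L_p)$. Let $M_{p,n}=\max_{1\le j\le p}|\langle L_j,U\rangle|$. Then for any fixed real $x$, as $p\to\infty$, $$\sup_{n\ge 2}\Big|\mathbb{P}\Big(\frac{M_{p,n}^2-a_{p,n}}{b_{p,n}}<x\Big)-I\Big(x>\frac{n-1}{2}\Big)-\exp\Big(-\Big(1-\frac{2}{n-1}x\Big)^{(n-1)/2}\Big)I\Big(x\le\frac{n-1}{2}\Big)\Big|\to 0.$$ In particular, if $n\to\infty$ and $p\to\infty$, then for any fixed $x$ one has the double limit $$\mathbb{P}\Big(\frac{M_{p,n}^2-a_{p,n}}{b_{p,n}}<x\Big)\to\exp(-e^{-x}).$$ 2. Suppose we observe $n$ i.i.d. samples of $(X_1,\ldots,X_p,Y)$, where $X_1,\ldots,X_p$ are independent Gaussian variables and $Y$ is an arbitrarily distributed random variable independent of $(X_1,\ldots,X_p)$. Let $M_{XY}=\max_{1\le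 j\le p}|\hat C(X_j,Y)|$ be the maximal absolute sample correlation. Then for any fixed real $x$, as $p\to\infty$, $$\sup_{n\ge 3}\Big|\mathbb{P}\Big(\frac{M_{XY}^2-a_{p,n-1}}{b_{p,n-1}}<x\Big)-I\Big(x>\frac{n-2}{2}\Big)-\exp\Big(-\Big(1-\frac{2}{n-2}x\Big)^{(n-2)/2}\Big)I\Big(x\le\frac{n-2}{2}\Big)\Big|\to 0.$$ In particular, if $n\to\infty$ and $p\to\infty$, then for any fixed $x$ one has the double limit $$\mathbb{P}\Big(\frac{M_{XY}^2-a_{p,n-1}}{b_{p,n-1}}<x\Big)\to\exp(-e^{-x}).$$
   Context: $S^{n-1}$ is the unit sphere of $\mathbb{R}^n$; uniform means with respect to normalized surface measure. For random variables $X,Y$ with $n$ i.i.d. observations $(X_i,Y_i)$ and sample means $\bar X,\bar Y$, the sample correlation is $$\hat C(X,Y)=\frac{\sum_{i=1}^n(X_i-\bar X)(Y_i-\bar Y)}{\sqrt{\sum_{i=1}^n(X_i-\bar X)^2}\sqrt{\sum_{i=1}^n(Y_i-\bar Y)^2}}.$$ Sample correlations are assumed to be well defined, i.e. denominators are almost surely nonzero. The product of an expression with an indicator equal to $0$ is $0$ (even where the expression is not real-valued). Double limits are as $n,p\to\infty$ jointly, with no restriction on relative rates. *)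

(* Defs.v *)
From HB Require Import structures.
From mathcomp Require Import all_boot all_order all_algebra.
From mathcomp Require Import all_classical all_reals all_analysis.

Set Implicit Arguments.
Unset Strict Implicit.
Unset Printing Implicit Defensive.

Import Order.TTheory GRing.Theory Num.Theory.
Import numFieldNormedType.Exports.

Local Open Scope classical_set_scope.
Local Open Scope ring_scope.

(** Points of [R^n] are tuples [n.-tuple R], which carry the product Borel
    sigma-algebra. *)
Section euclidean.
Context {R : realType}.

Definition inner n (u v : n.-tuple R) : R := \sum_(i < n) tnth u i * tnth v i.

Definition enorm n (v : n.-tuple R) : R :=
  Num.sqrt (\sum_(i < n) tnth v i ^+ 2).

Definition tscale n (r : R) (v : n.-tuple R) : n.-tuple R :=
  [tuple r * tnth v i | i < n].

(** The [n]-fold product of [lebesgue_measure], by sections as in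
    [product_measure1]. *)
Fixpoint lebesgue_tuple (n : nat) : set (n.-tuple R) -> \bar R :=
  match n return set (n.-tuple R) -> \bar R with
  | 0 => fun A => (\1_A [tuple])%:E
  | n'.+1 => fun A => (\int[lebesgue_measure]_x
      lebesgue_tuple [set v : n'.-tuple R | A [tuple of x :: v]])%E
  end.

(** Surface measure of the part of [A] lying on the unit sphere, by integration
    in polar coordinates: [n] times the Lebesgue measure of the cone
    [{r u : 0 < r <= 1, u \in A, enorm u = 1}], the factor [n] being the inverse
    of the integral of [r ^+ n.-1] over [[0, 1]]. *)
Definition sphere_surface n (A : set (n.-tuple R)) : \bar R :=
  (n%:R%:E * lebesgue_tuple
     [set v : n.-tuple R | (0 < enorm v <= 1)%R /\
                           A (tscale (enorm v)^-1 v)])%E.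

Definition sphere_uniform n (A : set (n.-tuple R)) : \bar R :=
  (sphere_surface A * ((fine (sphere_surface [set: n.-tuple R]))^-1)%:E)%E.

End euclidean.

Section random_elements.
Context {R : realType} {d : measure_display} {T : measurableType d}.
Variable P : probability T R.

Definition mutually_independent d' (T' : measurableType d') (I : finType)
    (X : I -> T -> T') :=
  forall (J : {set I}) (A : I -> set T'),
    (forall i, i \in J -> measurable (A i)) ->
    P (\bigcap_(i in [set` J]) (X i @^-1` A i)) =
    (\prod_(i in J) P (X i @^-1` A i))%E.

Definition independent2 d1 d2 (T1 : measurableType d1) (T2 : measurableType d2)
    (X : T -> T1) (Y : T -> T2) :=
  forall (A : set T1) (B : set T2), measurable A -> measurable B ->
    P (X @^-1` A `&` Y @^-1` B) = (P (X @^-1` A) * P (Y @^-1` B))%E.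

Definition has_law d' (T' : measurableType d') (X : T -> T')
    (mu : set T' -> \bar R) :=
  forall A : set T', measurable A -> P (X @^-1` A) = mu A.

(** Nondegenerate, since a constant variable has no sample correlation. *)
Definition gaussian (X : T -> R) :=
  exists m s : R, 0 < s /\ has_law X (normal_prob m s).

End random_elements.

Section normalizing_constants.
Context {R : realType}.

(** The library's [beta_fun] only takes integer arguments. *)
Definition Beta (s t : R) : R :=
  \int[lebesgue_measure]_(x in `]0, 1[) (x `^ (s - 1) * (1 - x) `^ (t - 1)).

Definition c_ (p n : nat) : R :=
  (n.-1%:R / 2 * Beta (1 / 2) (n.-1%:R / 2)
   * Num.sqrt (1 - p%:R `^ (- 2 / n.-1%:R))) `^ (2 / n.-1%:R).

Definition a_ (p n : nat) : R := 1 - p%:R `^ (- 2 / n.-1%:R) * c_ p n.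

Definition b_ (p n : nat) : R :=
  2 / n.-1%:R * p%:R `^ (- 2 / n.-1%:R) * c_ p n.

(** [powR] is total, so the last indicator does annihilate the exponential
    where the base is negative. *)
Definition limit_cdf (n : nat) (x : R) : R :=
  (x > n.-1%:R / 2)%R%:R
  + expR (- (1 - 2 / n.-1%:R * x) `^ (n.-1%:R / 2)) * (x <= n.-1%:R / 2)%R%:R.

End normalizing_constants.

Section spherical_model.
Context {R : realType} {d : measure_display} {T : measurableType d}.
Variables (P : probability T R) (p n : nat).
Variables (L : 'I_p -> {RV P >-> n.-tuple R}) (U : {RV P >-> n.-tuple R}).

Definition spherical_model :=
  [/\ forall j, has_law P (L j) (@sphere_uniform R n),
      mutually_independent P (fun j => L j : T -> n.-tuple R),
      {ae P, forall t, enorm (U t) = 1}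
    & independent2 P U (fun t => [tuple L j t | j < p])].

Definition max_inner (t : T) : R :=
  \big[Num.max/0]_(j < p) `|inner (L j t) (U t)|.

End spherical_model.

Section sample_model.
Context {R : realType}.

Definition sample_mean n (u : 'I_n -> R) : R := (\sum_(i < n) u i) / n%:R.

Definition sample_ssq n (u : 'I_n -> R) : R :=
  \sum_(i < n) (u i - sample_mean u) ^+ 2.

Definition sample_corr n (u v : 'I_n -> R) : R :=
  (\sum_(i < n) (u i - sample_mean u) * (v i - sample_mean v))
  / (Num.sqrt (sample_ssq u) * Num.sqrt (sample_ssq v)).

(** [Q] is the joint law of [(X_1, ..., X_p, Y)]. *)
Definition gaussian_design p (Q : probability (p.-tuple R * R)%type R) :=
  [/\ forall j : 'I_p, gaussian Q (fun w => tnth w.1 j),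
      mutually_independent Q (fun (j : 'I_p) w => tnth w.1 j)
    & independent2 Q fst snd].

Context {d : measure_display} {T : measurableType d}.
Variables (P : probability T R) (p n : nat).
Variables (Q : probability (p.-tuple R * R)%type R).
Variables (Z : 'I_n -> {RV P >-> (p.-tuple R * R)%type}).

Definition obsX (j : 'I_p) (t : T) (i : 'I_n) : R := tnth (Z i t).1 j.
Definition obsY (t : T) (i : 'I_n) : R := (Z i t).2.

Definition iid_sample :=
  (forall i, has_law P (Z i) Q) /\
  mutually_independent P (fun i => Z i : T -> (p.-tuple R * R)%type).

Definition corr_well_defined :=
  {ae P, forall t, forall j : 'I_p,
    Num.sqrt (sample_ssq (obsX j t)) * Num.sqrt (sample_ssq (obsY t)) != 0}.

Definition max_corr (t : T) : R :=
  \big[Num.max/0]_(j < p) `|sample_corr (obsX j t) (obsY t)|.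

End sample_model.

(* Main.v *)
(** Conditionally on [U], the events [<L_j, U> ^ 2 < y] are independent and have
    the same probability, so the maximum is below [sqrt y] with probability
    [(1 - q) ^ p], where [q] is the measure of the double cap at height [sqrt y].
    Translation-invariant measures are unique up to a factor, hence Lebesgue
    measure on tuples is invariant under reflections and the cap may be centered
    at the first basis vector. Slicing by hyperplanes then gives
    [q = f (sqrt y) / f 0] on the sphere of [R ^ m.+1], where [f], called [profile],
    has derivative [- m / m.+1 * (1 - x ^ 2) ^ (m / 2 - 1)] and [f 0] is a multiple
    of [B (1 / 2, m / 2)]. Comparing [f x] with [(1 - x ^ 2) ^ (m / 2) / x] by
    monotonicity shows that [p q] is close, uniformly in [m], to
    [(1 - 2 x / m) ^ (m / 2)] at [y = a + b x], and [(1 - q) ^ p] is close to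
    [expR (- p q)].

    In the second part, centering is the projection orthogonal to the unit vector
    [e] on the diagonal. Given [Y], a squared correlation is at least [y] when the
    projection of the Gaussian vector of the observations of [X_j] lies in the
    cone over a double cap. The Gaussian density is radial, so a reflection sends
    [e] to the first basis vector, whose coordinate is then dropped, and a
    layer-cake argument identifies the Gaussian measure of the cone with the
    spherical measure of the cap, in dimension [n - 1]. *)

Require Import Defs.
From HB Require Import structures.
From mathcomp Require Import all_boot all_order all_algebra.
From mathcomp Require Import all_classical all_reals all_analysis.
From mathcomp Require Import measurable_realfun ring lra.

Import Order.TTheory GRing.Theory Num.Theory.
Import numFieldNormedType.Exports.

Local Open Scope classical_set_scope.
Local Open Scope ring_scope.

Set Implicit Arguments.
Unset Strict Implicit.
Unset Printing Implicit Defensive.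

(** * Product measures on tuples *)

(** The difficulty is uniformity in the dimension. With m = n - 1 and theta = p^(-2/m) = exp (- 2 ln
    p / m), the ratio [ln p / m] ranges over all scales, so no expansion in it is available, and for
    m = 1 the density (1 - t^2)^(m/2 - 1) is unbounded near 1. The constants are such that s = 1 -
    y, at y = a + b x, satisfies s^(m/2) = K W / p, where W = (1 - 2 x / m)^(m/2) and K = (m/2)
    B(1/2, m/2) sqrt (1 - theta). The profile at height sqrt y is about s^(m/2) / sqrt y up to a
    factor, and the sqrt (1 - theta) in K is there to cancel sqrt y. This is legitimate because 1/2
    <= K <= 2 ln p + 2 for every m: compared with a power p^d such factors are negligible, so s is
    comparable with theta up to exponents 1 - d and 1 + d, and concavity of 1 - exp (- u) turns this
    into bounds of y by (1 - d) (1 - theta) and (1 + d) (1 - theta), whatever u = 2 ln p / m is. The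
    lower estimate degenerates when W is small, but for W < d it is trivial up to an error d. *)

Section cons_tuple.
Context d (S : measurableType d).

Definition cons_tup n (xv : S * n.-tuple S) : n.+1.-tuple S :=
  [tuple of xv.1 :: xv.2].

Lemma measurable_cons_tup n : measurable_fun setT (@cons_tup n).
Proof. exact: measurable_cons. Qed.

Lemma measurable_tnth_comp d' (T : measurableType d') n (f : T -> n.-tuple S) i :
  measurable_fun setT f -> measurable_fun setT (fun t => tnth (f t) i).
Proof. by move=> mf; apply: (measurableT_comp (measurable_tnth i) mf). Qed.

Definition rect n (B : 'I_n -> set S) : set (n.-tuple S) :=
  [set v | forall i, B i (tnth v i)].

Lemma rect_bigcap n (B : 'I_n -> set S) :
  rect B = \bigcap_(i in [set: 'I_n]) (fun v => tnth v i) @^-1` B i.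
Proof. by apply/seteqP; split=> v /= h i; [move=> _|]; exact: h. Qed.

Lemma measurable_rect n (B : 'I_n -> set S) :
  (forall i, measurable (B i)) -> measurable (rect B).
Proof.
move=> mB; rewrite rect_bigcap; apply: fin_bigcap_measurable => // i _.
by rewrite -[X in measurable X]setTI; exact: measurable_tnth.
Qed.

Definition rects n : set (set (n.-tuple S)) :=
  [set A | exists2 B : 'I_n -> set S, forall i, measurable (B i) & A = rect B].

(** A generator of the product sigma-algebra constrains one coordinate, hence is a box whose other
    sides are full. *)
Lemma rects_generate n : (measurable : set (set (n.-tuple S))) = <<s @rects n >>.
Proof.
apply/seteqP; split; last first.
  apply: smallest_sub; first exact: sigma_algebra_measurable.
  by move=> _ [B mB ->]; exact: measurable_rect.
apply: smallest_sub; first exact: smallest_sigma_algebra.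
elim/big_ind : _ => // [A B sA sB|i _]; first by rewrite subUset.
move=> _ [B mB <-]; rewrite setTI; apply: sub_sigma_algebra.
exists (fun j => if j == i then B else setT); first by move=> j; case: ifP.
apply/seteqP; split=> v /=; first by move=> Bi j; case: eqP => // ->.
by move=> /(_ i); rewrite eqxx.
Qed.

Lemma rects_setI n : setI_closed (@rects n).
Proof.
move=> _ _ [A mA ->] [B mB ->]; exists (fun i => A i `&` B i).
  by move=> i; exact: measurableI.
apply/seteqP; split=> v /=; first by move=> [vA vB] i; split.
by move=> vAB; split=> i; case: (vAB i).
Qed.

Lemma rects_setT n : @rects n setT.
Proof. by exists (fun=> setT) => //; apply/seteqP; split. Qed.

Lemma rects_unique (R : realType) n
    (m1 m2 : {measure set (n.-tuple S) -> \bar R}) :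
  (m1 setT < +oo)%E ->
  (forall B, (forall i, measurable (B i)) -> m1 (rect B) = m2 (rect B)) ->
  forall A, measurable A -> m1 A = m2 A.
Proof.
move=> m1oo m12; apply: (measure_unique (@rects n) (fun=> setT)) => //.
- exact: rects_generate.
- exact: rects_setI.
- by move=> _; exact: rects_setT.
- by rewrite bigcup_const//; exists 0%N.
- by move=> _ [B mB ->]; exact: m12.
Qed.

End cons_tuple.

Section tuple_measure.
Local Open Scope ereal_scope.
Context d (S : measurableType d) (R : realType).
Variable mu : {sigma_finite_measure set S -> \bar R}.

(** The recursion of [lebesgue_tuple]. *)
Fixpoint tuple_measure (n : nat) : set (n.-tuple S) -> \bar R :=
  match n return set (n.-tuple S) -> \bar R with
  | 0%N => fun A => (\1_A [tuple])%:E
  | n'.+1 => fun A => \int[mu]_x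
      tuple_measure [set v : n'.-tuple S | A [tuple of x :: v]]
  end.

Section cons_measure.
Variables (n : nat) (nu : {sigma_finite_measure set (n.-tuple S) -> \bar R}).

(** One step of [tuple_measure], built as the image of a product measure so that additivity and
    sigma-finiteness are inherited. *)
Definition cons_measure := pushforward (mu \x nu) (@cons_tup _ S n).

Let cons_measure0 : cons_measure set0 = 0.
Proof. by rewrite /cons_measure /pushforward preimage_set0 measure0. Qed.

Let cons_measure_ge0 A : 0 <= cons_measure A.
Proof. by rewrite /cons_measure /pushforward measure_ge0. Qed.

Let cons_measure_sigma_additive : semi_sigma_additive cons_measure.
Proof.
pose f : {mfun (S * n.-tuple S)%type >-> n.+1.-tuple S} :=
  HB.pack (@cons_tup _ S n)
    (isMeasurableFun.Build _ _ _ _ _ (@measurable_cons_tup _ S n)).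
exact: (@measure_semi_sigma_additive _ _ _ (pushforward (mu \x nu) f)).
Qed.

HB.instance Definition _ := isMeasure.Build _ _ _ cons_measure
  cons_measure0 cons_measure_ge0 cons_measure_sigma_additive.

Let cons_measure_sigma_finite : sigma_finite setT cons_measure.
Proof.
have /sigma_finiteP[F [TF ndF Foo]] := sigma_finiteT mu.
have /sigma_finiteP[G [TG ndG Goo]] := sigma_finiteT nu.
pose uncons (v : n.+1.-tuple S) := (thead v, [tuple of behead v]).
have consK : cancel (@cons_tup _ S n) uncons.
  by move=> [x v]; congr pair; apply: val_inj.
exists (fun k => uncons @^-1` (F k `*` G k)).
  rewrite -preimage_bigcup (_ : \bigcup_k _ = setT) ?preimage_setT//.
  rewrite -subTset => -[x v] _.
  have : [set: S] x by []. rewrite TF => -[i _ Fx].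
  have : [set: n.-tuple S] v by []. rewrite TG => -[j _ Gv].
  exists (maxn i j) => //; split => /=.
    by move: x Fx; exact/subsetPset/ndF/leq_maxl.
  by move: v Gv; exact/subsetPset/ndG/leq_maxr.
move=> k; have [mF Fk] := Foo k; have [mG Gk] := Goo k; split.
  rewrite -[X in measurable X]setTI.
  apply: measurable_fun_pair (measurableX mF mG) => //.
    exact: measurable_tnth.
  exact: measurable_behead.
rewrite /cons_measure /pushforward -comp_preimage.
rewrite (_ : _ \o _ = id); last by apply/funext => x /=; rewrite consK.
by rewrite preimage_id product_measure1E// lte_mul_pinfty// ge0_fin_numE.
Qed.

HB.instance Definition _ := Measure_isSigmaFinite.Build _ _ _
  cons_measure cons_measure_sigma_finite.

End cons_measure.

(** The recursion only produces a set function. Iterating [cons_measure] yields a genuine measure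
    with the same values, from which the instances below are transported. *)
Lemma tuple_measure_sigma_finite n :
  exists nu : {sigma_finite_measure set (n.-tuple S) -> \bar R},
    (nu : set _ -> _) = @tuple_measure n.
Proof.
elim: n => [|n [nu nuE]].
  by exists (dirac ([tuple] : 0.-tuple S)).
exists (cons_measure nu); apply/funext => A /=.
rewrite /cons_measure /pushforward /product_measure1 /=.
apply: eq_integral => x _; rewrite -nuE; congr (nu _).
by apply/seteqP; split=> v; rewrite /xsection /= inE.
Qed.

Let tuple_measure0 n : @tuple_measure n set0 = 0.
Proof. by have [nu <-] := tuple_measure_sigma_finite n; exact: measure0. Qed.

Let tuple_measure_ge0 n A : 0 <= @tuple_measure n A.
Proof. by have [nu <-] := tuple_measure_sigma_finite n; exact: measure_ge0. Qed.

Let tuple_measure_sigma_additive n : semi_sigma_additive (@tuple_measure n).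
Proof.
have [nu <-] := tuple_measure_sigma_finite n.
exact: measure_semi_sigma_additive.
Qed.

HB.instance Definition _ n := isMeasure.Build _ _ _ (@tuple_measure n)
  (tuple_measure0 n) (@tuple_measure_ge0 n) (@tuple_measure_sigma_additive n).

Let tuple_measure_sigma_finite' n : sigma_finite setT (@tuple_measure n).
Proof.
by have [nu <-] := tuple_measure_sigma_finite n; exact: sigma_finiteT.
Qed.

HB.instance Definition _ n := Measure_isSigmaFinite.Build _ _ _
  (@tuple_measure n) (tuple_measure_sigma_finite' n).

Lemma tuple_measureS n (A : set (n.+1.-tuple S)) :
  tuple_measure A =
  \int[mu]_x tuple_measure [set v : n.-tuple S | A [tuple of x :: v]].
Proof. by []. Qed.

Lemma tuple_measure_pushforward n :
  @tuple_measure n.+1 = pushforward (mu \x @tuple_measure n) (@cons_tup _ S n).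
Proof.
apply/funext => A; rewrite tuple_measureS.
apply: eq_integral => x _; rewrite /=; congr (tuple_measure _).
by apply/seteqP; split=> v; rewrite /xsection /= inE.
Qed.

Lemma integral_tuple_measureS n (f : n.+1.-tuple S -> \bar R) :
  measurable_fun [set: n.+1.-tuple S] f -> (forall v, 0 <= f v) ->
  \int[@tuple_measure n.+1]_v f v =
  \int[mu]_x \int[@tuple_measure n]_v f [tuple of x :: v].
Proof.
move=> mf f0; rewrite tuple_measure_pushforward ge0_integral_pushforward//; last first.
- exact: measurable_cons_tup.
- rewrite preimage_setT fubini_tonelli1//; last by move=> x; exact: f0.
  exact: (measurableT_comp mf (@measurable_cons_tup _ S n)).
Qed.

Lemma tuple_measure_rect n (B : 'I_n -> set S) :
  (forall i, measurable (B i)) -> tuple_measure (rect B) = \prod_(i < n) mu (B i).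
Proof.
elim: n B => [|n IHn] B mB.
  rewrite big_ord0 /= indicE mem_set//=; by case.
rewrite big_ord_recl tuple_measureS.
under eq_integral => x _.
  rewrite (_ : tuple_measure _ = (\1_(B ord0) x)%:E *
      \prod_(i < n) mu (B (lift ord0 i))); last first.
    rewrite -IHn// indicE; have [xB|xB] := boolP (x \in B ord0).
      rewrite mul1e; congr tuple_measure; apply/seteqP; split=> v /= vB i.
        by have := vB (lift ord0 i); rewrite tnthS.
      by case: (unliftP ord0 i) => [j ->|->]; rewrite ?tnthS//; exact/set_mem.
    rewrite mul0e -(tuple_measure0 n); congr tuple_measure.
    apply/seteqP; split=> // v /= /(_ ord0); rewrite tnth0 => xB'.
    by move: xB; rewrite mem_set.
  over.
rewrite ge0_integralZr//; last 2 first.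
- exact/measurable_EFinP/measurable_indic.
- by apply: prode_ge0 => i _; exact: measure_ge0.
by rewrite integral_indic// setIT.
Qed.

End tuple_measure.

(** * Uniqueness of translation-invariant measures *)

Section measurable_sets.
Context d (T : measurableType d) (R : realType).
Implicit Types f g : T -> R.

Lemma measurable_set_le f g : measurable_fun setT f -> measurable_fun setT g ->
  measurable [set x | f x <= g x].
Proof.
move=> mf mg; have := measurable_fun_ler mf mg.
move=> /(_ measurableT [set true] I); rewrite setTI.
by congr measurable; apply/seteqP; split=> x /=.
Qed.

Lemma measurable_set_lt f g : measurable_fun setT f -> measurable_fun setT g ->
  measurable [set x | f x < g x].
Proof.
move=> mf mg; have := measurable_fun_ltr mf mg.
move=> /(_ measurableT [set true] I); rewrite setTI.
by congr measurable; apply/seteqP; split=> x /=.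
Qed.

Lemma measurable_preimage d' (S : measurableType d') (f : T -> S) A :
  measurable_fun setT f -> measurable A -> measurable [set x | A (f x)].
Proof. by move=> mf mA; rewrite -[X in measurable X]setTI; exact: mf. Qed.


End measurable_sets.

(** Packs the image measure together with its measurability proof, so that proofs can rewrite with a
    plain equation of set functions. *)
Lemma pushforward_measure_exists d1 d2 (T1 : measurableType d1)
    (T2 : measurableType d2) (R : realType) (m : {measure set T1 -> \bar R})
    (f : T1 -> T2) : measurable_fun setT f ->
  exists m' : {measure set T2 -> \bar R}, m' = pushforward m f :> (set _ -> _).
Proof.
move=> mf.
by exists (measure_function_pushforward__canonical__measure_function_Measure m mf).
Qed.

Section lebesgue_on_R.
Local Open Scope ereal_scope.
Context {R : realType}.

(** [lebesgue_measure] lives on [measurableTypeR R], which has another display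
    than the canonical structure on [R] from which the one of [n.-tuple R] is
    built; [leb] moves it to the latter. *)
Definition leb : set R -> \bar R := @lebesgue_measure R.

Let leb0 : leb set0 = 0. Proof. exact: measure0. Qed.

Let leb_ge0 A : 0 <= leb A. Proof. exact: measure_ge0. Qed.

Let leb_sigma_additive : semi_sigma_additive leb.
Proof. exact: (@measure_semi_sigma_additive _ _ _ (@lebesgue_measure R)). Qed.

HB.instance Definition _ := isMeasure.Build _ _ _ leb
  leb0 leb_ge0 leb_sigma_additive.

Let leb_sigma_finite : sigma_finite setT leb.
Proof. exact: (sigma_finiteT (@lebesgue_measure R)). Qed.

HB.instance Definition _ := Measure_isSigmaFinite.Build _ _ _ leb leb_sigma_finite.

Lemma ge0_integral_leb (D : set R) (f : R -> \bar R) : measurable D ->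
  measurable_fun D f -> (forall x, D x -> 0 <= f x) ->
  \int[leb]_(x in D) f x = \int[lebesgue_measure]_(x in D) f x.
Proof.
move=> mD mf f0.
(* The identity is measurable between the two structures on the line, and [leb] is the image of
   Lebesgue measure under it. *)
have mid : measurable_fun [set: measurableTypeR R] (id : measurableTypeR R -> R).
  exact: (@measurable_id _ R).
have [m mE] := pushforward_measure_exists (@lebesgue_measure R) mid.
transitivity (\int[m]_(x in D) f x).
  by apply: eq_measure_integral => A mA _; rewrite mE.
rewrite mE ge0_integral_pushforward//.
by move=> x /set_mem; exact: f0.
Qed.

Let measurable_shift (c : R) : measurable_fun setT (fun x : R => (x + c)%R).
Proof. exact: measurable_funD. Qed.

Lemma leb_shift (c : R) (A : set R) : measurable A ->
  leb [set x | A (x + c)%R] = leb A.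
Proof.
move=> mA; have [m mE] := pushforward_measure_exists leb (@measurable_shift c).
have <- : m A = leb [set x | A (x + c)%R] by rewrite mE.
(* The shifted measure is carried back to the display of [lebesgue_measure], where agreement on
   half-open intervals gives uniqueness. *)
pose m' : set (measurableTypeR R) -> \bar R := m.
have m0 : m' set0 = 0 by exact: measure0.
have m1 B : 0 <= m' B by exact: measure_ge0.
have m2 : semi_sigma_additive m' by exact: (@measure_semi_sigma_additive _ _ _ m).
pose H := isMeasure.Build _ _ _ m' m0 m1 m2.
pose m3 := HB.pack_for (Measure.type (measurableTypeR R) R) m' H.
apply/esym; apply: (@lebesgue_measure_unique _ m3) => //.
move=> _ [[a b] _ <-] /=; rewrite /m' mE /pushforward.
have -> : (fun x => x + c)%R @^-1` `]a, b]%classic = `](a - c)%R, (b - c)%R]%classic.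
  by apply/seteqP; split=> x /=; rewrite !in_itv /= ltrBlDr lerBrDr.
rewrite /leb; transitivity (lebesgue_measure (`](a - c)%R, (b - c)%R]%classic : set R)); last by [].
by rewrite !lebesgue_measure_itv /= !lte_fin ltrD2r -!EFinB opprB addrA subrK.
Qed.

Lemma ge0_integral_leb_shift (c : R) (f : R -> \bar R) :
  measurable_fun setT f -> (forall x, 0 <= f x) ->
  \int[leb]_x f (x + c)%R = \int[leb]_x f x.
Proof.
move=> mf f0; have [m mE] := pushforward_measure_exists leb (@measurable_shift c).
transitivity (\int[m]_x f x); last first.
  by apply: eq_measure_integral => A mA _; rewrite mE; exact: (leb_shift c mA).
by rewrite mE ge0_integral_pushforward.
Qed.

Lemma leb_itv_cc (a b : R) : (a <= b)%R -> leb `[a, b]%classic = (b - a)%:E.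
Proof.
move=> ab; rewrite /leb lebesgue_measure_itv /= lte_fin -EFinB.
by case: ltgtP ab => // ->; rewrite subrr.
Qed.

End lebesgue_on_R.

Section Haar.
Local Open Scope ereal_scope.
Context d1 d2 (T1 : measurableType d1) (T2 : measurableType d2) (R : realType).
Variable m1 : {sigma_finite_measure set T1 -> \bar R}.
Variable m2 : {sigma_finite_measure set T2 -> \bar R}.

Lemma Tonelli_set (E : set (T1 * T2)) : measurable E ->
  \int[m1]_x m2 [set y | E (x, y)] = \int[m2]_y m1 [set x | E (x, y)].
Proof.
move=> mE; have := @indic_fubini_tonelli _ _ _ _ _ m1 m2 _ mE.
rewrite indic_fubini_tonelli_FE// indic_fubini_tonelli_GE// /= => H.
transitivity (\int[m1]_x m2 (xsection E x)).
  apply: eq_integral => x _; congr (m2 _).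
  by apply/seteqP; split=> y; rewrite /xsection /= inE.
rewrite H; apply: eq_integral => y _; congr (m1 _).
by apply/seteqP; split=> x; rewrite /ysection /= inE.
Qed.

End Haar.

Section translations.
Context {R : realType}.
Implicit Types n : nat.

Definition tadd n (v w : n.-tuple R) : n.-tuple R :=
  [tuple tnth v i + tnth w i | i < n].

Definition topp n (v : n.-tuple R) : n.-tuple R := [tuple - tnth v i | i < n].

Lemma taddC n (v w : n.-tuple R) : tadd v w = tadd w v.
Proof. by apply: eq_from_tnth => i; rewrite !tnth_mktuple addrC. Qed.

Lemma taddK n (v w : n.-tuple R) : tadd (tadd v w) (topp w) = v.
Proof. by apply: eq_from_tnth => i; rewrite !tnth_mktuple addrK. Qed.

Lemma toppD n (v w : n.-tuple R) : topp (tadd v w) = tadd (topp v) (topp w).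
Proof. by apply: eq_from_tnth => i; rewrite !tnth_mktuple opprD. Qed.

Lemma toppK n : involutive (@topp n).
Proof. by move=> v; apply: eq_from_tnth => i; rewrite !tnth_mktuple opprK. Qed.

Context d (T : measurableType d).

Lemma measurable_mktuple n (f : T -> 'I_n -> R) :
  (forall i, measurable_fun setT (f^~ i)) ->
  measurable_fun setT (fun t => [tuple f t i | i < n]).
Proof.
move=> mf; apply/measurable_fun_tnthP => i.
rewrite (_ : _ \o _ = f^~ i)//.
by apply/funext => t /=; rewrite tnth_mktuple.
Qed.

Lemma measurable_tadd n (f g : T -> n.-tuple R) :
  measurable_fun setT f -> measurable_fun setT g ->
  measurable_fun setT (fun t => tadd (f t) (g t)).
Proof.
move=> mf mg; apply: measurable_mktuple => i.
by apply: measurable_funD; exact: measurable_tnth_comp.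
Qed.

Lemma measurable_topp n (f : T -> n.-tuple R) :
  measurable_fun setT f -> measurable_fun setT (fun t => topp (f t)).
Proof.
move=> mf; apply: measurable_mktuple => i.
by apply: measurableT_comp => //; exact: measurable_tnth_comp.
Qed.

End translations.

Definition translation_invariant (R : realType) n (mu : set (n.-tuple R) -> \bar R) :=
  forall c A, measurable A -> mu [set v | A (tadd v c)] = mu A.

Section Haar_uniqueness.
Local Open Scope ereal_scope.
Context {R : realType} (n : nat).
Implicit Types mu nu : {sigma_finite_measure set (n.-tuple R) -> \bar R}.

(** Both sides compute the double integral of [\1_A x * \1_B (y + x)]. Invariance of [nu] gives the
    left side directly; replacing x by x - y under [mu], exchanging the integrals and using
    invariance of [nu] again gives the right side. *)
Lemma translation_invariant_mul mu nu (A B : set (n.-tuple R)) :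
  translation_invariant mu -> translation_invariant nu ->
  measurable A -> measurable B ->
  mu A * nu B = mu B * nu [set v | A (topp v)].
Proof.
move=> muT nuT mA mB.
pose E := [set xy : n.-tuple R * n.-tuple R | A xy.1 /\ B (tadd xy.2 xy.1)].
have mE : measurable E.
  apply: measurableI; first exact: measurable_preimage.
  by apply: measurable_preimage => //; exact: measurable_tadd.
pose E' := [set xy : n.-tuple R * n.-tuple R | A (tadd xy.1 (topp xy.2)) /\ B xy.1].
have mE' : measurable E'.
  apply: measurableI; last exact: measurable_preimage.
  apply: measurable_preimage => //; apply: measurable_tadd => //.
  exact: measurable_topp.
have mNA : measurable [set v : n.-tuple R | A (topp v)].
  apply: measurable_preimage => //.
  by apply: measurable_topp; exact: measurable_id.
transitivity (\int[mu]_x nu [set y | E (x, y)]).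
  rewrite -[in LHS](setIT A) -[mu _]integral_indic// -ge0_integralZr//; last first.
    exact/measurable_EFinP/measurable_indic.
  apply: eq_integral => x _; rewrite indicE.
  have [xA|xA] := boolP (x \in A).
    rewrite mul1e -(nuT x)//; congr (nu _); apply/seteqP; split=> y /=; last by case.
    by split=> //; exact/set_mem.
  rewrite mul0e -[LHS](measure0 nu); congr (nu _); apply/seteqP; split=> // y [].
  by move=> /mem_set; rewrite (negbTE xA).
transitivity (\int[nu]_y mu [set x | E' (x, y)]).
  rewrite Tonelli_set//; apply: eq_integral => y _.
  rewrite -[RHS](muT y)/=; last first.
    apply: measurableI => //; apply: measurable_preimage => //.
    exact: (measurable_tadd (f := id) (g := fun=> topp y)).
  congr (mu _); apply/seteqP; split=> x /=; by rewrite /E /E' /= taddK taddC.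
rewrite -Tonelli_set// -[in RHS](setIT B) -[mu _]integral_indic// -ge0_integralZr//; last first.
  exact/measurable_EFinP/measurable_indic.
apply: eq_integral => x _; rewrite indicE.
have [xB|xB] := boolP (x \in B).
  rewrite mul1e -[RHS](nuT (topp x))//; congr (nu _); apply/seteqP; split=> y /=.
    by rewrite toppD toppK taddC => -[].
  by rewrite toppD toppK taddC; split=> //; exact/set_mem.
rewrite mul0e -[RHS](measure0 nu); congr (nu _); apply/seteqP; split=> // y [].
by move=> _ /mem_set; rewrite (negbTE xB).
Qed.

End Haar_uniqueness.

(** * Lebesgue measure on tuples *)

Section lebesgue_tuples.
Local Open Scope ereal_scope.
Context {R : realType}.
Implicit Types n : nat.

Definition lebn n := tuple_measure (@leb R) (n := n).
HB.instance Definition _ n := Measure.on (@lebn n).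
HB.instance Definition _ n := SigmaFiniteMeasure.on (@lebn n).

Lemma measurable_cons_section n (A : set (n.+1.-tuple R)) x : measurable A ->
  measurable [set v : n.-tuple R | A [tuple of x :: v]].
Proof.
move=> mA; apply: (measurable_preimage (f := fun v : n.-tuple R => [tuple of x :: v])) => //.
exact: (@measurable_cons _ _ _ _ (fun=> x) _ id).
Qed.

Lemma measurable_lebn_section n (A : set (n.+1.-tuple R)) : measurable A ->
  measurable_fun setT (fun x => lebn [set v : n.-tuple R | A [tuple of x :: v]]).
Proof.
move=> mA; have mE : measurable ((@cons_tup _ R n) @^-1` A).
  by apply: measurable_preimage => //; exact: measurable_cons_tup.
have := measurable_fun_xsection (lebn (n := n)) mE.
congr measurable_fun; apply/funext => x /=; congr (lebn _).
by apply/seteqP; split=> v; rewrite /xsection /= inE.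
Qed.

Lemma lebesgue_tupleE n (A : set (n.-tuple R)) : measurable A ->
  lebesgue_tuple A = lebn A.
Proof.
elim: n A => [//|n IHn] A mA.
rewrite [LHS]/= [RHS]/lebn tuple_measureS ge0_integral_leb//; last first.
  exact: (measurable_lebn_section mA).
by apply: eq_integral => x _; rewrite IHn//; exact: measurable_cons_section.
Qed.

Lemma lebn_translation n : translation_invariant (@lebn n).
Proof.
elim: n => [|n IHn] c A mA.
  congr (lebn _); apply/seteqP.
  by split=> v /=; rewrite (tuple0 v) (tuple0 (tadd _ _)).
pose cn := [tuple tnth c (lift ord0 i) | i < n].
rewrite [RHS]/lebn tuple_measureS -(ge0_integral_leb_shift (tnth c ord0)); last 2 first.
- exact: measurable_lebn_section.
- by move=> x; exact: measure_ge0.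
rewrite [LHS]/lebn tuple_measureS; apply: eq_integral => x _.
apply: etrans; last exact: (IHn cn _ (measurable_cons_section _ mA)).
congr (lebn _); apply/seteqP.
have E (v : n.-tuple R) : tadd [tuple of x :: v] c = [tuple of (x + tnth c ord0)%R :: tadd v cn].
  apply: eq_from_tnth => i; rewrite tnth_mktuple.
  case: (unliftP ord0 i) => [j ->|->]; last by rewrite !tnth0.
  by rewrite !tnthS !tnth_mktuple.
by split=> v /=; rewrite E.
Qed.

Definition cube n (r : R) : set (n.-tuple R) := rect (fun=> `[0%R, r]%classic).

Lemma measurable_cube n r : measurable (@cube n r).
Proof. by apply: measurable_rect => i; exact: measurable_itv. Qed.

Lemma lebn_cube n r : (0 <= r)%R -> lebn (@cube n r) = (r ^+ n)%:E.
Proof.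
move=> r0; rewrite /lebn tuple_measure_rect//.
rewrite (eq_bigr (fun=> r%:E)) => [|i _]; last first.
  by rewrite -[X in X%:E]subr0; exact: leb_itv_cc.
by rewrite prodEFin prodr_const card_ord.
Qed.

(** An image measure need not be sigma-finite; a measurable left inverse pulls an exhaustion of the
    source back to one of the target. *)
Lemma pushforward_sigma_finite d1 d2 (T1 : measurableType d1)
    (T2 : measurableType d2) (m : {sigma_finite_measure set T1 -> \bar R})
    (f : T1 -> T2) (g : T2 -> T1) :
  measurable_fun setT f -> measurable_fun setT g -> cancel f g ->
  exists m' : {sigma_finite_measure set T2 -> \bar R},
    m' = pushforward m f :> (set _ -> _).
Proof.
move=> mf mg fK.
pose m1 : {measure set T2 -> \bar R} :=
  measure_function_pushforward__canonical__measure_function_Measure m mf.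
have sf : sigma_finite setT m1.
  have [F TF Foo] := sigma_finiteT m.
  exists (fun k => g @^-1` F k); first by rewrite -preimage_bigcup -TF preimage_setT.
  move=> k; have [mF Fk] := Foo k; split; first exact: measurable_preimage.
  rewrite /= /pushforward -comp_preimage.
  by rewrite (_ : _ \o _ = id)//; apply/funext => x /=; rewrite fK.
pose H1 := isSFinite.Build _ _ _ _ (sfinite_measure_sigma_finite sf).
pose H2 := isSigmaFinite.Build _ _ _ _ sf.
by exists (HB.pack_for (SigmaFiniteMeasure.type T2 R) (Measure.sort m1) H1 H2).
Qed.

(** The product identity against the unit cube leaves a reflected copy of A; the same identity for
    [lebn] with itself shows that the reflection does not change its measure. *)
Lemma translation_invariant_unique n
    (mu : {sigma_finite_measure set (n.-tuple R) -> \bar R}) A :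
  translation_invariant mu -> measurable A ->
  mu A = mu (cube 1) * lebn A.
Proof.
move=> muT mA; have mQ := measurable_cube (n := n) 1.
have Q1 : lebn (@cube n 1) = 1 by rewrite lebn_cube// expr1n.
have := translation_invariant_mul muT (@lebn_translation n) mA mQ.
rewrite /= Q1 mule1 => ->; congr (_ * _).
have := translation_invariant_mul (@lebn_translation n) (@lebn_translation n) mA mQ.
by rewrite /= Q1 mule1 mul1e => <-.
Qed.

Definition nsq n (v : n.-tuple R) : R := (\sum_(i < n) tnth v i ^+ 2)%R.

Lemma nsq_ge0 n (v : n.-tuple R) : (0 <= nsq v)%R.
Proof. by apply: sumr_ge0 => i _; exact: sqr_ge0. Qed.

Definition tball n : set (n.-tuple R) := [set v | (nsq v <= 1)%R].

Lemma measurable_nsq n d (T : measurableType d) (f : T -> n.-tuple R) :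
  measurable_fun setT f -> measurable_fun setT (fun t => nsq (f t)).
Proof.
move=> mf; apply: measurable_sum => i; apply: measurable_funX.
exact: measurable_tnth_comp.
Qed.

Lemma measurable_tball n : measurable (@tball n).
Proof. by apply: measurable_set_le => //; apply: measurable_nsq; exact: measurable_id. Qed.

Lemma tscale_nsq n r (v : n.-tuple R) : nsq (tscale r v) = (r ^+ 2 * nsq v)%R.
Proof.
by rewrite /nsq mulr_sumr; apply: eq_bigr => i _; rewrite tnth_mktuple exprMn.
Qed.

Lemma measurable_tscale n d (T : measurableType d) (g : T -> R) (f : T -> n.-tuple R) :
  measurable_fun setT g -> measurable_fun setT f ->
  measurable_fun setT (fun t => tscale (g t) (f t)).
Proof.
move=> mg mf; apply: measurable_mktuple => i; apply: measurable_funM => //.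
exact: measurable_tnth_comp.
Qed.

Lemma tscaleA n r s (v : n.-tuple R) : tscale r (tscale s v) = tscale (r * s)%R v.
Proof. by apply: eq_from_tnth => i; rewrite !tnth_mktuple mulrA. Qed.

Lemma tscale1 n (v : n.-tuple R) : tscale 1%R v = v.
Proof. by apply: eq_from_tnth => i; rewrite !tnth_mktuple mul1r. Qed.

Lemma tscaleDr n r (v w : n.-tuple R) : tscale r (tadd v w) = tadd (tscale r v) (tscale r w).
Proof. by apply: eq_from_tnth => i; rewrite !tnth_mktuple mulrDr. Qed.

Lemma lebn_scale n (r : R) (A : set (n.-tuple R)) : (0 < r)%R -> measurable A ->
  lebn [set v | A (tscale r v)] = (r^-1 ^+ n)%:E * lebn A.
Proof.
move=> r0 mA.
have mf s : measurable_fun setT (@tscale R n s).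
  by apply: measurable_tscale; [exact: measurable_cst|exact: measurable_id].
have K : cancel (@tscale R n r) (@tscale R n r^-1).
  by move=> v; rewrite tscaleA mulVf ?gt_eqF// tscale1.
have [m mE] := pushforward_sigma_finite (@lebn n) (mf r) (mf (r^-1)%R) K.
have mT : translation_invariant m.
  move=> c B mB; rewrite mE /pushforward.
  rewrite -[RHS](lebn_translation (tscale r^-1 c)); last exact: measurable_preimage.
  congr (lebn _); apply/seteqP.
  by split=> v /=; rewrite tscaleDr tscaleA mulfV ?gt_eqF// tscale1.
have := translation_invariant_unique mT mA; rewrite mE /pushforward => ->.
congr (_ * _); rewrite -lebn_cube ?invr_ge0 ?ltW//; congr (lebn _).
apply/seteqP; split=> v /= Qv i; have := Qv i; rewrite /= tnth_mktuple !in_itv /=.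
  by rewrite pmulr_rge0// -(ler_pdivlMl _ _ r0) mulr1.
by rewrite pmulr_rge0// -(ler_pdivlMl _ _ r0) mulr1.
Qed.

Lemma tball_cube n : @tball n `<=` [set v | cube 2 (tadd v (nseq_tuple n 1%R))].
Proof.
move=> v /= v1 i /=; rewrite tnth_mktuple tnth_nseq in_itv /=.
have h : (tnth v i ^+ 2 <= 1)%R.
  apply: le_trans v1; rewrite /nsq (bigD1 i)//= lerDl.
  by apply: sumr_ge0 => j _; exact: sqr_ge0.
have : (`|tnth v i| <= 1)%R.
  by rewrite -(@ler_pXn2r _ 2)// ?nnegrE// expr1n real_normK ?num_real.
by rewrite ler_norml => /andP[? ?]; apply/andP; split; lra.
Qed.

Lemma lebn_tball_lty n : lebn (@tball n) < +oo.
Proof.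
apply: (@le_lt_trans _ _ (lebn (@cube n 2))); last by rewrite lebn_cube// ltry.
rewrite -(lebn_translation (nseq_tuple n 1%R) (measurable_cube 2)).
apply: le_measure; rewrite ?inE.
- exact: measurable_tball.
- apply: measurable_preimage (measurable_cube 2).
  exact: (measurable_tadd (f := id) (g := fun=> _)).
- exact: tball_cube.
Qed.

Lemma lebn_tball_gt0 n : 0 < lebn (@tball n).
Proof.
apply: (@lt_le_trans _ _ (lebn (@cube n (n.+1%:R^-1)%R))).
  by rewrite lebn_cube// lte_fin exprn_gt0// invr_gt0.
apply: le_measure; rewrite ?inE; [exact: measurable_cube|exact: measurable_tball|].
move=> v /= Qv; rewrite /tball /= /nsq.
apply: (@le_trans _ _ (\sum_(i < n) (n.+1%:R^-1))%R).
  apply: ler_sum => i _; have := Qv i; rewrite /= in_itv /= => /andP[v0 v1].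
  have : (n.+1%:R^-1 <= 1 :> R)%R by rewrite invf_le1// ler1n.
  by move=> c1; rewrite expr2 (le_trans _ v1)// ler_piMl// (le_trans v1).
rewrite sumr_const card_ord -[X in (X <= _)%R]mulr_natl ler_pdivrMr// mul1r ler_nat; exact: leqnSn.
Qed.

(** Additivity makes the image measure translation invariant, hence a multiple of [lebn]. The unit
    ball is its own preimage and has positive finite measure, so the factor is 1, without any
    determinant. *)
Lemma lebn_isometry n (Q : n.-tuple R -> n.-tuple R) A :
  measurable_fun setT Q -> involutive Q -> {morph Q : v w / tadd v w} ->
  (forall v, nsq (Q v) = nsq v) -> measurable A ->
  lebn [set v | A (Q v)] = lebn A.
Proof.
move=> mQ QK QD Qn mA.
have [m mE] := pushforward_sigma_finite (@lebn n) mQ mQ QK.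
have mT : translation_invariant m.
  move=> c B mB; rewrite mE /pushforward.
  rewrite -[RHS](lebn_translation (Q c)); last exact: measurable_preimage.
  by congr (lebn _); apply/seteqP; split=> v /=; rewrite QD QK.
have mB : m (@tball n) = lebn (@tball n).
  rewrite mE /pushforward; congr (lebn _).
  by apply/seteqP; split=> v; rewrite /tball /= Qn.
have -> : lebn [set v | A (Q v)] = m A by rewrite mE.
rewrite (translation_invariant_unique mT mA).
have := translation_invariant_unique mT (@measurable_tball n); rewrite mB.
have := @lebn_tball_gt0 n; have := @lebn_tball_lty n.
have : 0 <= m (cube 1) by exact: measure_ge0.
(* An infinite factor would give the ball infinite measure. *)
move: (m (cube 1)) (lebn (@tball n)) => [q| |] [b| |]//=; last first.
  by move=> _ _; rewrite lte_fin => b0; rewrite gt0_mulye.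
move=> _ _; rewrite lte_fin => b0 /(congr1 fine) /= qb.
by rewrite (_ : q = 1%R) ?mul1e//; apply: (mulIf (lt0r_neq0 b0)); rewrite mul1r.
Qed.

End lebesgue_tuples.
Arguments lebn : simpl never.
Arguments tuple_measure : simpl never.

(** * Reflections and caps *)

Section householder.
Context {R : realType}.
Implicit Types n : nat.

Lemma innerC n (v w : n.-tuple R) : inner v w = inner w v.
Proof. by apply: eq_bigr => i _; rewrite mulrC. Qed.

Lemma inner_nsq n (v : n.-tuple R) : inner v v = nsq v.
Proof. by apply: eq_bigr => i _; rewrite expr2. Qed.

Lemma innerDl n (u v w : n.-tuple R) : inner (tadd u v) w = inner u w + inner v w.
Proof. by rewrite -big_split; apply: eq_bigr => i _; rewrite tnth_mktuple mulrDl. Qed.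

Lemma innerZl n r (v w : n.-tuple R) : inner (tscale r v) w = r * inner v w.
Proof. by rewrite mulr_sumr; apply: eq_bigr => i _; rewrite tnth_mktuple mulrA. Qed.

Lemma innerNl n (v w : n.-tuple R) : inner (topp v) w = - inner v w.
Proof. by rewrite -sumrN; apply: eq_bigr => i _; rewrite tnth_mktuple mulNr. Qed.

Lemma innerDr n (u v w : n.-tuple R) : inner u (tadd v w) = inner u v + inner u w.
Proof. by rewrite innerC innerDl !(innerC u). Qed.

Lemma innerZr n r (v w : n.-tuple R) : inner v (tscale r w) = r * inner v w.
Proof. by rewrite innerC innerZl innerC. Qed.

Lemma innerNr n (v w : n.-tuple R) : inner v (topp w) = - inner v w.
Proof. by rewrite innerC innerNl innerC. Qed.

Lemma nsq_eq0 n (v : n.-tuple R) : nsq v = 0 -> forall i, tnth v i = 0.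
Proof.
move=> /eqP; rewrite /nsq psumr_eq0 => [/allP h i|i _]; last exact: sqr_ge0.
by apply/eqP; rewrite -sqrf_eq0; apply: h; rewrite mem_index_enum.
Qed.

Lemma measurable_inner n d (T : measurableType d) (f g : T -> n.-tuple R) :
  measurable_fun setT f -> measurable_fun setT g ->
  measurable_fun setT (fun t => inner (f t) (g t)).
Proof.
move=> mf mg; apply: measurable_sum => i.
by apply: measurable_funM; exact: measurable_tnth_comp.
Qed.

(** The identity for [h = 0]. *)
Definition reflect_tuple n (h v : n.-tuple R) : n.-tuple R :=
  tadd v (tscale (- (2 * inner v h / nsq h)) h).

Lemma inner_reflect n (h v w : n.-tuple R) :
  inner (reflect_tuple h v) w = inner v w - 2 * inner v h / nsq h * inner h w.
Proof. by rewrite innerDl innerZl mulNr. Qed.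

Lemma reflect_tupleD n (h : n.-tuple R) : {morph reflect_tuple h : v w / tadd v w}.
Proof.
move=> v w; apply: eq_from_tnth => i; rewrite !tnth_mktuple innerDl.
by ring.
Qed.

Lemma reflect_tupleK n (h : n.-tuple R) : involutive (reflect_tuple h).
Proof.
move=> v; apply: eq_from_tnth => i; rewrite !tnth_mktuple inner_reflect inner_nsq.
have [h0|h0] := eqVneq (nsq h) 0; first by rewrite h0 invr0; ring.
by field.
Qed.

Lemma inner_reflect_reflect n (h v w : n.-tuple R) :
  inner (reflect_tuple h v) (reflect_tuple h w) = inner v w.
Proof.
rewrite inner_reflect !(innerC _ (reflect_tuple h w)) !inner_reflect.
rewrite inner_nsq (innerC w h) (innerC w v) (innerC h v).
have [h0|h0] := eqVneq (nsq h) 0; first by rewrite h0 invr0; ring.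
by field.
Qed.

Lemma nsq_reflect n (h v : n.-tuple R) : nsq (reflect_tuple h v) = nsq v.
Proof. by rewrite -!inner_nsq inner_reflect_reflect. Qed.

Lemma measurable_reflect n (h : n.-tuple R) : measurable_fun setT (reflect_tuple h).
Proof.
apply: (measurable_tadd (f := id)); first exact: measurable_id.
apply: measurable_tscale; last exact: measurable_cst.
apply: measurableT_comp => //; apply: measurable_funM; last exact: measurable_cst.
apply: measurable_funM; first exact: measurable_cst.
by apply: measurable_inner; [exact: measurable_id|exact: measurable_cst].
Qed.

(** Equal norms give |u - w|^2 = 2 <u, u - w>, so the reflection subtracts exactly u - w from u. If
    u = w the reflection is the identity. *)
Lemma reflect_swap n (u w : n.-tuple R) : nsq u = nsq w ->
  reflect_tuple (tadd u (topp w)) u = w.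
Proof.
move=> uw; set h := tadd u _.
have hE : nsq h = 2 * inner u h.
  rewrite -inner_nsq {1}/h innerDl innerNl /h !innerDr !innerNr !inner_nsq uw.
  by rewrite (innerC w u); ring.
apply: eq_from_tnth => i.
have [h0|h0] := eqVneq (nsq h) 0.
  have := nsq_eq0 h0 i; rewrite !tnth_mktuple => E; rewrite E mulr0 addr0.
  by apply/eqP; rewrite -subr_eq0 E.
rewrite !tnth_mktuple -hE divff// mulN1r; by ring.
Qed.

End householder.

Lemma measurable_sqrt_comp d (T : measurableType d) (R : realType) (f : T -> R) :
  measurable_fun setT f -> measurable_fun setT (fun x => Num.sqrt (f x)).
Proof.
move=> mf; have ms : measurable_fun setT (fun x : R => Num.sqrt x).
  by apply: continuous_measurable_fun; exact: sqrt_continuous.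
exact: (measurableT_comp ms mf).
Qed.

Section caps.
Local Open Scope ereal_scope.
Context {R : realType}.
Implicit Types (n m : nat) (y : R).

Definition basis0 n : n.+1.-tuple R := [tuple of 1%R :: nseq_tuple n 0%R].

Lemma inner_basis0 n (v : n.+1.-tuple R) : inner v (basis0 n) = tnth v ord0.
Proof.
rewrite /inner big_ord_recl tnth0 mulr1 big1 ?addr0// => i _.
by rewrite tnthS tnth_nseq mulr0.
Qed.

Lemma nsq_basis0 n : nsq (basis0 n) = 1%R.
Proof. by rewrite -inner_nsq inner_basis0 tnth0. Qed.

(** The cone over the spherical double cap, cleared of the division by the norm and without its
    apex. *)
Definition cap n (u : n.-tuple R) y : set (n.-tuple R) :=
  [set v | (0 < nsq v)%R /\ (y * nsq v <= inner v u ^+ 2)%R].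

Lemma measurable_cap n (u : n.-tuple R) y : measurable (cap u y).
Proof.
have mn : measurable_fun setT (@nsq R n).
  by apply: measurable_nsq; exact: measurable_id.
apply: measurableI.
  by apply: measurable_set_lt => //; exact: measurable_cst.
apply: measurable_set_le; first exact: measurable_funM.
apply: measurable_funX; apply: measurable_inner; first exact: measurable_id.
exact: measurable_cst.
Qed.

Lemma lebn_cap n (u w : n.-tuple R) y : nsq u = nsq w ->
  lebn (@tball R n `&` cap u y) = lebn (@tball R n `&` cap w y).
Proof.
move=> uw; pose Q := reflect_tuple (tadd u (topp w)).
rewrite -[RHS](lebn_isometry (Q := Q)); last 5 first.
- exact: measurable_reflect.
- exact: reflect_tupleK.
- exact: reflect_tupleD.
- exact: nsq_reflect.
- apply: measurableI; [exact: measurable_tball|exact: measurable_cap].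
congr (lebn _); apply/seteqP.
have E v : inner (Q v) w = inner v u.
  by rewrite -(reflect_swap uw) inner_reflect_reflect.
by split=> v; rewrite /tball /cap /= E /Q nsq_reflect.
Qed.

Lemma lebn_nsq_le0 m : lebn [set z : m.+1.-tuple R | (nsq z <= 0)%R] = 0.
Proof.
have -> : [set z : m.+1.-tuple R | (nsq z <= 0)%R] = @rect _ R m.+1 (fun=> [set (0%R : R)]).
  apply/seteqP; split=> z /=.
    move=> z0 i; apply: nsq_eq0; apply/eqP.
    by rewrite eq_le z0 nsq_ge0.
  by move=> z0; rewrite /nsq big1// => i _; rewrite z0 expr0n.
rewrite /lebn tuple_measure_rect// big_ord_recl.
by rewrite [X in X * _](_ : _ = 0) ?mul0e//; exact: lebesgue_measure_set1.
Qed.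

Definition cone n (C : set (n.-tuple R)) :=
  forall r v, (0 < r)%R -> C (tscale r v) <-> C v.

Lemma lebn_cone_ball m (C : set (m.+1.-tuple R)) (r : R) : measurable C -> cone C ->
  lebn [set z | C z /\ (nsq z <= r)%R] =
  (Num.sqrt r ^+ m.+1)%:E * lebn (@tball R m.+1 `&` C).
Proof.
move=> mC coneC.
have mS (s : R) : measurable [set z : m.+1.-tuple R | (nsq z <= s)%R].
  apply: measurable_set_le; first by apply: measurable_nsq; exact: measurable_id.
  exact: measurable_cst.
(* For r <= 0 the set lies in the null set reduced to the origin, and [Num.sqrt r] is 0 on the other
   side. *)
have [r0|r0] := leP r 0%R.
  rewrite ler0_sqrtr// exprS mul0r mul0e; apply/eqP; rewrite eq_le; apply/andP.
  split; last exact: measure_ge0.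
  rewrite -(lebn_nsq_le0 m); apply: le_measure; rewrite ?inE//.
    exact: (measurableI _ _ mC (mS r)).
  by move=> z /= [_ /le_trans]; exact.
have s0 : (0 < (Num.sqrt r)^-1)%R by rewrite invr_gt0 sqrtr_gt0.
have := lebn_scale s0 (measurableI _ _ (@measurable_tball R m.+1) mC); rewrite invrK => <-.
have E (z : m.+1.-tuple R) : (nsq (tscale (Num.sqrt r)^-1 z) <= 1)%R = (nsq z <= r)%R.
  by rewrite tscale_nsq exprVn (sqr_sqrtr (ltW r0)) ler_pdivrMl// mulr1.
congr (lebn _); apply/seteqP; split=> z /= []; rewrite /tball /= E.
  by move=> Cz zr; split=> //; apply/coneC.
by move=> zr /(coneC _ _ s0) ?; split.
Qed.

Lemma lebn_ball m (r : R) :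
  lebn [set z : m.+1.-tuple R | (nsq z <= r)%R] =
  (Num.sqrt r ^+ m.+1)%:E * lebn (@tball R m.+1).
Proof.
rewrite -[X in _ * lebn X]setIT -lebn_cone_ball//.
by congr (lebn _); apply/seteqP; split=> z //= [].
Qed.

Lemma nsq_cons n x (z : n.-tuple R) :
  nsq [tuple of x :: z] = (x ^+ 2 + nsq z)%R.
Proof.
by rewrite /nsq big_ord_recl tnth0; congr (_ + _)%R; apply: eq_bigr => i _; rewrite tnthS.
Qed.

Lemma inner_cons n x y (z w : n.-tuple R) :
  inner [tuple of x :: z] [tuple of y :: w] = (x * y + inner z w)%R.
Proof.
rewrite /inner big_ord_recl !tnth0; congr (_ + _)%R.
by apply: eq_bigr => i _; rewrite !tnthS.
Qed.

(** At first coordinate x, the ball requires |z|^2 <= 1 - x^2 and the cone requires |z|^2 <= x^2 (1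
    - y) / y, so the slice is a ball whose squared radius is the minimum. *)
Lemma lebn_cap_slices m y : (0 < y <= 1)%R ->
  lebn (@tball R m.+2 `&` cap (basis0 m.+1) y) =
  (\int[leb]_x (Num.sqrt (Num.min (1 - x ^+ 2) (x ^+ 2 * ((1 - y) / y))) ^+ m.+1)%:E)
  * lebn (@tball R m.+1).
Proof.
move=> /andP[y0 y1].
rewrite /lebn tuple_measureS -ge0_integralZr//; last first.
  apply/measurable_EFinP/measurable_funX/measurable_sqrt_comp.
  apply: measurable_minr; first exact: measurable_funB.
  exact: measurable_funM.
apply: eq_integral => x _; rewrite -!/(lebn _) -lebn_ball.
(* At x = 0 the two sets differ: the apex is missing from the cap, while the ball of radius 0
   contains it. Both are null. *)
have [->|x0] := eqVneq x 0%R.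
  transitivity (0 : \bar R).
    rewrite -[RHS](measure0 (@lebn R m.+1)); congr (lebn _); apply/seteqP; split=> // z.
    rewrite /tball /cap /= inner_basis0 tnth0 nsq_cons expr0n/= add0r.
    by move=> [_ [z0]]; rewrite pmulr_rle0// leNgt z0.
  apply/esym; rewrite expr0n/= subr0 mul0r min_r//; exact: lebn_nsq_le0.
have xx0 : (0 < x ^+ 2)%R by rewrite exprn_even_gt0.
congr (lebn _); apply/seteqP; split=> z;
  rewrite /tball /cap /= inner_basis0 tnth0 nsq_cons le_min.
- move=> [z1 [z0 zy]]; rewrite lerBrDl z1/= mulrA ler_pdivlMr//.
  by move: zy; rewrite !mulrDr; nra.
- rewrite lerBrDl mulrA ler_pdivlMr// => /andP[z1 zy]; split=> //; split.
    by rewrite ltr_pwDl// nsq_ge0.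
  by nra.
Qed.

Lemma lebn_ball_slices m :
  lebn (@tball R m.+2) =
  (\int[leb]_x (Num.sqrt (1 - x ^+ 2) ^+ m.+1)%:E) * lebn (@tball R m.+1).
Proof.
rewrite {1}/lebn tuple_measureS -ge0_integralZr//; last first.
  apply/measurable_EFinP/measurable_funX/measurable_sqrt_comp.
  exact: measurable_funB.
apply: eq_integral => x _; rewrite -!/(lebn _) -lebn_ball.
congr (lebn _); apply/seteqP; split=> z; rewrite /tball /= nsq_cons; by rewrite lerBrDl.
Qed.

End caps.

(** * The profile of caps *)

Section real_derivatives.
Context {R : realType}.
Implicit Types (f g h : R -> R) (x : R).

Lemma der_cst (c : R) x : is_derive x 1 (fun=> c) 0.
Proof. exact: is_derive_cst. Qed.

Lemma der_id x : is_derive x 1 (fun t : R => t) 1.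
Proof. exact: is_derive_id. Qed.

Lemma derD f g x a b : is_derive x 1 f a -> is_derive x 1 g b ->
  is_derive x 1 (fun t => f t + g t) (a + b).
Proof. exact: is_deriveD. Qed.

Lemma derB f g x a b : is_derive x 1 f a -> is_derive x 1 g b ->
  is_derive x 1 (fun t => f t - g t) (a - b).
Proof. exact: is_deriveB. Qed.

Lemma derM f g x a b : is_derive x 1 f a -> is_derive x 1 g b ->
  is_derive x 1 (fun t => f t * g t) (a * g x + f x * b).
Proof.
move=> fa gb; rewrite addrC [a * _]mulrC; exact: (is_deriveM fa gb).
Qed.

Lemma derMl (c : R) f x a : is_derive x 1 f a -> is_derive x 1 (fun t => c * f t) (c * a).
Proof. by move=> fa; have := derM (der_cst c x) fa; rewrite mul0r add0r. Qed.

Lemma derX f x a n : is_derive x 1 f a ->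
  is_derive x 1 (fun t => f t ^+ n) (n%:R * f x ^+ n.-1 * a).
Proof.
move=> fa; have := is_deriveX n fa; rewrite /GRing.scale /=.
congr is_derive; apply/funext => t.
by elim: n => [|n IH]; rewrite ?expr0// !exprS fctE IH.
Qed.

Lemma der_comp f g x a b : is_derive (g x) 1 f a -> is_derive x 1 g b ->
  is_derive x 1 (fun t => f (g t)) (a * b).
Proof. exact: is_derive1_comp. Qed.

Lemma der_continuous f x a : is_derive x 1 f a -> {for x, continuous f}.
Proof.
move=> fa; apply: differentiable_continuous; apply/derivable1_diffP.
by case: fa.
Qed.

Lemma cont_comp f g x : {for x, continuous f} -> {for f x, continuous g} ->
  {for x, continuous (fun t => g (f t))}.
Proof. exact: continuous_comp. Qed.

Lemma nondecreasing_is_derive h dh a b : a <= b ->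
  (forall x, a < x < b -> is_derive x 1 h (dh x)) ->
  (forall x, a < x < b -> 0 <= dh x) ->
  (forall x, a <= x <= b -> {for x, continuous h}) -> h a <= h b.
Proof.
move=> ab hd d0 hc.
apply: (@ger0_derive1_ndecr _ h a b) => // [x|x|].
- by rewrite in_itv /= => /hd -[].
- rewrite in_itv /= => xab; have hx := hd _ xab.
  by rewrite derive1E derive_val d0.
- apply: continuous_in_subspaceT => x.
  by rewrite inE /= in_itv /=; exact: hc.
Qed.

End real_derivatives.

Section cap_profile.
Context {R : realType}.
Notation mu := (@lebesgue_measure R).
Variable m : nat.
Implicit Types x t : R.

Definition slice t : R := Num.sqrt (1 - t ^+ 2) ^+ m.

(** Starting at -1 makes 0 an interior point, where the primitive is differentiable. *)
Definition slice_int x : R := \int[mu]_(t in `[-1, x]) slice t.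

(** Up to a constant factor, the volume of [{v | x |v| <= v_0, |v| <= 1}]. *)
Definition profile x : R := x * slice x / m.+1%:R + (slice_int 1 - slice_int x).

Lemma slice_continuous : continuous slice.
Proof.
move=> x; apply: (@cont_comp _ (fun t => Num.sqrt (1 - t ^+ 2)) (fun s => s ^+ m)); last exact: exprn_continuous.
apply: (@cont_comp _ (fun t => 1 - t ^+ 2) Num.sqrt); last exact: sqrt_continuous.
apply: (der_continuous (a := 0 - 2%:R * x ^+ 1 * 1)).
exact: (derB (der_cst 1 x) (derX 2 (der_id x))).
Qed.

Lemma slice_ge0 x : 0 <= slice x.
Proof. by rewrite exprn_ge0// sqrtr_ge0. Qed.

Lemma slice_le1 x : slice x <= 1.
Proof.
rewrite exprn_ile1 ?sqrtr_ge0// -[leRHS]sqrtr1 ler_wsqrtr//.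
by rewrite gerBl sqr_ge0.
Qed.

Lemma slice_eq0 x : (0 < m)%N -> 1 <= x ^+ 2 -> slice x = 0.
Proof. by move=> m0 x1; rewrite /slice ler0_sqrtr ?subr_le0// expr0n -leqn0 leqNgt m0. Qed.

(** The derivative of (1 - x^2)^(m/2), with (1 - x^2)^(m/2 - 1) written as a quotient because the
    natural exponent m - 2 would be wrong for m = 1. *)
Lemma slice_der x : x ^+ 2 < 1 ->
  is_derive x 1 slice (- (m%:R * x * (slice x / (1 - x ^+ 2)))).
Proof.
move=> x1; have p0 : 0 < 1 - x ^+ 2 by rewrite subr_gt0.
have s0 : 0 < Num.sqrt (1 - x ^+ 2) by rewrite sqrtr_gt0.
have d1 : is_derive x 1 (fun t : R => 1 - t ^+ 2) (0 - 2%:R * x ^+ 1 * 1).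
  exact: (derB (der_cst 1 x) (derX 2 (der_id x))).
have := derX m (@der_comp _ Num.sqrt (fun t => 1 - t ^+ 2) _ _ _ (is_derive1_sqrt p0) d1).
move=> H; apply: (is_derive_eq H); rewrite /slice.
have E : 1 - x ^+ 2 = Num.sqrt (1 - x ^+ 2) ^+ 2 by rewrite sqr_sqrtr// ltW.
rewrite [X in _ / X]E; case: m => [|k]; first by rewrite !mul0r oppr0.
rewrite /= [X in _ = - (_ * (X / _))]exprS.
by move: s0; set s := Num.sqrt _ => s0; field; rewrite gt_eqF.
Qed.

Lemma slice_integrable (a b : R) : mu.-integrable `[a, b] (EFin \o slice).
Proof.
apply: continuous_compact_integrable; first exact: segment_compact.
by apply: continuous_subspaceT => x; exact: slice_continuous.
Qed.

Lemma slice_int_der x : -1 < x < 2 -> is_derive x 1 slice_int (slice x).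
Proof.
move=> /andP[x1 x2].
(* The upper end 2 makes 1 interior too, which yields continuity of [profile] there. *)
have [] := continuous_FTC1_closed x2 (slice_integrable (-1) 2) x1 (@slice_continuous x).
by move=> dF dFE; apply: (DeriveDef dF); rewrite -derive1E.
Qed.

Lemma slice_int_continuous x : -1 < x < 2 -> {for x, continuous slice_int}.
Proof. by move=> /slice_int_der; exact: der_continuous. Qed.

(** The terms in x^2 cancel and leave a multiple of (1 - x^2)^(m/2 - 1), the density of one
    coordinate of a uniform point of the sphere of R^(m+1). *)
Lemma profile_der x : -1 < x < 1 ->
  is_derive x 1 profile (- (m%:R / m.+1%:R * (slice x / (1 - x ^+ 2)))).
Proof.
move=> /andP[x0 x1].
have xx : x ^+ 2 < 1 by nra.
have := derD (derMl m.+1%:R^-1 (derM (der_id x) (slice_der xx)))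
  (derB (der_cst (slice_int 1) x) (slice_int_der (x := x) _)).
rewrite (_ : (fun t => _) = profile); last first.
  by apply/funext => t; rewrite /profile mulrC.
move=> H; apply: is_derive_eq; first by apply: H; lra.
have m0 : m.+1%:R != 0 :> R by [].
have xn : 1 - x ^+ 2 != 0 by rewrite gt_eqF// subr_gt0.
rewrite -natr1 in m0 *.
by field; rewrite m0 xn.
Qed.

Lemma profile_continuous x : -1 < x < 2 -> {for x, continuous profile}.
Proof.
move=> x12; apply: continuousD.
  apply: continuousM; last exact: cst_continuous.
  by apply: continuousM; [exact: (der_continuous (der_id x))|exact: slice_continuous].
by apply: continuousB; [exact: cst_continuous|exact: slice_int_continuous].
Qed.

Hypothesis m0 : (0 < m)%N.

Lemma slice1 : slice 1 = 0.
Proof. by rewrite slice_eq0// expr1n. Qed.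

Lemma slice0 : slice 0 = 1.
Proof. by rewrite /slice expr0n/= subr0 sqrtr1 expr1n. Qed.

Lemma profile1 : profile 1 = 0.
Proof. by rewrite /profile slice1 mulr0 mul0r subrr addr0. Qed.

(** A Mills ratio bound: on [x, 1] the integrand of [profile] grows when multiplied by t / x >= 1,
    and then has the primitive - [slice t / x] up to the factor m + 1. *)
Lemma profile_ub x : 0 < x <= 1 -> m.+1%:R * profile x <= slice x / x.
Proof.
move=> /andP[x0 x1].
pose h t := m.+1%:R * profile t - x^-1 * slice t.
suff : h x <= h 1 by rewrite /h profile1 slice1 !mulr0 subrr subr_le0 (mulrC x^-1).
apply: (nondecreasing_is_derive (h := h) (dh := (fun t => m%:R * (slice t / (1 - t ^+ 2)) * (t / x - 1))) x1).
- move=> t /andP[xt t1].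
  have tt : t ^+ 2 < 1 by nra.
  have := derB (derMl m.+1%:R (profile_der (x := t) _)) (derMl x^-1 (slice_der tt)).
  move=> H; apply: is_derive_eq; first by apply: H; lra.
  have mn0 : m.+1%:R != 0 :> R by [].
  have xn : 1 - t ^+ 2 != 0 by rewrite gt_eqF// subr_gt0.
  rewrite -natr1 in mn0 *; field; rewrite mn0 xn; lra.
- move=> t /andP[xt t1]; rewrite mulr_ge0//.
    rewrite mulr_ge0// divr_ge0 ?slice_ge0// subr_ge0; nra.
  by rewrite subr_ge0 ler_pdivlMr// mul1r ltW.
- move=> t /andP[xt t1]; apply: continuousB; apply: continuousM; try exact: cst_continuous.
    by apply: profile_continuous; lra.
  exact: slice_continuous.
Qed.

(** The converse comparison, with the factor t / b <= 1 on [a, b]; it is sharp only when a is close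
    to b. *)
Lemma profile_lb a b : 0 <= a -> a <= b -> b <= 1 -> 0 < b ->
  (slice a - slice b) / b <= m.+1%:R * (profile a - profile b).
Proof.
move=> a0 ab b1 b0.
pose h t := b^-1 * slice t - m.+1%:R * profile t.
suff : h a <= h b by rewrite /h; lra.
apply: (nondecreasing_is_derive (h := h) (dh := (fun t => m%:R * (slice t / (1 - t ^+ 2)) * (1 - t / b))) ab).
- move=> t /andP[xt t1].
  have tt : t ^+ 2 < 1 by nra.
  have := derB (derMl b^-1 (slice_der tt)) (derMl m.+1%:R (profile_der (x := t) _)).
  move=> H; apply: is_derive_eq; first by apply: H; lra.
  have mn0 : m.+1%:R != 0 :> R by [].
  have xn : 1 - t ^+ 2 != 0 by rewrite gt_eqF// subr_gt0.
  rewrite -natr1 in mn0 *; field; rewrite mn0 xn; lra.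
- move=> t /andP[xt t1]; rewrite mulr_ge0//.
    rewrite mulr_ge0// divr_ge0 ?slice_ge0// subr_ge0; nra.
  by rewrite subr_ge0 ler_pdivrMr// mul1r ltW.
- move=> t /andP[xt t1]; apply: continuousB; apply: continuousM; try exact: cst_continuous.
    exact: slice_continuous.
  by apply: profile_continuous; lra.
Qed.

Lemma profile_ge0 a : 0 <= a <= 1 -> 0 <= profile a.
Proof.
move=> /andP[a0 a1]; have := profile_lb a0 a1 (lexx 1) ltr01.
rewrite slice1 profile1 !subr0 divr1 => /(le_trans (slice_ge0 a)).
by rewrite pmulr_rge0.
Qed.

Lemma profile0_gt0 : 0 < profile 0.
Proof.
have := profile_lb (lexx 0) ler01 (lexx 1) ltr01.
rewrite slice1 slice0 profile1 !subr0 divr1 => /(lt_le_trans ltr01).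
by rewrite pmulr_rgt0.
Qed.

Lemma profile0_le1 : profile 0 <= 1.
Proof.
rewrite /profile mul0r mul0r add0r.
pose h t := t - slice_int t.
suff : h 0 <= h 1 by rewrite /h; lra.
apply: (nondecreasing_is_derive (h := h) (dh := (fun t => 1 - slice t)) ler01).
- move=> t t01; have t12 : -1 < t < 2 by lra.
  exact: (derB (der_id t) (slice_int_der t12)).
- by move=> t _; rewrite subr_ge0 slice_le1.
- move=> t t01; apply: continuousB; first exact: (der_continuous (der_id t)).
  apply: slice_int_continuous; lra.
Qed.

(** For m > 1 the factor (1 - t^2)^(m/2 - 1) is at most 1, whereas for m = 1 it blows up at 1. *)
Lemma profile0_ub x : (1 < m)%N -> 0 <= x <= 1 ->
  m.+1%:R * (profile 0 - profile x) <= m%:R * x.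
Proof.
move=> m1 /andP[x0 x1].
pose h t := m%:R * t + m.+1%:R * profile t.
suff : h 0 <= h x by rewrite /h; lra.
apply: (nondecreasing_is_derive (h := h) (dh := (fun t => m%:R * (1 - slice t / (1 - t ^+ 2)))) x0).
- move=> t /andP[xt t1].
  have := derD (derMl m%:R (der_id t)) (derMl m.+1%:R (profile_der (x := t) _)).
  move=> H; apply: is_derive_eq; first by apply: H; lra.
  have mn0 : m.+1%:R != 0 :> R by [].
  have xn : 1 - t ^+ 2 != 0 by rewrite gt_eqF// subr_gt0; nra.
  rewrite -natr1 in mn0 *; field; by rewrite mn0 xn.
- move=> t /andP[t0 tx]; rewrite mulr_ge0// subr_ge0.
  have tt : 0 < 1 - t ^+ 2 by rewrite subr_gt0; nra.
  rewrite ler_pdivrMr// mul1r /slice -{2}(sqr_sqrtr (ltW tt)).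
  apply: ler_wiXn2l; rewrite ?sqrtr_ge0//.
  by rewrite -[leRHS]sqrtr1 ler_wsqrtr// gerBl sqr_ge0.
- move=> t /andP[xt t1]; apply: continuousD; apply: continuousM; try exact: cst_continuous.
    exact: (der_continuous (der_id t)).
  by apply: profile_continuous; lra.
Qed.

End cap_profile.

(** * The profile and the Beta function *)

Section integrals.
Local Open Scope ereal_scope.
Context {R : realType}.
Notation mu := (@lebesgue_measure R).
Implicit Types (f g F : R -> R).

Lemma integral_is_derive f F (a b : R) : (a <= b)%R ->
  (forall x : R, (a <= x <= b)%R -> {for x, continuous f}) ->
  (forall x : R, (a <= x <= b)%R -> is_derive x 1%R F (f x)) ->
  \int[mu]_(x in `[a, b]) (f x)%:E = (F b - F a)%:E.
Proof.
rewrite le_eqVlt => /predU1P[->|ab] fc Fd.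
  by rewrite set_itv1 integral_set1 subrr.
have Fc x : (a <= x <= b)%R -> {for x, continuous F}.
  by move=> /Fd; exact: der_continuous.
rewrite (@continuous_FTC2 _ f F)//.
- apply: continuous_in_subspaceT => x; rewrite inE /= in_itv /=; exact: fc.
- split.
  + by move=> x; rewrite in_itv /= => /andP[ax xb]; have [] := Fd x; rewrite ?ltW//.
  + by apply: cvg_at_right_filter; apply: Fc; rewrite lexx ltW.
  + by apply: cvg_at_left_filter; apply: Fc; rewrite lexx ltW.
- move=> x; rewrite in_itv /= => /andP[ax xb].
  have Fx : is_derive x 1%R F (f x) by apply: Fd; rewrite !ltW.
  by rewrite derive1E derive_val.
Qed.

(** A fundamental theorem for integrands that may be singular at both ends: only F is continuous
    there. Monotone convergence extends it from compact subintervals. *)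
Lemma integral_itvoo01_is_derive f F :
  (forall x : R, (0 < x < 1)%R -> (0 <= f x)%R) ->
  (forall x : R, (0 < x < 1)%R -> {for x, continuous f}) ->
  (forall x : R, (0 < x < 1)%R -> is_derive x 1%R F (f x)) ->
  {for 0%R, continuous F} -> {for 1%R, continuous F} ->
  \int[mu]_(x in `]0%R, 1%R[) (f x)%:E = (F 1 - F 0)%:E.
Proof.
move=> f0 fc Fd F0 F1.
(* The shift by 2 keeps e k at most 1/2, so that each [D k] is nonempty. *)
pose e (k : nat) : R := (k.+2%:R^-1)%R.
have e0 k : (0 < e k)%R by rewrite invr_gt0.
have e1 k : (e k <= 2^-1)%R by rewrite lef_pV2 ?posrE// ler_nat.
pose D k : set R := `[e k, (1 - e k)%R]%classic.
have Dsub k x : D k x -> (0 < x < 1)%R.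
  by rewrite /D /= in_itv /=; have := e0 k; lra.
have ecvg : e k @[k --> \oo] --> 0%R.
  by have := @cvg_harmonic R; rewrite -cvg_shiftS.
have UD : \bigcup_k D k = `]0%R, 1%R[%classic.
  apply/seteqP; split=> x /=; rewrite in_itv /=; first by move=> [k _ /Dsub].
  move=> /andP[x0 x1].
  have : (0 < Num.min x (1 - x))%R by rewrite lt_min x0 subr_gt0.
  move=> /(cvgr_lt _ ecvg) [N _ /(_ N (leqnn N))] /=.
  rewrite lt_min => /andP[eN1 eN2]; exists N => //.
  by rewrite /D /= in_itv /= ltW//=; lra.
have mfD k : measurable_fun (D k) (EFin \o f).
  apply/measurable_EFinP; apply: subspace_continuous_measurable_fun.
    exact: measurable_itv.
  apply: continuous_in_subspaceT => x /set_mem /Dsub; exact: fc.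
have cE k : \int[mu]_(x in D k) (f x)%:E = (F (1 - e k) - F (e k))%:E.
  apply: integral_is_derive; first by have := e1 k; lra.
  - by move=> x xk; apply: fc; apply: (Dsub k); rewrite /D /= in_itv.
  - by move=> x xk; apply: Fd; apply: (Dsub k); rewrite /D /= in_itv.
have L : \int[mu]_(x in D k) (f x)%:E @[k --> \oo] --> (F 1 - F 0)%:E.
  rewrite (_ : (fun k => _) = EFin \o (fun k => F (1 - e k) - F (e k))%R); last first.
    by apply/funext => k; exact: cE.
  apply: cvg_EFin; first exact: nearW.
  apply: cvgB.
    have e1cvg : (1 - e k)%R @[k --> \oo] --> (1 - 0 : R)%R.
      by apply: cvgB => //; exact: cvg_cst.
    rewrite subr0 in e1cvg; exact: (cvg_comp (fun k => 1 - e k)%R F e1cvg F1).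
  exact: (cvg_comp e F ecvg F0).
rewrite -UD; apply: cvg_unique L => //.
apply: (@ge0_nondecreasing_set_cvg_integral _ (measurableTypeR R) R D (EFin \o f) mu).
- move=> i j ij; apply/subsetPset => x; rewrite /D /= !in_itv /=.
  have : (e j <= e i)%R by rewrite lef_pV2 ?posrE// ler_nat !ltnS.
  by lra.
- by move=> k; exact: measurable_itv.
- exact: mfD.
- by move=> k x Dx; rewrite lee_fin; exact: f0 (Dsub _ _ Dx).
Qed.

Lemma integral_eq_setS (D E : set R) f : measurable D -> measurable E -> E `<=` D ->
  (forall x, D x -> ~ E x -> f x = 0%R) ->
  \int[mu]_(x in D) (f x)%:E = \int[mu]_(x in E) (f x)%:E.
Proof.
move=> mD mE ED f0; rewrite integral_mkcond [RHS]integral_mkcond.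
apply: eq_integral => x _; rewrite !patchE.
have [xE|xE] := boolP (x \in E).
  by rewrite mem_set//; exact/ED/set_mem.
case: ifPn => // xD; rewrite f0//; first exact: set_mem.
by move=> /mem_set; rewrite (negbTE xE).
Qed.

Lemma integral_itv_cat f (a b c : R) : (a <= b)%R -> (b <= c)%R ->
  (forall x, 0 <= f x)%R -> measurable_fun setT f ->
  \int[mu]_(x in `[a, c]) (f x)%:E =
  \int[mu]_(x in `[a, b]) (f x)%:E + \int[mu]_(x in `[b, c]) (f x)%:E.
Proof.
move=> ab bc f0 mf.
rewrite -[X in _ = _ + X]integral_itv_obnd_cbnd; last exact/measurable_EFinP/measurable_funTS.
rewrite -ge0_integral_setU//=; first last.
- apply/disj_setPS => x /=; rewrite !in_itv /= => -[]; lra.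
- by move=> x _; rewrite lee_fin.
- exact/measurable_EFinP/measurable_funTS.
congr integral; apply/seteqP; split=> x /=; rewrite !in_itv /=; last first.
  by move=> -[]; lra.
by have [xb|xb] := leP x b; [left|right]; lra.
Qed.

End integrals.

Section slice_integrals.
Local Open Scope ereal_scope.
Context {R : realType} (m : nat).
Notation mu := (@lebesgue_measure R).
Implicit Types x y : R.
Hypothesis m0 : (0 < m)%N.

Lemma measurable_slice : measurable_fun setT (@slice R m).
Proof. by apply: continuous_measurable_fun; exact: slice_continuous. Qed.

Lemma integral_slice_itv x : (0 <= x <= 1)%R ->
  \int[mu]_(t in `[x, 1%R]) (slice m t)%:E = (slice_int m 1 - slice_int m x)%:E.
Proof.
move=> /andP[x0 x1]; apply: integral_is_derive => // t /andP[xt t1].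
  exact: slice_continuous.
by apply: slice_int_der; lra.
Qed.

(** [Num.sqrt] is 0 on negative numbers, so [slice] is an even function supported in [-1, 1] and the
    integral over the line is twice that over [0, 1]. *)
Lemma integral_slice : \int[leb]_x (slice m x)%:E = (2 * profile m 0)%:E :> \bar R.
Proof.
rewrite ge0_integral_leb; [|exact: measurableT| |by move=> x _; rewrite lee_fin slice_ge0]; last first.
  by apply/measurable_EFinP; exact: measurable_slice.
rewrite ge0_symfun_integralT//; last 3 first.
- exact: slice_ge0.
- exact: slice_continuous.
- by move=> x; rewrite /slice /= sqrrN.
rewrite EFinM; congr (_ * _).
rewrite (@integral_eq_setS _ _ `[0%R, 1%R]%classic)//; first last.
- move=> x /= x0 /negP; rewrite in_itv /= x0/= -ltNge => x1.
  by apply: slice_eq0 => //; rewrite expr_ge1// ltW.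
- by move=> x /=; rewrite in_itv /= => /andP[].
- by rewrite -set_itvcy; exact: measurable_itv.
by rewrite integral_slice_itv ?lexx ?ler01//; congr EFin; rewrite /profile !mul0r add0r.
Qed.

(** Here y is the height of the cap, not its square. Below height y the cone limits the slices and
    their volume is a monomial in x, which integrates to the first term of [profile]; above it the
    ball limits them and gives the second term. *)
Lemma integral_cap_slice y : (0 < y <= 1)%R ->
  \int[leb]_x (Num.sqrt (Num.min (1 - x ^+ 2) (x ^+ 2 * ((1 - y ^+ 2) / y ^+ 2))) ^+ m)%:E =
  (2 * profile m y)%:E :> \bar R.
Proof.
move=> /andP[y0 y1]; set t := ((1 - y ^+ 2) / y ^+ 2)%R.
have yy0 : (0 < y ^+ 2)%R by rewrite exprn_gt0.
have yy1 : (y ^+ 2 <= 1)%R by rewrite exprn_ile1// ltW.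
have t0 : (0 <= t)%R by rewrite divr_ge0 ?subr_ge0// ltW.
pose f x : R := (Num.sqrt (Num.min (1 - x ^+ 2) (x ^+ 2 * t)) ^+ m)%R.
have fc : continuous f.
  have sq x : {for x, continuous (fun x : R => x ^+ 2)%R}.
    exact: (der_continuous (derX 2 (der_id x))).
  move=> x; apply: (@cont_comp _ (fun x => Num.sqrt (Num.min (1 - x ^+ 2) (x ^+ 2 * t))%R)
    (fun s => s ^+ m)%R); last exact: exprn_continuous.
  apply: (@cont_comp _ (fun x => Num.min (1 - x ^+ 2) (x ^+ 2 * t))%R (@Num.sqrt R)); last exact: sqrt_continuous.
  apply: (@continuous_min _ _ (fun x => 1 - x ^+ 2)%R (fun x => x ^+ 2 * t)%R).
    by apply: continuousB => //; exact: cst_continuous.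
  by apply: continuousM => //; exact: cst_continuous.
have f0 x : (0 <= f x)%R by rewrite exprn_ge0// sqrtr_ge0.
have mf : measurable_fun setT f by exact: continuous_measurable_fun.
rewrite ge0_integral_leb; [|exact: measurableT| |by move=> x _; rewrite lee_fin f0]; last first.
  exact/measurable_EFinP.
rewrite (@ge0_symfun_integralT _ f)//; last first.
  by move=> x; rewrite /f /= sqrrN.
rewrite EFinM; congr (_ * _).
rewrite (@integral_eq_setS _ _ `[0%R, 1%R]%classic)//; first last.
- move=> x /= x0 /negP; rewrite in_itv /= x0/= -ltNge => x1.
  rewrite /f ler0_sqrtr ?expr0n; first by case: m m0.
  by rewrite ge_min subr_le0 expr_ge1// ltW.
- by move=> x /=; rewrite in_itv /= => /andP[].
- by rewrite -set_itvcy; exact: measurable_itv.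
rewrite (@integral_itv_cat _ f _ y)//; last exact: ltW.
(* The two arguments of the minimum cross exactly at x = y. *)
have yt : (y ^+ 2 * t = 1 - y ^+ 2)%R by rewrite mulrC divfK// gt_eqF.
rewrite /profile EFinD; congr (_ + _).
- transitivity (\int[mu]_(x in `[0%R, y]) (Num.sqrt t ^+ m * x ^+ m)%:E).
    apply: eq_integral => x; rewrite inE /= in_itv /= => /andP[x0 xy].
    have xy2 : (x ^+ 2 <= y ^+ 2)%R by rewrite ler_pXn2r// ?nnegrE// ltW.
    rewrite /f min_r; last first.
      rewrite lerBrDl -{1}(mulr1 (x ^+ 2)%R) -mulrDr.
      have -> : (1 + t = (y ^+ 2)^-1)%R by rewrite /t; field; rewrite gt_eqF.
      by rewrite ler_pdivrMr// mul1r.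
    by rewrite sqrtrM ?sqr_ge0// sqrtr_sqr ger0_norm// exprMn mulrC.
  pose F x := (Num.sqrt t ^+ m / m.+1%:R * x ^+ m.+1)%R.
  transitivity (F y - F 0%R)%:E.
    apply: integral_is_derive; first exact: ltW.
      move=> x _; apply: (@continuousM _ _ (fun=> _) (fun x => x ^+ m)%R).
        exact: cst_continuous.
      exact: exprn_continuous.
    move=> x _; apply: (is_derive_eq (derMl _ (derX m.+1 (der_id x)))).
    by rewrite /=; field; rewrite addrC natr1.
  rewrite /F expr0n/= mulr0 subr0; congr EFin.
  rewrite /slice -yt (sqrtrM t (sqr_ge0 y)) sqrtr_sqr gtr0_norm// exprMn exprS.
  by ring.
- rewrite -integral_slice_itv; last by rewrite (ltW y0).
  apply: eq_integral => x.
  rewrite inE /= in_itv /= => /andP[yx x1].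
  have xy2 : (y ^+ 2 <= x ^+ 2)%R.
    by rewrite ler_pXn2r// ?nnegrE ?(ltW y0)// (le_trans (ltW y0)).
  rewrite /f /slice min_l//.
  rewrite lerBlDl -{1}(mulr1 (x ^+ 2)%R) -mulrDr.
  have -> : (1 + t = (y ^+ 2)^-1)%R by rewrite /t; field; rewrite gt_eqF.
  by rewrite ler_pdivlMr// mul1r.
Qed.

End slice_integrals.

Section beta.
Context {R : realType} (m : nat).
Hypothesis m0 : (0 < m)%N.

Lemma powR_half (a : R) n : 0 <= a -> a `^ (n%:R / 2) = Num.sqrt a ^+ n.
Proof.
move=> a0; rewrite mulrC powRrM powR12_sqrt// powR_mulrn// sqrtr_ge0.
Qed.

(** Under x = t^2 the Beta integrand becomes the derivative of [profile], so a primitive is a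
    multiple of [profile m (Num.sqrt x)]. The integrand is singular at 0, and at 1 as well when m =
    1. *)
Lemma Beta_profile :
  Beta (1 / 2) (m%:R / 2) = 2 * m.+1%:R / m%:R * profile m 0 :> R.
Proof.
pose f x : R := slice m (Num.sqrt x) / (1 - x) / Num.sqrt x.
pose F x : R := - (2 * m.+1%:R / m%:R) * profile m (Num.sqrt x).
have mn0 : m%:R != 0 :> R by rewrite pnatr_eq0 -lt0n.
have -> : Beta (1 / 2) (m%:R / 2) =
    fine (\int[lebesgue_measure]_(x in `]0%R, 1%R[) (f x)%:E)%E.
  rewrite /Beta /Rintegral; congr fine; apply: eq_integral => x.
  rewrite inE /= in_itv /= => /andP[x0 x1]; congr EFin.
  have -> : 1 / 2 - 1 = - 2^-1 :> R by field.
  have x10 : 0 < 1 - x by rewrite subr_gt0.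
  rewrite powRN (powR12_sqrt (ltW x0)) powRB; last by rewrite (gt_eqF x10) implybT.
  rewrite (powR_half _ (ltW x10)) (powRr1 (ltW x10)) /f /slice (sqr_sqrtr (ltW x0)).
  by rewrite mulrC.
suff -> : (\int[lebesgue_measure]_(x in `]0%R, 1%R[) (f x)%:E = (F 1 - F 0)%:E)%E.
  by rewrite /F sqrtr1 sqrtr0 profile1// mulr0 sub0r mulNr opprK.
apply: integral_itvoo01_is_derive.
- move=> x /andP[x0 x1]; rewrite /f !divr_ge0 ?slice_ge0 ?sqrtr_ge0// subr_ge0 ltW//.
- move=> x /andP[x0 x1].
  have c1 : {for x, continuous (fun x : R => slice m (Num.sqrt x))}.
    apply: (@cont_comp _ (@Num.sqrt R) (slice m)); first exact: sqrt_continuous.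
    exact: slice_continuous.
  have c2 : {for x, continuous (fun x : R => (1 - x)^-1)}.
    apply: cvgV; first by rewrite subr_eq0 gt_eqF.
    exact: (der_continuous (derB (der_cst 1 x) (der_id x))).
  have c3 : {for x, continuous (fun x : R => (Num.sqrt x)^-1)}.
    apply: cvgV; first by rewrite gt_eqF// sqrtr_gt0.
    exact: sqrt_continuous.
  exact: (continuousM (continuousM c1 c2) c3).
- move=> x /andP[x0 x1].
  have s0 : 0 < Num.sqrt x by rewrite sqrtr_gt0.
  have s1 : Num.sqrt x < 1 by rewrite -[ltRHS]sqrtr1 ltr_sqrt.
  have sx : Num.sqrt x ^+ 2 = x by rewrite sqr_sqrtr// ltW.
  have s01 : -1 < Num.sqrt x < 1 by rewrite s1 andbT (lt_trans _ s0)// ltrN10.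
  have := derMl (- (2 * m.+1%:R / m%:R)) (@der_comp _ (profile m) (@Num.sqrt R) _ _ _
    (profile_der m s01) (is_derive1_sqrt x0)).
  move=> H; apply: (is_derive_eq H); rewrite /f sx.
  have Mn0 : m.+1%:R != 0 :> R by [].
  have xn0 : 1 - x != 0 by rewrite gt_eqF// subr_gt0.
  rewrite -natr1 in Mn0 *.
  by field; rewrite mn0 Mn0 xn0 gt_eqF.
- apply: (@continuousM _ _ (fun=> _) (fun x => profile m (Num.sqrt x))).
    exact: cst_continuous.
  apply: (@cont_comp _ (@Num.sqrt R) (profile m)); first exact: sqrt_continuous.
  by apply: profile_continuous; rewrite sqrtr0; lra.
- apply: (@continuousM _ _ (fun=> _) (fun x => profile m (Num.sqrt x))).
    exact: cst_continuous.
  apply: (@cont_comp _ (@Num.sqrt R) (profile m)); first exact: sqrt_continuous.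
  by apply: profile_continuous; rewrite sqrtr1; lra.
Qed.

End beta.

(** * Caps of the sphere *)

Section sphere_caps.
Local Open Scope ereal_scope.
Context {R : realType} (k : nat).
Hypothesis k0 : (0 < k)%N.

Definition cap_prob (y : R) : R := (profile k (Num.sqrt y) / profile k 0)%R.

Lemma enormE n (v : n.-tuple R) : enorm v = Num.sqrt (nsq v).
Proof. by []. Qed.

Lemma lebn_tball_profile :
  lebn (@tball R k.+1) = (2 * profile k 0 : R)%:E * lebn (@tball R k).
Proof.
case: k k0 => // m _; rewrite lebn_ball_slices; congr (_ * _).
exact: integral_slice.
Qed.

Lemma lebn_cap_profile (u : k.+1.-tuple R) (y : R) : nsq u = 1%R -> (0 < y <= 1)%R ->
  lebn (@tball R k.+1 `&` cap u y) = (2 * profile k (Num.sqrt y))%:E * lebn (@tball R k).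
Proof.
case: k k0 u => // m _ u u1 /andP[y0 y1].
rewrite (lebn_cap _ (w := basis0 m.+1)) ?nsq_basis0// lebn_cap_slices ?y0//.
congr (_ * _); rewrite -integral_cap_slice//.
  by under [RHS]eq_integral do rewrite sqr_sqrtr ?ltW//.
by rewrite sqrtr_gt0 y0 -[leRHS]sqrtr1 ler_wsqrtr.
Qed.

Lemma lebn_cap_ratio (u : k.+1.-tuple R) (y : R) : nsq u = 1%R -> (0 < y <= 1)%R ->
  lebn (@tball R k.+1 `&` cap u y) = (cap_prob y)%:E * lebn (@tball R k.+1).
Proof.
move=> u1 y01; rewrite lebn_cap_profile// lebn_tball_profile muleA; congr (_ * _).
by rewrite -EFinM /cap_prob; congr EFin; field; rewrite gt_eqF// profile0_gt0.
Qed.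

Lemma sphere_surface_cap (u : k.+1.-tuple R) y :
  sphere_surface [set l | (y <= inner l u ^+ 2)%R] =
  k.+1%:R%:E * lebn (@tball R k.+1 `&` cap u y).
Proof.
rewrite /sphere_surface; congr (_ * _); rewrite -lebesgue_tupleE; last first.
  by apply: measurableI; [exact: measurable_tball|exact: measurable_cap].
congr lebesgue_tuple; apply/seteqP.
have E (v : k.+1.-tuple R) : (0 < nsq v)%R ->
    (y <= inner (tscale (enorm v)^-1 v) u ^+ 2)%R = (y * nsq v <= inner v u ^+ 2)%R.
  move=> v0; rewrite innerZl exprMn exprVn enormE (sqr_sqrtr (ltW v0)).
  by rewrite ler_pdivlMl// mulrC.
have E1 (v : k.+1.-tuple R) : (enorm v <= 1)%R = (nsq v <= 1)%R.
  by rewrite enormE -[X in (_ <= X)%R]sqrtr1 ler_sqrt.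
by split=> v; rewrite /tball /cap /= E1 enormE sqrtr_gt0 => -[];
  [move=> /andP[v0 v1]; rewrite -enormE E|move=> v1 [v0 vy]; rewrite v0 v1 -enormE E].
Qed.

Lemma sphere_surfaceT :
  sphere_surface [set: k.+1.-tuple R] = k.+1%:R%:E * lebn (@tball R k.+1).
Proof.
(* The whole space is a cap of level 0, whose cone misses only the origin. *)
have -> : [set: k.+1.-tuple R] = [set l | (0 <= inner l (basis0 k) ^+ 2)%R].
  by apply/seteqP; split=> v //= _; exact: sqr_ge0.
rewrite sphere_surface_cap; congr (_ * _).
have mc := measurable_cap (basis0 k) 0%R.
have mb := @measurable_tball R k.+1.
have mn : measurable [set z : k.+1.-tuple R | (nsq z <= 0)%R].
  apply: measurable_set_le; first by apply: measurable_nsq; exact: measurable_id.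
  exact: measurable_cst.
have mbc : measurable (@tball R k.+1 `&` cap (basis0 k) 0%R) by exact: measurableI.
apply/eqP; rewrite eq_le; apply/andP; split.
  apply: le_measure; rewrite ?inE; [exact: mbc|exact: mb|].
  exact: subIsetl.
apply: (@le_trans _ _ (lebn ((@tball R k.+1 `&` cap (basis0 k) 0%R) `|`
    [set z : k.+1.-tuple R | (nsq z <= 0)%R]))).
  apply: le_measure; rewrite ?inE; [exact: mb| |].
    exact: (measurableU _ _ mbc mn).
  move=> v v1 /=; have [v0|v0] := ltP 0%R (nsq v); [left|by right].
  by split=> //; split=> //; rewrite mul0r sqr_ge0.
apply: (le_trans (measureU2 _ mbc mn)).
by rewrite /= lebn_nsq_le0 adde0.
Qed.

Lemma sphere_uniform_cap (u : k.+1.-tuple R) y : nsq u = 1%R -> (0 < y <= 1)%R ->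
  sphere_uniform [set l | (y <= inner l u ^+ 2)%R] = (cap_prob y)%:E.
Proof.
move=> u1 y01; rewrite /sphere_uniform sphere_surfaceT sphere_surface_cap lebn_cap_ratio//.
have := @lebn_tball_gt0 R k.+1; have := @lebn_tball_lty R k.+1.
case: (lebn (@tball R k.+1)) => [b| |]// _; rewrite lte_fin => b0.
rewrite -!EFinM /=; congr EFin; field.
by rewrite (gt_eqF b0)/= addrC natr1.
Qed.

End sphere_caps.

(** * Gaussian integrals over cones *)

Section cones.
Local Open Scope ereal_scope.
Context {R : realType}.

Lemma cap_cone n (u : n.-tuple R) y : cone (cap u y).
Proof.
move=> r v r0; rewrite /cap /= tscale_nsq innerZl exprMn.
have rr : (0 < r ^+ 2)%R by rewrite exprn_gt0.
by rewrite pmulr_rgt0// mulrCA ler_pM2l.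
Qed.

(** Layer cake: the superlevel sets of [expR (- c * nsq _)] on a cone are
    rescaled copies of the intersection of the cone with the unit ball. *)
Lemma integral_cone_gauss m (C : set (m.+1.-tuple R)) (c : R) : (0 < c)%R ->
  measurable C -> cone C ->
  \int[@lebn R m.+1]_(v in C) (expR (- (c * nsq v)))%:E =
  (\int[leb]_(t in [set t | (0 < t)%R]) (Num.sqrt (- ln t / c) ^+ m.+1)%:E) *
    lebn (@tball R m.+1 `&` C).
Proof.
move=> c0 mC coneC.
have mpos : measurable [set t : R | (0 < t)%R].
  by apply: measurable_set_lt; [exact: measurable_cst|exact: measurable_id].
pose f (v : m.+1.-tuple R) : R := expR (- (c * nsq v)).
have mg : measurable_fun setT (fun v : m.+1.-tuple R => - (c * nsq v))%R.
  apply: measurableT_comp => //; apply: measurable_funM; first exact: measurable_cst.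
  by apply: measurable_nsq; exact: measurable_id.
have mf : measurable_fun setT f by exact: (measurableT_comp (@measurable_expR R) mg).
pose E : set (R * m.+1.-tuple R) := [set tv | [/\ (0 < tv.1)%R, C tv.2 & (tv.1 <= f tv.2)%R]].
have mE : measurable E.
  have -> : E = [set tv | (0 < tv.1)%R] `&` ([set tv | C tv.2] `&` [set tv | (tv.1 <= f tv.2)%R]).
    by apply/seteqP; split=> tv; [case|move=> [? []]].
  apply: measurableI; first by apply: measurable_set_lt => //; exact: measurable_cst.
  apply: measurableI; first exact: measurable_preimage.
  by apply: measurable_set_le => //; exact: measurableT_comp.
have := Tonelli_set (@leb R) (@lebn R m.+1) mE => T.
transitivity (\int[@lebn R m.+1]_v leb [set t | E (t, v)]).
  rewrite integral_mkcond; apply: eq_integral => v _; rewrite patchE.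
  have [vC|vC] := boolP (v \in C); last first.
    rewrite -[LHS](measure0 (@leb R)); congr leb; apply/seteqP; split=> // t [_ /= Cv _].
    by move: vC; rewrite mem_set.
  transitivity (leb `]0%R, (f v)]%classic).
    rewrite /leb lebesgue_measure_itv /= lte_fin expR_gt0 oppr0 adde0//.
  congr leb; apply/seteqP; split=> t; rewrite /E /= in_itv /=.
    by move=> /andP[t0 tv]; split=> //; exact/set_mem.
  by move=> [-> _ ->].
rewrite -T -ge0_integralZr//; last first.
  apply/measurable_EFinP/measurable_funTS/measurable_funX/measurable_sqrt_comp.
  apply: measurable_funM; last exact: measurable_cst.
  apply: measurableT_comp => //; exact: measurable_ln.
rewrite [RHS]integral_mkcond; apply: eq_integral => t _; rewrite patchE.
case: ifPn => [/set_mem /= t0|t0]; last first.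
  rewrite -[RHS](measure0 (@lebn R m.+1)); congr (lebn _); apply/seteqP; split=> // v [/= tp _ _].
  by move: t0; rewrite mem_set.
rewrite -lebn_cone_ball//; congr (lebn _); apply/seteqP.
have E1 v : (t <= f v)%R = (nsq v <= - ln t / c)%R.
  rewrite /f -{1}(lnK (x := t)) ?posrE// ler_expR ler_pdivlMr// lerNr.
  by rewrite mulrC.
by split=> v; rewrite /E /= E1 => -[].
Qed.

End cones.

Section density_measure.
Local Open Scope ereal_scope.
Context d (T : measurableType d) (R : realType).
Variables (mu : {measure set T -> \bar R}) (f : T -> \bar R).
Hypothesis (mf : measurable_fun setT f) (f0 : forall x, 0 <= f x).

Lemma density_measure_exists :
  exists m : {measure set T -> \bar R},
    (m : set T -> \bar R) = (fun A => \int[mu]_(x in A) f x).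
Proof.
pose m A := \int[mu]_(x in A) f x.
have m0 : m set0 = 0 by exact: integral_set0.
have mp A : 0 <= m A by apply: integral_ge0.
have ms : semi_sigma_additive m.
  move=> F mF tF mUF.
  rewrite /m ge0_integral_bigcup//; last exact: measurable_funTS.
  by apply: is_cvg_ereal_nneg_natsum_cond => n _ _; apply: integral_ge0.
pose H := isMeasure.Build _ _ _ m m0 mp ms.
by exists (HB.pack_for (Measure.type T R) m H).
Qed.

End density_measure.

Section invariance.
Local Open Scope ereal_scope.
Context d (T : measurableType d) (R : realType).

Lemma ge0_integral_invariant (mu : {measure set T -> \bar R}) (g : T -> T) (h : T -> \bar R) :
  measurable_fun setT g -> (forall A, measurable A -> mu (g @^-1` A) = mu A) ->
  measurable_fun setT h -> (forall x, 0 <= h x) ->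
  \int[mu]_x h (g x) = \int[mu]_x h x.
Proof.
move=> mg inv mh h0; have [m mE] := pushforward_measure_exists mu mg.
transitivity (\int[m]_x h x); last first.
  by apply: eq_measure_integral => A mA _; rewrite mE; exact: inv.
by rewrite mE ge0_integral_pushforward.
Qed.

End invariance.

Section product_integral.
Local Open Scope ereal_scope.
Context d (S : measurableType d) (R : realType).
Variable mu : {sigma_finite_measure set S -> \bar R}.

Lemma integral_tuple_prod n (g : 'I_n -> S -> R) :
  (forall i, measurable_fun setT (g i)) -> (forall i x, (0 <= g i x)%R) ->
  \int[tuple_measure mu (n := n)]_v (\prod_(i < n) g i (tnth v i))%:E =
  \prod_(i < n) \int[mu]_x (g i x)%:E.
Proof.
elim: n g => [|n IHn] g mg g0.
  rewrite big_ord0; under eq_integral do rewrite big_ord0.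
  rewrite integral_cst// mul1e.
  transitivity ((\1_[set: 0.-tuple S] [tuple])%:E : \bar R); first by [].
  by rewrite indicE mem_set.
rewrite integral_tuple_measureS; last 2 first.
- apply/measurable_EFinP; apply: measurable_prod => i _.
  exact: (measurableT_comp (mg i) (measurable_tnth i)).
- by move=> v; rewrite lee_fin; apply: prodr_ge0.
rewrite big_ord_recl -(IHn (fun i => g (lift ord0 i)))//.
rewrite -ge0_integralZr//; last 3 first.
- exact/measurable_EFinP.
- by move=> x _; rewrite lee_fin.
- by apply: integral_ge0 => v _; rewrite lee_fin; apply: prodr_ge0.
apply: eq_integral => x _; rewrite -ge0_integralZl//; last 3 first.
- apply/measurable_EFinP; apply: measurable_prod => i _.
  exact: (measurableT_comp (mg _) (measurable_tnth i)).
- by move=> v _; rewrite lee_fin; apply: prodr_ge0.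
- by rewrite lee_fin.
apply: eq_integral => v _; rewrite big_ord_recl EFinM tnth0; congr (_ * _%:E).
by apply: eq_bigr => i _; rewrite tnthS.
Qed.

End product_integral.

(** * Gaussian vectors *)

Section gaussian_vectors.
Local Open Scope ereal_scope.
Context {R : realType}.
Implicit Types (n k : nat) (mean s y : R).

Definition gauss_density mean s n (v : n.-tuple R) : R :=
  (\prod_(i < n) normal_pdf mean s (tnth v i))%R.

Definition gauss_vec mean s n (A : set (n.-tuple R)) : \bar R :=
  \int[@lebn R n]_(v in A) (gauss_density mean s v)%:E.

Lemma gauss_density_ge0 mean s n (v : n.-tuple R) : (0 <= gauss_density mean s v)%R.
Proof. by apply: prodr_ge0 => i _; exact: normal_pdf_ge0. Qed.

Lemma measurable_gauss_density mean s n :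
  measurable_fun setT (fun v : n.-tuple R => (gauss_density mean s v)%:E).
Proof.
apply/measurable_EFinP; apply: measurable_prod => i _.
exact: (measurableT_comp (measurable_normal_pdf mean s) (measurable_tnth i)).
Qed.

Lemma gauss_vec_measure mean s n :
  exists m : {measure set (n.-tuple R) -> \bar R}, (m : set _ -> \bar R) = @gauss_vec mean s n.
Proof.
apply: density_measure_exists; first exact: measurable_gauss_density.
by move=> v; rewrite lee_fin gauss_density_ge0.
Qed.

Lemma gauss_vecE mean s n (A : set (n.-tuple R)) :
  gauss_vec mean s A = \int[@lebn R n]_v ((\1_A v * gauss_density mean s v)%R)%:E.
Proof.
rewrite /gauss_vec integral_mkcond; apply: eq_integral => v _.
by rewrite patchE indicE; case: ifP => _; rewrite ?mul1r ?mul0r.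
Qed.

Lemma measurable_indic_gauss_density mean s n (A : set (n.-tuple R)) : measurable A ->
  measurable_fun setT (fun v : n.-tuple R => (\1_A v * gauss_density mean s v)%:E).
Proof.
move=> mA; apply/measurable_EFinP/measurable_funM; first exact: measurable_indic.
by apply/measurable_EFinP; exact: measurable_gauss_density.
Qed.

Lemma gauss_vec_rect mean s n (B : 'I_n -> set R) : (forall i, measurable (B i)) ->
  gauss_vec mean s (rect B) = \prod_(i < n) normal_prob mean s (B i).
Proof.
move=> mB; rewrite gauss_vecE.
transitivity (\int[@lebn R n]_v
    (\prod_(i < n) ((\1_(B i) (tnth v i) * normal_pdf mean s (tnth v i))%R))%:E).
  apply: eq_integral => v _; congr EFin; rewrite big_split /=; congr (_ * _)%R.
  rewrite indicE; case: (boolP (v \in rect B)) => [/set_mem vB|vB].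
    by rewrite big1// => i _; rewrite indicE mem_set//; exact: vB.
  have [i iB] : exists i, tnth v i \notin B i.
    apply: contrapT => H; move: vB; rewrite notin_setE; apply => i.
    by apply: contrapT => iB; apply: H; exists i; rewrite notin_setE.
  by rewrite (bigD1 i)//= indicE (negbTE iB) mul0r.
have mpdf := measurable_normal_pdf mean s.
have mf i : measurable_fun setT (fun x : R => \1_(B i) x * normal_pdf mean s x)%R.
  by apply: measurable_funM => //; exact: measurable_indic.
rewrite /lebn (integral_tuple_prod (@leb R) (g := fun i x => \1_(B i) x * normal_pdf mean s x)%R)//; last first.
  by move=> i x; rewrite mulr_ge0// normal_pdf_ge0.
apply: eq_bigr => i _; rewrite ge0_integral_leb//; last 2 first.
- exact/measurable_EFinP.
- by move=> x _; rewrite lee_fin mulr_ge0// normal_pdf_ge0.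
rewrite /normal_prob [RHS]integral_mkcond; apply: eq_integral => x _.
by rewrite patchE indicE; case: ifP => _; rewrite ?mul1r ?mul0r.
Qed.

Lemma gauss_vecT mean s n : gauss_vec mean s [set: n.-tuple R] = 1.
Proof.
have -> : [set: n.-tuple R] = rect (fun=> setT) by apply/seteqP; split.
by rewrite gauss_vec_rect// big1// => i _; exact: probability_setT.
Qed.

Lemma gauss_densityE mean s n (v : n.-tuple R) : s != 0%R ->
  gauss_density mean s v = (normal_peak s ^+ n *
    expR (- ((s ^+ 2 *+ 2)^-1 * nsq (tadd v (topp (nseq_tuple n mean))))))%R.
Proof.
move=> s0; rewrite /gauss_density.
under eq_bigr => i _ do rewrite normal_pdfE//.
rewrite big_split /= prodr_const card_ord -expR_sum; congr (_ * expR _)%R.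
rewrite /nsq mulr_sumr -sumrN; apply: eq_bigr => i _.
by rewrite !tnth_mktuple tnth_nseq mulNr mulrC.
Qed.

(** A common mean moves the vector along the diagonal, and events about centered observations do not
    see this. *)
Lemma gauss_vec_translate mean s n (A : set (n.-tuple R)) : s != 0%R -> measurable A ->
  (forall v, A (tadd v (nseq_tuple n mean)) <-> A v) ->
  gauss_vec mean s A = gauss_vec 0 s A.
Proof.
move=> s0 mA Ainv; pose c := nseq_tuple n mean.
rewrite !gauss_vecE -(@ge0_integral_invariant _ _ _ _ (fun v => tadd v c)) /=.
- apply: eq_integral => v _; congr EFin; congr (_ * _)%R.
    have E : (tadd v c \in A) = (v \in A).
      by apply/idP/idP => /set_mem /Ainv /mem_set.
    by rewrite !indicE E.
  rewrite !gauss_densityE//; congr (_ * expR (- (_ * _)))%R.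
  by rewrite taddK; apply: eq_bigr => i _; rewrite !tnth_mktuple tnth_nseq oppr0 addr0.
- exact: (measurable_tadd (f := id) (g := fun=> c)).
- by move=> B mB; exact: lebn_translation.
- exact: measurable_indic_gauss_density.
- by move=> v; rewrite lee_fin mulr_ge0// gauss_density_ge0.
Qed.

Lemma gauss_density0E s n (v : n.-tuple R) : s != 0%R ->
  gauss_density 0 s v = (normal_peak s ^+ n * expR (- ((s ^+ 2 *+ 2)^-1 * nsq v)))%R.
Proof.
move=> s0; rewrite gauss_densityE//; congr (_ * expR (- (_ * _)))%R.
by apply: eq_bigr => i _; rewrite !tnth_mktuple tnth_nseq oppr0 addr0.
Qed.

Lemma gauss_vec_reflect s n (h : n.-tuple R) (A : set (n.-tuple R)) : s != 0%R ->
  measurable A ->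
  gauss_vec 0 s [set v | A (reflect_tuple h v)] = gauss_vec 0 s A.
Proof.
move=> s0 mA.
rewrite !gauss_vecE -[RHS](@ge0_integral_invariant _ _ _ _ (reflect_tuple h)) /=.
- apply: eq_integral => v _; congr EFin; congr (_ * _)%R.
  by rewrite !gauss_density0E// nsq_reflect.
- exact: measurable_reflect.
- move=> B mB; apply: lebn_isometry => //.
  + exact: measurable_reflect.
  + exact: reflect_tupleK.
  + exact: reflect_tupleD.
  + exact: nsq_reflect.
- exact: measurable_indic_gauss_density.
- by move=> v; rewrite lee_fin mulr_ge0// gauss_density_ge0.
Qed.

Lemma gauss_vec_behead s n (A : set (n.-tuple R)) : measurable A ->
  gauss_vec 0 s [set v : n.+1.-tuple R | A [tuple of behead v]] = gauss_vec 0 s A.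
Proof.
move=> mA; rewrite !gauss_vecE /lebn integral_tuple_measureS; last 2 first.
- apply: measurable_indic_gauss_density; apply: measurable_preimage => //.
  exact: measurable_behead.
- by move=> v; rewrite lee_fin mulr_ge0// gauss_density_ge0.
pose I := \int[tuple_measure (@leb R) (n := n)]_v (\1_A v * gauss_density 0 s v)%:E.
have mpdf : measurable_fun setT (fun x : R => (normal_pdf 0 s x)%:E).
  by apply/measurable_EFinP; exact: measurable_normal_pdf.
transitivity (\int[leb]_x ((normal_pdf 0 s x)%:E * I)).
  apply: eq_integral => x _; rewrite /I -[RHS]ge0_integralZl//; last 3 first.
  - exact: measurable_indic_gauss_density.
  - by move=> v _; rewrite lee_fin mulr_ge0// gauss_density_ge0.
  - by rewrite lee_fin normal_pdf_ge0.
  apply: eq_integral => v _; rewrite -EFinM; congr EFin.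
  rewrite /gauss_density big_ord_recl tnth0 mulrCA; congr (_ * (_ * _))%R.
    have E : [tuple of behead [tuple of x :: v]] = v by apply: val_inj.
    rewrite !indicE; congr (nat_of_bool _)%:R; apply/idP/idP => /set_mem /= Av;
      by apply/mem_set; rewrite /= E in Av *.
  by apply: eq_bigr => i _; rewrite tnthS.
have one : \int[leb]_x (normal_pdf 0 s x)%:E = 1.
  rewrite ge0_integral_leb; [exact: integral_normal_pdf|exact: measurableT|exact: mpdf|].
  by move=> x _; rewrite lee_fin normal_pdf_ge0.
apply: etrans; first apply: ge0_integralZr => //.
- by move=> x _; rewrite lee_fin normal_pdf_ge0.
- by apply: integral_ge0 => v _; rewrite lee_fin mulr_ge0// gauss_density_ge0.
by rewrite one mul1e.
Qed.

(** The layer-cake factor does not depend on the cone and is never evaluated: the whole space is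
    also a cone, of total mass 1, which fixes it. *)
Lemma gauss_vec_cone_mul s k (C : set (k.+1.-tuple R)) : s != 0%R ->
  measurable C -> cone C ->
  exists K, [/\ 0 <= K, gauss_vec 0 s C = K * lebn (@tball R k.+1 `&` C)
    & 1 = K * lebn (@tball R k.+1)].
Proof.
move=> s0 mC coneC; pose c := ((s ^+ 2 *+ 2)^-1)%R.
have c0 : (0 < c)%R by rewrite invr_gt0 pmulrn_lgt0// exprn_even_gt0.
pose K0 := \int[leb]_(t in [set t | (0 < t)%R]) (Num.sqrt (- ln t / c) ^+ k.+1)%:E.
have K00 : 0 <= K0 by apply: integral_ge0 => t _; rewrite lee_fin exprn_ge0// sqrtr_ge0.
have p0 : (0 <= normal_peak s ^+ k.+1)%R by rewrite exprn_ge0// normal_peak_ge0.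
have mg : measurable_fun setT (fun v : k.+1.-tuple R => (expR (- (c * nsq v)))%:E).
  apply/measurable_EFinP; apply: (measurableT_comp (@measurable_expR R)).
  apply: measurableT_comp => //; apply: measurable_funM; first exact: measurable_cst.
  by apply: measurable_nsq; exact: measurable_id.
have H (D : set (k.+1.-tuple R)) : measurable D -> cone D ->
    gauss_vec 0 s D = (normal_peak s ^+ k.+1)%:E * K0 * lebn (@tball R k.+1 `&` D).
  move=> mD coneD; rewrite -muleA -integral_cone_gauss// -ge0_integralZl//; last exact: measurable_funTS.
  by apply: eq_integral => v _; rewrite gauss_density0E.
exists ((normal_peak s ^+ k.+1)%:E * K0); split.
- by rewrite mule_ge0.
- exact: H.
- by rewrite -(gauss_vecT 0 s k.+1) H ?setIT.
Qed.

Lemma gauss_vec_cap s k (u : k.+1.-tuple R) y : s != 0%R -> (0 < k)%N ->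
  nsq u = 1%R -> (0 < y <= 1)%R ->
  gauss_vec 0 s (cap u y) = (cap_prob k y)%:E.
Proof.
move=> s0 k0 u1 y01.
have [K [K0 -> E]] := gauss_vec_cone_mul s0 (measurable_cap u y) (cap_cone u y).
by rewrite lebn_cap_ratio// muleCA -E mule1.
Qed.

(** For a unit vector e, the difference is the squared norm of the projection of v orthogonal to e.
    When u is orthogonal to e, [inner v u] is already the inner product of that projection with
    u. *)
Definition perp_cap n (e u : n.-tuple R) y : set (n.-tuple R) :=
  [set v | (0 < nsq v - inner v e ^+ 2)%R /\
           (y * (nsq v - inner v e ^+ 2) <= inner v u ^+ 2)%R].

Lemma measurable_perp_cap n (e u : n.-tuple R) y : measurable (perp_cap e u y).
Proof.
have mi (w : n.-tuple R) : measurable_fun setT (fun v => inner v w ^+ 2)%R.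
  apply: measurable_funX; apply: measurable_inner; first exact: measurable_id.
  exact: measurable_cst.
have mn : measurable_fun setT (fun v : n.-tuple R => nsq v - inner v e ^+ 2)%R.
  apply: measurable_funB => //; apply: measurable_nsq; exact: measurable_id.
apply: measurableI; first by apply: measurable_set_lt => //; exact: measurable_cst.
by apply: measurable_set_le => //; exact: measurable_funM.
Qed.

Lemma gauss_vec_perp_cap0 s k (e u : k.+2.-tuple R) y : s != 0%R -> (0 < k)%N ->
  nsq e = 1%R -> nsq u = 1%R -> inner u e = 0%R -> (0 < y <= 1)%R ->
  gauss_vec 0 s (perp_cap e u y) = (cap_prob k y)%:E.
Proof.
move=> s0 k0 e1 u1 ue y01.
pose Q := reflect_tuple (tadd e (topp (basis0 k.+1))).
have Qe : Q e = basis0 k.+1 by apply: reflect_swap; rewrite e1 nsq_basis0.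
pose u' := Q u.
(* The image of u is orthogonal to the image of e, so deleting its first coordinate leaves a unit
   vector. *)
have u'0 : tnth u' ord0 = 0%R by rewrite -inner_basis0 -Qe inner_reflect_reflect.
pose u'' : k.+1.-tuple R := [tuple of behead u'].
have u'E : u' = [tuple of 0%R :: u''].
  by rewrite [LHS]tuple_eta -u'0; apply: val_inj.
have u''1 : nsq u'' = 1%R.
  have : nsq u' = 1%R by rewrite nsq_reflect.
  by rewrite u'E nsq_cons expr0n/= add0r.
rewrite -(gauss_vec_cap s0 k0 u''1 y01) -[RHS]gauss_vec_behead; last exact: measurable_cap.
rewrite -[RHS](gauss_vec_reflect (tadd e (topp (basis0 k.+1))) s0 (A := [set v : k.+2.-tuple R | cap u'' y [tuple of behead v]])); last first.
  apply: measurable_preimage; [exact: measurable_behead|exact: measurable_cap].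
congr gauss_vec; apply/seteqP.
have E (v : k.+2.-tuple R) : perp_cap e u y v <-> cap u'' y [tuple of behead (Q v)].
  have E1 : nsq [tuple of behead (Q v)] = (nsq v - inner v e ^+ 2)%R.
    rewrite -[X in _ = (_ - X ^+ 2)%R](inner_reflect_reflect (tadd e (topp (basis0 k.+1)))).
    rewrite -/(Q v) -/(Q e) Qe inner_basis0 -(nsq_reflect (tadd e (topp (basis0 k.+1)))) -/(Q v).
    by rewrite [in RHS](tuple_eta (Q v)) nsq_cons tnth0 addrC addKr.
  have E2 : inner [tuple of behead (Q v)] u'' = inner v u.
    rewrite -[RHS](inner_reflect_reflect (tadd e (topp (basis0 k.+1)))) -/(Q v) -/(Q u) -/u' u'E.
    by rewrite [in RHS](tuple_eta (Q v)) inner_cons mulr0 add0r.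
  by rewrite /perp_cap /cap /= E1 E2.
by split=> v /E.
Qed.

Lemma gauss_vec_perp_cap mean s k (e u : k.+2.-tuple R) r y : s != 0%R -> (0 < k)%N ->
  nsq e = 1%R -> nsq u = 1%R -> inner u e = 0%R -> (0 < y <= 1)%R ->
  nseq_tuple k.+2 mean = tscale r e ->
  gauss_vec mean s (perp_cap e u y) = (cap_prob k y)%:E.
Proof.
move=> s0 k0 e1 u1 ue y01 me; rewrite -(gauss_vec_perp_cap0 s0 k0 e1 u1 ue y01).
apply: gauss_vec_translate => //; first exact: measurable_perp_cap.
move=> v; rewrite /perp_cap me /=.
have -> : inner (tadd v (tscale r e)) u = inner v u.
  by rewrite innerDl innerZl (innerC e u) ue mulr0 addr0.
have -> : nsq (tadd v (tscale r e)) = (nsq v + 2 * r * inner v e + r ^+ 2)%R.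
  rewrite -inner_nsq !innerDl !innerDr !innerZl !innerZr !inner_nsq e1 (innerC e v); ring.
have -> : inner (tadd v (tscale r e)) e = (inner v e + r)%R.
  by rewrite innerDl innerZl inner_nsq e1 mulr1.
suff -> : (nsq v + 2 * r * inner v e + r ^+ 2 - (inner v e + r) ^+ 2 =
  nsq v - inner v e ^+ 2)%R by [].
ring.
Qed.

End gaussian_vectors.

(** * Tail estimates *)

Section exponential_estimates.
Context {R : realType}.
Implicit Types (t u v d q : R).

(** Tangent line at [t * v], evaluated at [v] and [0]. *)
Lemma expR_scale_le t v : 0 <= t <= 1 -> expR (t * v) <= t * expR v + (1 - t).
Proof.
move=> /andP[t0 t1].
have e0 := expR_gt0 (t * v).
have h1 : expR (t * v) * (1 + (1 - t) * v) <= expR v.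
  rewrite -[X in _ <= expR X](_ : t * v + (1 - t) * v = v); last by ring.
  by rewrite expRD ler_pM2l// expR_ge1Dx.
have h2 : expR (t * v) * (1 - t * v) <= 1.
  rewrite -[X in _ <= X](expR0 R) -[X in _ <= expR X](subrr (t * v)) expRD ler_pM2l//.
  exact: expR_ge1Dx.
nra.
Qed.

(** Concavity of 1 - exp (- u), which vanishes at 0. The constants do not involve u; at u = 2 ln p /
    m this is what makes the estimates uniform in m. *)
Lemma one_sub_expR_lb d u : 0 <= d <= 1 -> (1 - d) * (1 - expR (- u)) <= 1 - expR (- ((1 - d) * u)).
Proof.
move=> /andP[d0 d1]; have := @expR_scale_le (1 - d) (- u).
by rewrite mulrN => H; have := H _; rewrite subr_ge0 d1/= gerBl d0 => /(_ isT); lra.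
Qed.

Lemma one_sub_expR_ub d u : 0 <= d -> 1 - expR (- ((1 + d) * u)) <= (1 + d) * (1 - expR (- u)).
Proof.
move=> d0; have d1 : 0 < 1 + d by lra.
have := @expR_scale_le (1 + d)^-1 (- ((1 + d) * u)).
rewrite mulrN mulKf ?gt_eqF// invr_ge0 invf_le1// (ltW d1)/= lerDl d0 => /(_ isT).
rewrite -(ler_pM2l d1) mulrDr mulrA divff ?gt_eqF// mul1r mulrBr divff ?gt_eqF//.
lra.
Qed.

Lemma expR_lipschitz u v : 0 <= u -> u <= v -> expR (- u) - expR (- v) <= v - u.
Proof.
move=> u0 uv.
have h1 : expR (- u) <= 1 by rewrite -expR0 ler_expR; lra.
have := expR_ge1Dx (u - v).
have -> : expR (- v) = expR (- u) * expR (u - v) by rewrite -expRD; congr expR; ring.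
have := expR_gt0 (- u); nra.
Qed.

Lemma expR_lipschitz_norm u v : 0 <= u -> 0 <= v -> `|expR (- u) - expR (- v)| <= `|u - v|.
Proof.
wlog uv : u v / u <= v.
  move=> H u0 v0; have [uv|vu] := leP u v; first exact: H.
  by rewrite distrC [leRHS]distrC; apply: H => //; exact: ltW.
move=> u0 v0; rewrite ger0_norm; last by rewrite subr_ge0 ler_expR; lra.
by rewrite distrC ger0_norm ?subr_ge0//; exact: expR_lipschitz.
Qed.

Lemma expr_one_sub_expR (p : nat) q : (0 < p)%N -> 0 <= q -> q <= 1 / 2 ->
  `|(1 - q) ^+ p - expR (- (p%:R * q))| <= 2 * (p%:R * q) * q.
Proof.
move=> p0 q0 q1; set l := p%:R * q.
have l0 : 0 <= l by rewrite mulr_ge0.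
have q10 : 0 < 1 - q by lra.
have ub : (1 - q) ^+ p <= expR (- l).
  rewrite /l -mulrN expRM_natl ler_pXn2r ?nnegrE ?expR_ge0// ?(ltW q10)//.
  exact: expR_ge1Dx.
(* Inverting 1 + t <= exp t at t = q / (1 - q) gives exp (- q / (1 - q)) <= 1 - q. *)
have lb : expR (- (l / (1 - q))) <= (1 - q) ^+ p.
  rewrite /l -mulrA -mulrN expRM_natl ler_pXn2r ?nnegrE ?expR_ge0// ?(ltW q10)//.
  rewrite expRN -[leRHS]invrK lef_pV2 ?posrE ?expR_gt0 ?invr_gt0//.
  apply: le_trans (expR_ge1Dx _).
  by rewrite le_eqVlt; apply/orP; left; apply/eqP; field; rewrite gt_eqF.
have il : l <= l / (1 - q) by rewrite ler_pdivlMr// ler_piMr//; lra.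
have := expR_lipschitz l0 il.
have -> : l / (1 - q) - l = l * q / (1 - q) by field; rewrite gt_eqF.
have : l * q / (1 - q) <= 2 * l * q.
  by rewrite ler_pdivrMr//; have := mulr_ge0 l0 q0; nra.
by rewrite ler0_norm; lra.
Qed.

End exponential_estimates.

Section tail.
Context {R : realType}.
Variables m p : nat.
Hypotheses (m0 : (0 < m)%N) (p1 : (1 < p)%N).
Notation L := (ln (p%:R : R)).

(** The power p^(-2/m) of the normalizing constants. *)
Definition theta : R := expR (- (2 * L / m%:R)).
(** By [Beta_profile] this is (m/2) B(1/2, m/2) sqrt (1 - theta), the base of the power defining
    [c_]. *)
Definition tail_scale : R := m.+1%:R * profile m 0 * Num.sqrt (1 - theta).

Let mr0 : 0 < m%:R :> R. Proof. by rewrite ltr0n. Qed.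
Let pr1 : 1 < p%:R :> R. Proof. by rewrite ltr1n. Qed.
Let pr0 : 0 < p%:R :> R. Proof. exact: lt_trans pr1. Qed.
Let L0 : 0 < L. Proof. by rewrite ln_gt0. Qed.
Let Lp : expR L = p%:R. Proof. by rewrite lnK// posrE. Qed.
Let u0 : 0 < 2 * L / m%:R. Proof. by rewrite divr_gt0// mulr_gt0. Qed.

Lemma theta_gt0 : 0 < theta. Proof. exact: expR_gt0. Qed.

Lemma theta_lt1 : theta < 1.
Proof. by rewrite -expR0 ltr_expR oppr_lt0. Qed.

Let th0 := theta_gt0.
Let th1 := theta_lt1.

Lemma sqrt_expR_pow (c : R) : Num.sqrt (expR (2 * c / m%:R)) ^+ m = expR c.
Proof.
have -> : 2 * c / m%:R = c / m%:R + c / m%:R by field; rewrite gt_eqF.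
rewrite expRD -expr2 sqrtr_sqr gtr0_norm ?expR_gt0// -expRM_natl; congr expR.
by field; rewrite gt_eqF.
Qed.

Lemma sqrt_theta_pow : Num.sqrt theta ^+ m = p%:R^-1.
Proof.
rewrite /theta -mulNr -mulrN sqrt_expR_pow expRN Lp//.
Qed.

Lemma slice_sqrt (s : R) : s <= 1 -> slice m (Num.sqrt (1 - s)) = Num.sqrt s ^+ m.
Proof. by move=> s1; rewrite /slice sqr_sqrtr ?subr_ge0// opprB addrC subrK. Qed.

(** The height at which [slice] equals 1 / p, used as reference for the heights of caps. *)
Let b := Num.sqrt (1 - theta).
Let b0 : 0 < b. Proof. by rewrite sqrtr_gt0 subr_gt0. Qed.
Let b1 : b <= 1. Proof. by rewrite -[leRHS]sqrtr1 ler_wsqrtr// gerBl ltW. Qed.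
Let bb : b ^+ 2 = 1 - theta. Proof. by rewrite sqr_sqrtr// subr_ge0 ltW. Qed.
Let slice_b : slice m b = p%:R^-1.
Proof. by rewrite slice_sqrt ?ltW// sqrt_theta_pow. Qed.

(** Comparing the profile at 0 and at [b] gives at least 1 - 1 / p. *)
Lemma tail_scale_lb : 1 / 2 <= tail_scale.
Proof.
have := profile_lb m (lexx 0) (ltW b0) b1 b0.
rewrite slice0 slice_b ler_pdivrMr// => h.
have hb : 0 <= profile m b by rewrite profile_ge0// (ltW b0).
have hp : p%:R^-1 <= 1 / 2 :> R by rewrite div1r lef_pV2 ?posrE// ler_nat.
rewrite /tail_scale -/b.
have : 0 <= m.+1%:R * profile m b * b :> R by rewrite !mulr_ge0// ltW.
rewrite mulrBr mulrBl in h; lra.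
Qed.

(** Splitting the profile at [b], the part above contributes at most 1 / p and the part below at
    most m b^2 = m (1 - theta) <= 2 ln p. *)
Lemma tail_scale_ub : tail_scale <= 2 * L + 2.
Proof.
(* For m = 1 the integrand is unbounded, but [profile 1 0 <= 1] already bounds the scale by 2. *)
have [m1|m1] := leqP m 1.
  have mE : m.+1%:R = 2 :> R by congr (_.+1%:R); apply/eqP; rewrite eqn_leq m1.
  rewrite /tail_scale -/b mE; have := @profile0_le1 R m; have := @profile0_gt0 R m.
  by move=> p0 p1'; have := b0; have := b1; have := L0; nra.
have b01 : 0 <= b <= 1 by rewrite ltW.
have h1 := profile0_ub m1 b01.
have h2 := @profile_ub R m m0 b; rewrite b0 b1 slice_b in h2.
have {}h2 := h2 isT; rewrite ler_pdivlMr// in h2.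
have pi1 : p%:R^-1 <= 1 :> R by rewrite invf_le1// ltW.
have h3 : m%:R * b ^+ 2 <= 2 * L.
  rewrite bb /theta; have := expR_ge1Dx (- (2 * L / m%:R)) => h.
  rewrite mulrC -ler_pdivlMr//; lra.
rewrite /tail_scale -/b.
have : m.+1%:R * (profile m 0 - profile m b) * b <= m%:R * b * b by rewrite ler_pM2r.
rewrite mulrBr mulrBl -mulrA -(mulrA _ b b) -expr2 in h2 *.
lra.
Qed.

Lemma tail_scale_gt0 : 0 < tail_scale.
Proof. by apply: lt_le_trans tail_scale_lb; rewrite divr_gt0. Qed.

Variables (s W d : R).
Hypotheses (s0 : 0 <= s) (W0 : 0 <= W) (d0 : 0 < d) (d1 : d <= 1 / 2).
Hypothesis sE : Num.sqrt s ^+ m = tail_scale * W / p%:R.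
Hypothesis small : tail_scale * W <= expR (d * L).

Let dp0 : 0 < 1 + d. Proof. by rewrite addr_gt0. Qed.
Let dm0 : 0 < 1 - d. Proof. by have := d1; lra. Qed.

Let y := 1 - s.

Let ler_of_pow (x c : R) : 0 <= x -> Num.sqrt x ^+ m <= expR c -> x <= expR (2 * c / m%:R).
Proof.
move=> x0; rewrite -sqrt_expR_pow ler_pXn2r ?nnegrE ?sqrtr_ge0//.
by rewrite ler_sqrt// expR_gt0.
Qed.

Let ger_of_pow (x c : R) : 0 <= x -> expR c <= Num.sqrt x ^+ m -> expR (2 * c / m%:R) <= x.
Proof.
move=> x0; rewrite -sqrt_expR_pow ler_pXn2r ?nnegrE ?sqrtr_ge0//.
by rewrite ler_sqrt.
Qed.

(** The hypothesis [small] says s^(m/2) <= p^(d - 1), that is s <= theta^(1 - d), and concavity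
    compares 1 - theta^(1 - d) with 1 - theta. *)
Let y_lb : (1 - d) * (1 - theta) <= y.
Proof.
have : s <= expR (- ((1 - d) * (2 * L / m%:R))).
  have -> : - ((1 - d) * (2 * L / m%:R)) = 2 * (d * L - L) / m%:R by field; rewrite gt_eqF.
  apply: ler_of_pow => //; rewrite sE expRD expRN Lp ler_pM2r ?invr_gt0//.
have d01 : 0 <= d <= 1 by rewrite (ltW d0) -subr_ge0 ltW.
have := one_sub_expR_lb (2 * L / m%:R) d01.
by rewrite -/theta => h1 h2; apply: le_trans h1 _; rewrite lerD2l lerN2.
Qed.

Lemma tail_level : 0 < 1 - s <= 1.
Proof.
by rewrite gerBl s0 andbT; apply: lt_le_trans y_lb; rewrite mulr_gt0// subr_gt0.
Qed.

Let y01 : 0 < y <= 1. Proof. exact: tail_level. Qed.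
Let s1 : s <= 1. Proof. by rewrite -subr_ge0; case/andP: y01 => /ltW. Qed.
Let ry0 : 0 < Num.sqrt y. Proof. by rewrite sqrtr_gt0; case/andP: y01. Qed.
Let ry1 : Num.sqrt y <= 1.
Proof. by rewrite -[leRHS]sqrtr1 ler_wsqrtr//; case/andP: y01. Qed.
Let P0 : 0 < m.+1%:R * profile m 0 :> R.
Proof. by rewrite mulr_gt0// profile0_gt0. Qed.

Let cap_probE : p%:R * cap_prob m y = p%:R * (m.+1%:R * profile m (Num.sqrt y)) / (m.+1%:R * profile m 0).
Proof. by rewrite /cap_prob; field; rewrite gt_eqF ?profile0_gt0//= addrC natr1. Qed.

(** The Mills bound gives W b / sqrt y, and [y_lb] bounds b / sqrt y by 1 / sqrt (1 - d), hence by 1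
    / (1 - d). *)
Lemma tail_ub : p%:R * cap_prob m (1 - s) <= W / (1 - d).
Proof.
rewrite -/y cap_probE.
have h := @profile_ub R m m0 (Num.sqrt y); rewrite ry0 ry1 slice_sqrt// sE in h.
have {}h := h isT.
apply: (@le_trans _ _ (W * (b / Num.sqrt y))).
  rewrite ler_pdivrMr//.
  have -> : W * (b / Num.sqrt y) * (m.+1%:R * profile m 0) =
     p%:R * (tail_scale * W / p%:R / Num.sqrt y).
    rewrite /tail_scale -/b; field; by rewrite gt_eqF//= gt_eqF.
  by rewrite ler_pM2l.
apply: ler_wpM2l => //.
rewrite ler_pdivrMr// mulrC ler_pdivlMr//.
rewrite -(@ler_pXn2r _ 2)// ?nnegrE ?mulr_ge0 ?(ltW ry0) ?(ltW b0) ?(ltW dm0)//.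
rewrite exprMn bb sqr_sqrtr; last by case/andP: y01 => /ltW.
apply: le_trans y_lb; have t0 : 0 <= 1 - theta by rewrite subr_ge0 ltW.
rewrite expr2 mulrA [(1 - theta) * _]mulrC; apply: ler_piMr.
  by rewrite mulr_ge0// ltW.
by rewrite gerBl ltW.
Qed.

Hypothesis Wd : d <= W.
Hypothesis small2 : expR (- (d * L)) <= d ^+ 2 / 2.

(** [profile_lb] needs an upper height. It is taken so far above y that [slice] drops by the factor
    d, which costs 1 - d, yet so close that its square stays below (1 + d) (1 - theta). *)
Lemma tail_lb : W * (1 - d) / (1 + d) <= p%:R * cap_prob m (1 - s).
Proof.
rewrite -/y cap_probE.
(* This is d^(2/m), so that scaling s by it multiplies s^(m/2) by d. *)
pose k := expR (2 * ln d / m%:R).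
have k0 : 0 < k by exact: expR_gt0.
have k1 : k <= 1.
  rewrite -expR0 ler_expR pmulr_lle0 ?invr_gt0// pmulr_rle0//.
  by apply: ln_le0; rewrite (le_trans d1)// ler_pdivrMr// mul1r ler1n.
pose s' := k * s; pose y' := 1 - s'.
have s'0 : 0 <= s' by rewrite mulr_ge0// ltW.
have s's : s' <= s by rewrite ler_piMl.
have s'1 : s' <= 1 by exact: le_trans s1.
have s'E : Num.sqrt s' ^+ m = d * Num.sqrt s ^+ m.
  by rewrite /s' sqrtrM ?(ltW k0)// exprMn sqrt_expR_pow lnK.
(* Since [tail_scale] >= 1/2 and W >= d, the product d * tail_scale * W is at least d^2 / 2 >= p^(-
   d), whence s' >= theta^(1 + d). *)
have y'_ub : y' <= (1 + d) * (1 - theta).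
  have : expR (- ((1 + d) * (2 * L / m%:R))) <= s'.
    have -> : - ((1 + d) * (2 * L / m%:R)) = 2 * (- (d * L) - L) / m%:R by field; rewrite gt_eqF.
    apply: ger_of_pow => //; rewrite s'E sE expRD (expRN L) Lp mulrA ler_pM2r ?invr_gt0//.
    apply: (le_trans small2); rewrite (_ : d ^+ 2 / 2 = d * (1 / 2 * d)); last by field.
    by rewrite ler_pM2l//; apply: ler_pM; [|exact: ltW|exact: tail_scale_lb|exact: Wd].
  have := one_sub_expR_ub (2 * L / m%:R) (ltW d0).
  by rewrite -/theta => h1 h2; apply: le_trans h1; rewrite lerD2l lerN2.
have y'y : y <= y' by rewrite lerD2l lerN2.
have y'0 : 0 < y' by apply: lt_le_trans y'y; case/andP: y01.
have ry'0 : 0 < Num.sqrt y' by rewrite sqrtr_gt0.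
have ry'1 : Num.sqrt y' <= 1 by rewrite -[leRHS]sqrtr1 ler_wsqrtr// gerBl.
have h := profile_lb m (ltW ry0) (ler_wsqrtr y'y) ry'1 ry'0.
rewrite !slice_sqrt// s'E sE in h.
have hb : 0 <= profile m (Num.sqrt y') by rewrite profile_ge0// (ltW ry'0).
have h' : (tail_scale * W / p%:R - d * (tail_scale * W / p%:R)) / Num.sqrt y' <=
    m.+1%:R * profile m (Num.sqrt y).
  apply: (le_trans h); by rewrite ler_pM2l// gerBl.
apply: (@le_trans _ _ (W * (1 - d) * (b / Num.sqrt y'))).
  rewrite ler_wpM2l ?mulr_ge0 ?(ltW dm0)//.
  rewrite ler_pdivlMr// mulrC ler_pdivrMr//.
  rewrite -(@ler_pXn2r _ 2)// ?nnegrE ?mulr_ge0 ?(ltW ry'0) ?(ltW b0) ?(ltW dp0)//.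
  rewrite exprMn bb sqr_sqrtr ?(ltW y'0)//.
  apply: (le_trans y'_ub); rewrite mulrC ler_wpM2l ?subr_ge0 ?(ltW th1)//.
  by rewrite expr2 ler_peMl ?(ltW dp0)// lerDl ltW.
rewrite ler_pdivlMr//.
have -> : W * (1 - d) * (b / Num.sqrt y') * (m.+1%:R * profile m 0) =
    p%:R * ((tail_scale * W / p%:R - d * (tail_scale * W / p%:R)) / Num.sqrt y').
  rewrite /tail_scale -/b; field; by rewrite gt_eqF//= gt_eqF.
by rewrite ler_pM2l.
Qed.

End tail.

(** * Caps at the normalized level *)

Section normalizing_constants.
Context {R : realType}.
Variables m p : nat.
Hypotheses (m0 : (0 < m)%N) (p1 : (1 < p)%N).

Let mr0 : 0 < m%:R :> R. Proof. by rewrite ltr0n. Qed.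

Lemma theta_powR : (p%:R : R) `^ (- 2 / m%:R) = theta m p.
Proof.
rewrite /powR pnatr_eq0 gtn_eqF ?(ltn_trans _ p1)// /theta; congr expR.
by field; rewrite gt_eqF.
Qed.

Lemma c_E : c_ p m.+1 = tail_scale m p `^ (2 / m%:R) :> R.
Proof.
rewrite /c_ /= theta_powR Beta_profile// /tail_scale; congr (_ `^ _); congr (_ * _).
by field; rewrite gt_eqF.
Qed.

Lemma c_gt0 : 0 < c_ p m.+1 :> R.
Proof. by rewrite c_E powR_gt0// tail_scale_gt0. Qed.

Lemma b_gt0 : 0 < b_ p m.+1 :> R.
Proof.
rewrite /b_ /= mulr_gt0 ?c_gt0// mulr_gt0 ?divr_gt0// theta_powR.
exact: theta_gt0.
Qed.

(** Since b = (2 / m) theta c and a = 1 - theta c, the affine normalization turns into the factor 1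
    - 2 x / m of the limit law. *)
Lemma levelE (x : R) :
  1 - (a_ p m.+1 + b_ p m.+1 * x) = theta m p * c_ p m.+1 * (1 - 2 / m%:R * x).
Proof. by rewrite /a_ /b_ /= theta_powR; ring. Qed.

(** Beyond m / 2 the level exceeds every squared cosine; this is the source of the indicator in the
    limit law. *)
Lemma level_gt1 (x : R) : m%:R / 2 < x -> 1 < a_ p m.+1 + b_ p m.+1 * x.
Proof.
move=> xm; rewrite -subr_lt0 levelE pmulr_rlt0; last first.
  by rewrite mulr_gt0 ?c_gt0// theta_gt0.
rewrite subr_lt0 mulrAC ltr_pdivlMr// mul1r; lra.
Qed.

Lemma limit_cdf_gt (x : R) : m%:R / 2 < x -> limit_cdf m.+1 x = 1 :> R.
Proof. by move=> xm; rewrite /limit_cdf /= xm leNgt xm mulr0 addr0. Qed.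

Lemma limit_cdf_le (x : R) : x <= m%:R / 2 ->
  limit_cdf m.+1 x = expR (- (Num.sqrt (1 - 2 / m%:R * x) ^+ m)) :> R.
Proof.
move=> xm; rewrite /limit_cdf /= xm ltNge xm add0r mulr1 powR_half//.
by rewrite subr_ge0 mulrAC ler_pdivrMr// mul1r; lra.
Qed.

(** A bound of W independent of m, by 1 + t <= exp t; a negative base is harmless because its square
    root is 0. *)
Lemma sqrt_pow_le_expR (x : R) : Num.sqrt (1 - 2 / m%:R * x) ^+ m <= expR (- x).
Proof.
rewrite -(sqrt_expR_pow m0) ler_pXn2r ?nnegrE ?sqrtr_ge0//.
apply: ler_wsqrtr; rewrite mulrN mulNr mulrAC; exact: expR_ge1Dx.
Qed.

Lemma sqrt_level_pow (x : R) : x <= m%:R / 2 ->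
  Num.sqrt (theta m p * c_ p m.+1 * (1 - 2 / m%:R * x)) ^+ m =
  tail_scale m p * Num.sqrt (1 - 2 / m%:R * x) ^+ m / p%:R :> R.
Proof.
move=> xm.
have w0 : 0 <= 1 - 2 / m%:R * x.
  by rewrite subr_ge0 mulrAC ler_pdivrMr// mul1r; lra.
have th0 := @theta_gt0 R m p; have c0 := c_gt0.
rewrite sqrtrM; last by rewrite mulr_ge0// ltW.
rewrite sqrtrM; last exact: ltW.
rewrite !exprMn sqrt_theta_pow//.
have -> : Num.sqrt (c_ p m.+1) ^+ m = tail_scale m p :> R.
  rewrite -powR_half ?(ltW c0)// c_E -powRrM.
  have -> : 2 / m%:R * (m%:R / 2) = 1 :> R by field; rewrite gt_eqF.
  by rewrite powRr1// ltW// tail_scale_gt0.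
by ring.
Qed.

(** All conditions bound [ln p] from below in terms of x and d alone, never of m. The error is d for
    replacing (1 - q)^p by exp (- p q), plus 2 d A + d for replacing p q by W. *)
Lemma cap_prob_approx (x d : R) : x <= m%:R / 2 -> 0 < d -> d <= 1 / 2 ->
  let A := expR (- x) in
  1 <= ln (p%:R : R) -> 8 * A <= d ^+ 2 * ln (p%:R : R) -> 2 <= d ^+ 3 * ln (p%:R : R) ->
  4 * A <= ln (p%:R : R) -> 8 * A ^+ 2 <= d * ln (p%:R : R) ->
  let y := a_ p m.+1 + b_ p m.+1 * x in
  0 < y <= 1 /\ `|(1 - cap_prob m y) ^+ p - limit_cdf m.+1 x| <= 2 * d * (A + 1).
Proof.
move=> xm d0 d1 A l1 l2 l3 l4 l5 y.
set l := ln _ in l1 l2 l3 l4 l5.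
have A0 : 0 < A by exact: expR_gt0.
have pl : l <= p%:R.
  have pp : 0 < p%:R :> R by rewrite ltr0n (ltn_trans _ p1).
  have := expR_ge1Dx l; rewrite /l lnK ?posrE//; lra.
pose W := Num.sqrt (1 - 2 / m%:R * x) ^+ m.
have W0 : 0 <= W by rewrite exprn_ge0// sqrtr_ge0.
have WA : W <= A by exact: sqrt_pow_le_expR.
pose s := theta m p * c_ p m.+1 * (1 - 2 / m%:R * x).
have s0 : 0 <= s.
  rewrite mulr_ge0//; first by rewrite mulr_ge0 ?ltW ?c_gt0// theta_gt0.
  by rewrite subr_ge0 mulrAC ler_pdivrMr// mul1r; lra.
have yE : y = 1 - s by rewrite /s -levelE /y; ring.
have sE := sqrt_level_pow xm.
have dl0 : 0 <= d * l by rewrite mulr_ge0// ?ltW//; lra.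
have small : tail_scale m p * W <= expR (d * l).
  (* The quadratic bound exp (d l) >= (d l)^2 / 2 beats tail_scale * W <= (2 l + 2) A <= 4 l A. *)
  have := @expR_ge1Dxn R (d * l) 1 dl0 => h.
  have {}h : (d * l) ^+ 2 / 2 <= expR (d * l) by apply: le_trans h; rewrite lerDr.
  apply: le_trans h.
  have h1 := @tail_scale_ub R m p m0 p1; rewrite -/l in h1.
  have h2 : tail_scale m p * W <= (2 * l + 2) * A.
    by apply: ler_pM => //; rewrite ltW// tail_scale_gt0.
  apply: (le_trans h2).
  have : 8 * A * l <= d ^+ 2 * l * l by rewrite ler_pM2r//; lra.
  rewrite exprMn; nra.
have small2 : expR (- (d * l)) <= d ^+ 2 / 2.
  rewrite expRN -[leRHS]invrK lef_pV2 ?posrE ?expR_gt0 ?invr_gt0 ?divr_gt0 ?exprn_gt0//.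
  apply: (@le_trans _ _ (1 + d * l)); last exact: expR_ge1Dx.
  rewrite invf_div ler_pdivrMr ?exprn_gt0//.
  have : 0 <= d ^+ 2 by rewrite sqr_ge0.
  by rewrite exprS in l3; nra.
have y01 := tail_level m0 p1 s0 d0 d1 sE small.
rewrite -yE in y01.
split=> //.
have lub := tail_ub m0 p1 s0 W0 d0 d1 sE small.
rewrite -yE in lub.
have llb := tail_lb m0 p1 s0 W0 d0 d1 sE small.
rewrite -yE in llb.
set q := cap_prob m y in lub llb *.
have q0 : 0 <= q.
  rewrite /q /cap_prob divr_ge0 ?profile_ge0 ?sqrtr_ge0 ?lexx ?ler01//=.
  by rewrite -[leRHS]sqrtr1 ler_wsqrtr//; case/andP: y01.
have p0 : (0 < p)%N by apply: ltn_trans p1.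
have pr0 : 0 < p%:R :> R by rewrite ltr0n.
pose lam := p%:R * q.
have lam0 : 0 <= lam by rewrite mulr_ge0.
have lam1 : lam <= W + 2 * d * W.
  apply: (le_trans lub); rewrite ler_pdivrMr; last by lra.
  have : 0 <= d * W by rewrite mulr_ge0// ltW.
  by nra.
have lam2 : W - 2 * d * A - d <= lam.
  have dA : 0 <= d * A by rewrite mulr_ge0// ltW.
  (* For W < d the left side is negative, and [tail_lb] is only called in the other case. *)
  have [Wd|Wd] := leP d W; last by lra.
  apply: le_trans (llb Wd small2); rewrite ler_pdivlMr; last by lra.
  have : 0 <= d * (A - W) by rewrite mulr_ge0 ?subr_ge0//; exact: ltW.
  have : 0 <= d * d * A by rewrite -mulrA (mulr_ge0 (ltW d0)).
  by nra.
have dWA : d * W <= d * A by rewrite ler_pM2l.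
have lamA : lam <= 2 * A.
  have : d * A <= 1 / 2 * A by rewrite ler_pM2r.
  by lra.
have qE : q = lam / p%:R by rewrite /lam; field; rewrite gt_eqF.
have q1 : q <= 1 / 2 by rewrite qE ler_pdivrMr//; lra.
have h1 := expr_one_sub_expR p0 q0 q1; rewrite -/lam in h1.
have h2 := expR_lipschitz_norm lam0 W0.
have h3 : `|lam - W| <= 2 * d * A + d by rewrite ler_norml; apply/andP; split; lra.
(* Here 2 lam q = 2 lam^2 / p <= 8 A^2 / p <= d ln p / p <= d. *)
have h4 : 2 * lam * q <= d.
  rewrite qE mulrA ler_pdivrMr//.
  have : lam * lam <= 2 * A * (2 * A) by apply: ler_pM.
  have : d * l <= d * p%:R by rewrite ler_pM2l.
  by rewrite expr2 in l5; lra.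
rewrite limit_cdf_le// -/W.
apply: (le_trans (ler_distD (expR (- lam)) _ _)).
apply: (le_trans (lerD h1 h2)); lra.
Qed.

End normalizing_constants.

(** * Uniform and double limits *)

Section uniform_limit.
Context {R : realType}.

Lemma cap_prob_limit (x e : R) : 0 < e ->
  exists N : nat, forall p m : nat, (N <= p)%N -> (1 < p)%N -> (0 < m)%N ->
    x <= m%:R / 2 ->
    let y := a_ p m.+1 + b_ p m.+1 * x in
    0 < y <= 1 /\ `|(1 - cap_prob m y) ^+ p - limit_cdf m.+1 x| <= e.
Proof.
move=> e0; pose A : R := expR (- x); have A0 : 0 < A by exact: expR_gt0.
pose d : R := Num.min (1 / 2) (e / (2 * (A + 1))).
have A10 : 0 < 2 * (A + 1) by lra.
have d0 : 0 < d by rewrite lt_min divr_gt0//= divr_gt0.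
have d1 : d <= 1 / 2 by rewrite ge_min lexx.
have de : 2 * d * (A + 1) <= e.
  have : d <= e / (2 * (A + 1)) by rewrite ge_min lexx orbT.
  by rewrite ler_pdivlMr//; lra.
(* Each summand is the threshold for [ln p] in one condition of [cap_prob_approx]; all are
   nonnegative, so [ln p >= X] meets them together. *)
pose X := 1 + 8 * A / d ^+ 2 + 2 / d ^+ 3 + 4 * A + 8 * A ^+ 2 / d.
exists (Num.bound (expR X)) => p m Np p1 m0 xm.
have pr0 : 0 < p%:R :> R by rewrite ltr0n (ltn_trans _ p1).
have Xp : X <= ln (p%:R : R).
  rewrite -(expRK X) ler_ln ?posrE ?expR_gt0//.
  apply: (le_trans (ltW (archi_boundP (expR_ge0 X)))); by rewrite ler_nat.
have t1 : 0 <= 8 * A / d ^+ 2 by rewrite divr_ge0 ?sqr_ge0// mulr_ge0// ltW.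
have t2 : 0 <= 2 / d ^+ 3 by rewrite divr_ge0// exprn_ge0// ltW.
have t3 : 0 <= 4 * A by rewrite mulr_ge0// ltW.
have t4 : 0 <= 8 * A ^+ 2 / d by rewrite divr_ge0 ?mulr_ge0 ?sqr_ge0// ltW.
have [|||||y01 H] := @cap_prob_approx R m p m0 p1 x d xm d0 d1; rewrite -/A.
- by rewrite /X in Xp; lra.
- by rewrite -ler_pdivrMl ?exprn_gt0// mulrC; rewrite /X in Xp; lra.
- by rewrite -ler_pdivrMl ?exprn_gt0// mulrC; rewrite /X in Xp; lra.
- by rewrite /X in Xp; lra.
- by rewrite -ler_pdivrMl// mulrC; rewrite /X in Xp; lra.
by split=> //; exact: le_trans de.
Qed.

Lemma limit_cdf_cvg (x : R) : limit_cdf n x @[n --> \oo] --> expR (- expR (- x)).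
Proof.
rewrite -cvg_shiftS.
pose w (m : nat) : R := 1 - 2 * x * m%:R^-1.
have invm : (m%:R^-1 : R) @[m --> \oo] --> (0 : R).
  by rewrite -cvg_shiftS; exact: cvg_harmonic.
have wcvg : w m @[m --> \oo] --> (1 : R).
  rewrite -[X in _ --> X]subr0; apply: cvgB; first exact: cvg_cst.
  by rewrite -[X in _ --> X](mulr0 (2 * x)); apply: cvgM => //; exact: cvg_cst.
have Wcvg : Num.sqrt (w m) ^+ m @[m --> \oo] --> expR (- x).
  apply: (@squeeze_cvgr _ _ _ _ (fun m => expR (- (x * (w m)^-1))) (fun=> expR (- x))).
  - near=> m.
    have m0 : (0 < m)%N by near: m; exact: nbhs_infty_gt.
    have mr0 : 0 < m%:R :> R by rewrite ltr0n.
    have w0 : 0 < w m by near: m; apply: (cvgr_gt _ wcvg); exact: ltr01.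
    have wE : w m = 1 - 2 / m%:R * x by rewrite /w mulrAC.
    apply/andP; split; last by rewrite wE; exact: sqrt_pow_le_expR.
    rewrite -(sqrt_expR_pow m0) ler_pXn2r ?nnegrE ?sqrtr_ge0//.
    apply: ler_wsqrtr.
    (* By 1 + t <= exp t at t = 1 / w - 1, w >= exp (1 - 1 / w). As 1 - w = 2 x / m, the power m / 2
       of the right side is exp (- x / w), the lower function of the squeeze. *)
    have -> : 2 * - (x * (w m)^-1) / m%:R = - ((w m)^-1 - 1).
      have -> : (w m)^-1 - 1 = (1 - w m) / w m by field; rewrite gt_eqF.
      have -> : 1 - w m = 2 * x / m%:R by rewrite /w; ring.
      by field; rewrite !gt_eqF.
    rewrite expRN -[leRHS]invrK lef_pV2 ?posrE ?expR_gt0 ?invr_gt0//.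
    by have := expR_ge1Dx ((w m)^-1 - 1); rewrite addrC subrK.
  - apply: (cvg_comp _ expR) (@continuous_expR R _).
    apply: cvgN; rewrite -[X in _ --> X](mulr1 x); apply: cvgM; first exact: cvg_cst.
    by rewrite -[X in _ --> X]invr1; apply: cvgV => //; exact: oner_neq0.
  - exact: cvg_cst.
have Lcvg : expR (- (Num.sqrt (w m) ^+ m)) @[m --> \oo] --> expR (- expR (- x)).
  by apply: (cvg_comp _ expR) (@continuous_expR R _); exact: cvgN.
apply: cvg_trans Lcvg; apply: near_eq_cvg; near=> m.
have m0 : (0 < m)%N by near: m; exact: nbhs_infty_gt.
rewrite /= limit_cdf_le//; last first.
  rewrite ler_pdivlMr//; near: m; exact: nbhs_infty_ger.
by rewrite /w mulrAC.
Unshelve. all: by end_near. Qed.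

Variables (F : nat -> nat -> R) (G : nat -> R) (n0 : nat).
Hypothesis FG : forall e : R, 0 < e -> exists N : nat,
  forall p n, (N <= p)%N -> (n0 <= n)%N -> `|F p n - G n| <= e.

Lemma sup_cvg0 :
  ereal_sup [set (`|F p n - G n|)%:E | n in [set n : nat | (n0 <= n)%N]]
    @[p --> \oo] --> 0%E.
Proof.
apply/fine_cvgP.
have bnd p e : (forall n, (n0 <= n)%N -> `|F p n - G n| <= e) ->
  (0%:E <= ereal_sup [set (`|F p n - G n|)%:E | n in [set n : nat | (n0 <= n)%N]] <= e%:E)%E.
  move=> H; apply/andP; split.
    (* The index n0 shows that the set is nonempty; an empty supremum would be -oo. *)
    apply: (@le_trans _ _ (`|F p n0 - G n0|)%:E); first by rewrite lee_fin.
    by apply: ereal_sup_ubound; exists n0 => /=.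
  by apply: ge_ereal_sup => _ [n /= n0n <-]; rewrite lee_fin H.
split.
  have [N NH] := FG ltr01; exists N => // p /= Np.
  have /andP[h1 h2] := bnd p 1 (fun n => NH p n Np).
  by rewrite ge0_fin_numE// (le_lt_trans h2)// ltry.
apply/cvgrPdist_le => e e0; have [N NH] := FG e0; exists N => // p /= Np.
have /andP[h1 h2] := bnd p e (fun n => NH p n Np).
rewrite sub0r normrN; move: h1 h2.
by case: ereal_sup => [r| |]//=; rewrite !lee_fin => r0; rewrite ger0_norm.
Qed.

(** Uniformity in n lets the thresholds for p and n be chosen separately, so no relation between
    their rates arises. *)
Lemma double_cvg (l : R) : G n @[n --> \oo] --> l ->
  F pn.1 pn.2 @[pn --> (\oo, \oo)] --> l.
Proof.
move=> Gl; apply/cvgrPdist_le => e e0.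
have e20 : 0 < e / 2 by rewrite divr_gt0.
have [N NH] := FG e20.
move/cvgrPdist_le : Gl => /(_ _ e20) [M _ MH].
exists ([set p | (N <= p)%N], [set n | (maxn M n0 <= n)%N]).
  by split; [exists N|exists (maxn M n0)].
move=> [p n] /= [Np]; rewrite geq_max => /andP[Mn n0n].
apply: (le_trans (ler_distD (G n) _ _)).
have h1 := MH n Mn; have h2 := NH p n Np n0n; rewrite distrC in h2.
by rewrite [leRHS](splitr e) lerD.
Qed.

End uniform_limit.

(** * Independence *)

Section conditioning.
Local Open Scope ereal_scope.
Context {R : realType} {d : measure_display} {T : measurableType d}.
Variable P : probability T R.
Context d1 d2 (S1 : measurableType d1) (S2 : measurableType d2).

(** Independence makes the joint law a product, and the probability is the mean over V of the one
    with V frozen. When the latter is almost surely constant, the law of V disappears. *)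
Lemma independent2_prob (V : {RV P >-> S1}) (X : {RV P >-> S2}) (E : set (S1 * S2)) (k : R) :
  independent2 P V X -> measurable E -> (0 <= k)%R ->
  {ae P, forall t, P [set t' | E (V t, X t')] = k%:E} ->
  P [set t | E (V t, X t)] = k%:E.
Proof.
move=> ind mE k0 aeE.
have mVX : measurable_fun setT (fun t => (V t, X t)).
  by apply: measurable_fun_pair; exact: measurable_funP.
have [m mE'] := pushforward_measure_exists P mVX.
have -> : P [set t | E (V t, X t)] = m E by rewrite mE'.
rewrite -(@product_measure_unique _ _ _ _ _ (distribution P V) (distribution P X))//; last first.
  by move=> A B mA mB; rewrite mE' /pushforward /distribution -ind.
transitivity (\int[P]_t (distribution P X (xsection E (V t)))).
  rewrite /product_measure1 ge0_integral_pushforward//.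
  exact: (measurable_fun_xsection (distribution P X) mE).
rewrite (@ae_eq_integral _ _ _ P setT (fun=> k%:E))//.
- by rewrite integral_cst//= probability_setT mule1.
- apply: (measurableT_comp (measurable_fun_xsection (distribution P X) mE)).
  exact: measurable_funP.
- move: aeE; apply: filterS => t /= <- _.
  rewrite /distribution /pushforward; congr (P _).
  by apply/seteqP; split=> t'; rewrite /xsection /= inE.
Qed.

End conditioning.

Section families.
Local Open Scope ereal_scope.
Context {R : realType} {d d' : measure_display} {T : measurableType d} {S : measurableType d'}.

(** With C fixed, both sides are measures in A, finite and equal on boxes. *)
Lemma pi_lambda_restr n (M : {measure set T -> \bar R}) (xi : T -> n.-tuple S)
    (C : set T) (nu : {measure set (n.-tuple S) -> \bar R}) (r : R) :
  measurable_fun setT xi -> measurable C -> M setT < +oo -> (0 <= r)%R ->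
  (forall B, (forall i, measurable (B i)) ->
    M (xi @^-1` rect B `&` C) = r%:E * nu (rect B)) ->
  forall A, measurable A -> M (xi @^-1` A `&` C) = r%:E * nu A.
Proof.
move=> mxi mC Moo r0 H A mA.
have [m mE] := pushforward_measure_exists (mrestr M mC) mxi.
pose r' := NngNum r0.
have mS (B : set (n.-tuple S)) : m B = M (xi @^-1` B `&` C) by rewrite mE.
rewrite -mS.
transitivity (mscale r' nu A); last by [].
apply: rects_unique => // [|B mB].
  rewrite mS preimage_setT setTI; apply: le_lt_trans Moo.
  by apply: le_measure; rewrite ?inE.
by rewrite mS H.
Qed.

Lemma pi_lambda_family p n (M : {measure set T -> \bar R}) (xi : 'I_p -> T -> n.-tuple S)
    (nu : 'I_p -> probability (n.-tuple S) R) (c : R) :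
  (forall j, measurable_fun setT (xi j)) -> M setT < +oo -> (0 <= c)%R ->
  (forall B : 'I_p -> 'I_n -> set S, (forall j i, measurable (B j i)) ->
    M (\bigcap_(j in [set: 'I_p]) xi j @^-1` rect (B j)) =
    c%:E * \prod_(j < p) nu j (rect (B j))) ->
  forall D : 'I_p -> set (n.-tuple S), (forall j, measurable (D j)) ->
    M (\bigcap_(j in [set: 'I_p]) xi j @^-1` D j) = c%:E * \prod_(j < p) nu j (D j).
Proof.
move=> mxi Moo c0 H.
have mrects (D : set (n.-tuple S)) : rects D -> measurable D.
  by move=> [B mB ->]; exact: measurable_rect.
(* One set is freed at a time: the first k are arbitrary, the others are still boxes. *)
suff main k : (k <= p)%N -> forall D : 'I_p -> set (n.-tuple S),
    (forall j : 'I_p, if (j < k)%N then measurable (D j) else rects (D j)) ->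
    M (\bigcap_(j in [set: 'I_p]) xi j @^-1` D j) = c%:E * \prod_(j < p) nu j (D j).
  by move=> D mD; apply: (main p) => // j; rewrite ltn_ord.
elim: k => [_ D mD|k IH kp D mD].
  have [B HB] : exists B : 'I_p -> 'I_n -> set S, forall j, (forall i, measurable (B j i)) /\ D j = rect (B j).
    have /choice : forall j, exists B : 'I_n -> set S, (forall i, measurable (B i)) /\ D j = rect B.
      by move=> j; case: (mD j) => B mB ->; exists B.
    by move=> [B HB]; exists B.
  have -> : D = (fun j => rect (B j)) by apply/funext => j; have [] := HB j.
  by apply: H => j i; have [] := HB j.
pose j0 := Ordinal kp.
have mDm j : measurable (D j).
  by have := mD j; case: ifP => // _; exact: mrects.
pose C := \bigcap_(j in [set j : 'I_p | j != j0]) xi j @^-1` D j.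
have mC : measurable C.
  apply: fin_bigcap_measurable => // j _; exact: measurable_preimage.
pose r := (c * fine (\prod_(j < p | j != j0) nu j (D j)))%R.
have prfin : \prod_(j < p | j != j0) nu j (D j) \is a fin_num.
  by apply: prode_fin_num => j _; exact: fin_num_measure.
have r0 : (0 <= r)%R.
  by rewrite mulr_ge0// fine_ge0// prode_ge0.
have rE (E : set (n.-tuple S)) : measurable E ->
   r%:E * nu j0 E = c%:E * (nu j0 E * \prod_(j < p | j != j0) nu j (D j)).
  by move=> mE; rewrite /r EFinM fineK// -muleA; congr (_ * _); rewrite muleC.
have capE (E : set (n.-tuple S)) : \bigcap_(j in [set: 'I_p]) xi j @^-1`
    (if j == j0 then E else D j) = xi j0 @^-1` E `&` C.
  apply/seteqP; split=> t /=.
    move=> h; split; first by have := h j0 I; rewrite eqxx.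
    by move=> j /= jj0; have := h j I; rewrite (negbTE jj0).
  by move=> [h1 h2] j _; case: eqP => [->//|/eqP jj0]; exact: h2.
have DE : D = (fun j => if j == j0 then D j0 else D j).
  by apply/funext => j; case: eqP => [->|].
rewrite [in LHS]DE capE (bigD1 j0)//= -rE//.
apply: pi_lambda_restr => // B mB.
rewrite -capE rE; last exact: measurable_rect.
rewrite IH; last 2 first.
- exact: ltnW.
- move=> j; have := mD j; rewrite ltnS; case: (eqVneq j j0) => [-> _|jj0].
    by rewrite /= ltnn; exists B.
  have -> : (j <= k)%N = (j < k)%N.
    by rewrite leq_eqVlt; case: eqP => // jk; case/eqP: jj0; apply: val_inj.
  by [].
congr (_ * _); rewrite (bigD1 j0)//= eqxx; congr (_ * _).
by apply: eq_bigr => j /negbTE ->.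
Qed.

End families.

(** * The spherical maximum *)

Section spherical.
Local Open Scope ereal_scope.
Context {R : realType}.

Definition cap_tail (k : nat) (y : R) : R := if (y <= 1)%R then cap_prob k y else 0%R.

Lemma cap_tail_le1 k y : (0 < k)%N -> (0 < y)%R -> (cap_tail k y <= 1)%R.
Proof.
move=> k0 y0; rewrite /cap_tail; case: ifP => // y1.
rewrite /cap_prob ler_pdivrMr ?profile0_gt0// mul1r.
have ry0 : (0 < Num.sqrt y)%R by rewrite sqrtr_gt0.
have ry1 : (Num.sqrt y <= 1)%R by rewrite -[leRHS]sqrtr1 ler_wsqrtr.
have h := profile_lb k (lexx 0%R) (ltW ry0) ry1 ry0.
rewrite -subr_ge0 -(pmulr_rge0 _ (ltr0Sn R k)); apply: le_trans h.
by rewrite divr_ge0 ?(ltW ry0)// subr_ge0 slice0 slice_le1.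
Qed.

Lemma nsq_tadd_proj n (v u : n.-tuple R) : nsq u = 1%R ->
  nsq (tadd v (topp (tscale (inner v u) u))) = (nsq v - inner v u ^+ 2)%R.
Proof.
move=> u1; rewrite -inner_nsq !innerDl !innerDr !innerNl !innerNr !innerZl !innerZr.
by rewrite !inner_nsq u1 (innerC u v); ring.
Qed.

(** Cauchy-Schwarz, as nonnegativity of the squared norm of the projection. *)
Lemma sqr_inner_le n (v u : n.-tuple R) : nsq u = 1%R -> (inner v u ^+ 2 <= nsq v)%R.
Proof.
by move=> u1; rewrite -subr_ge0 -nsq_tadd_proj// nsq_ge0.
Qed.

Lemma sphere_uniform_tail k (u : k.+1.-tuple R) y : (0 < k)%N -> nsq u = 1%R -> (0 < y)%R ->
  sphere_uniform [set l | (y <= inner l u ^+ 2)%R] = (cap_tail k y)%:E.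
Proof.
move=> k0 u1 y0; rewrite /cap_tail; have [y1|y1] := leP y 1%R.
  by rewrite sphere_uniform_cap// y0.
rewrite /sphere_uniform sphere_surface_cap.
rewrite (_ : _ `&` _ = set0) ?measure0 ?mule0 ?mul0e//.
apply/seteqP; split=> // v [_ [v0 yv]]; have := sqr_inner_le v u1.
nra.
Qed.

Lemma bigmax_sqr_lt p (f : 'I_p -> R) (y : R) : (0 < y)%R ->
  ((\big[Num.max/0]_(j < p) `|f j|) ^+ 2 < y)%R <-> forall j, (f j ^+ 2 < y)%R.
Proof.
move=> y0.
have E (a : R) : (0 <= a)%R -> (a ^+ 2 < y)%R = (a < Num.sqrt y)%R.
  move=> a0; rewrite -[in LHS](sqr_sqrtr (ltW y0)) ltr_pXn2r// ?nnegrE ?sqrtr_ge0//.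
rewrite E; last by apply: bigmax_ge_id.
split=> [/bigmax_ltP[_ h] j|h].
  by rewrite -(real_normK (num_real (f j))) E//; exact: h.
apply/bigmax_ltP; split; first by rewrite sqrtr_gt0.
by move=> j _; rewrite -E// real_normK ?num_real.
Qed.

Context {d : measure_display} {T : measurableType d}.
Variables (P : probability T R) (p k : nat).
Hypothesis k0 : (0 < k)%N.

Lemma spherical_prob (L : 'I_p -> {RV P >-> k.+1.-tuple R}) (U : {RV P >-> k.+1.-tuple R})
    (y : R) : spherical_model L U -> (0 < y)%R ->
  P [set t | (max_inner L U t ^+ 2 < y)%R] = ((1 - cap_tail k y) ^+ p)%:E.
Proof.
move=> [lawL indL U1 indU] y0.
have mX : measurable_fun setT (fun t => [tuple L j t | j < p]).
  apply/measurable_fun_tnthP => j; rewrite (_ : _ \o _ = L j) ?measurable_funP//.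
  by apply/funext => t /=; rewrite tnth_mktuple.
pose X : {RV P >-> p.-tuple (k.+1.-tuple R)} :=
  HB.pack (fun t => [tuple L j t | j < p]) (isMeasurableFun.Build _ _ _ _ _ mX).
pose E : set (k.+1.-tuple R * p.-tuple (k.+1.-tuple R)) :=
  \bigcap_(j in [set: 'I_p]) [set uls | (inner (tnth uls.2 j) uls.1 ^+ 2 < y)%R].
have mE : measurable E.
  apply: fin_bigcap_measurable => // j _.
  apply: measurable_set_lt; last exact: measurable_cst.
  apply: measurable_funX; apply: measurable_inner => //.
  exact: (measurable_tnth_comp (f := snd)).
have -> : [set t | (max_inner L U t ^+ 2 < y)%R] = [set t | E (U t, X t)].
  apply/seteqP; split=> t /=; rewrite /max_inner.
    move=> /(bigmax_sqr_lt _ y0) h j _ /=; rewrite tnth_mktuple; exact: h.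
  move=> h; apply/(bigmax_sqr_lt _ y0) => j; have := h j I.
  by rewrite /= tnth_mktuple.
have q1 : (0 <= 1 - cap_tail k y)%R by rewrite subr_ge0 cap_tail_le1.
apply: independent2_prob => //; first by rewrite exprn_ge0.
move: U1; apply: filterS => t Ut1.
have u1 : nsq (U t) = 1%R.
  have : (enorm (U t) ^+ 2 = 1)%R by rewrite Ut1 expr1n.
  by rewrite enormE sqr_sqrtr// nsq_ge0.
pose A := [set l : k.+1.-tuple R | (y <= inner l (U t) ^+ 2)%R].
have mA : measurable A.
  apply: measurable_set_le; first exact: measurable_cst.
  apply: measurable_funX; apply: measurable_inner; first exact: measurable_id.
  exact: measurable_cst.
have -> : [set t' | E (U t, X t')] = \bigcap_(j in [set` [set: 'I_p]%SET]) (L j @^-1` (~` A)).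
  apply/seteqP; split=> t' /= h j _; have := h j; rewrite /A /= ?inE tnth_mktuple.
    by move=> /(_ I) yt; apply/negP; rewrite -ltNge.
  by move=> /(_ isT) /negP; rewrite -ltNge.
rewrite indL; last by move=> j _; exact: measurableC.
rewrite (eq_bigr (fun=> (1 - cap_tail k y)%:E)) => [|j _].
  by rewrite prodEFin prodr_const cardsT card_ord.
rewrite preimage_setC probability_setC; last exact: (measurable_funPTI (L j) mA).
by have := lawL j A mA; rewrite sphere_uniform_tail// => ->.
Qed.

End spherical.

(** * Correlations of Gaussian samples *)

Section correlation.
Context {R : realType}.
Implicit Types n : nat.

Definition center n (v : n.-tuple R) : n.-tuple R :=
  [tuple tnth v i - sample_mean (tnth v) | i < n].

Definition unit_diag n : n.-tuple R := nseq_tuple n (Num.sqrt n%:R)^-1.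

Lemma nsq_unit_diag n : nsq (unit_diag n.+1) = 1.
Proof.
rewrite /nsq (eq_bigr (fun=> n.+1%:R^-1)) => [|i _]; last first.
  by rewrite tnth_nseq exprVn sqr_sqrtr.
by rewrite sumr_const card_ord -[LHS]mulr_natr mulVf.
Qed.

Lemma inner_unit_diag n (v : n.-tuple R) :
  inner v (unit_diag n) = (\sum_(i < n) tnth v i) / Num.sqrt n%:R.
Proof. by rewrite mulr_suml; apply: eq_bigr => i _; rewrite tnth_nseq. Qed.

Lemma sum_center n (v : n.+1.-tuple R) : \sum_(i < n.+1) tnth (center v) i = 0.
Proof.
rewrite (eq_bigr (fun i => tnth v i - sample_mean (tnth v))) => [|i _]; last first.
  by rewrite tnth_mktuple.
rewrite big_split /= sumrN sumr_const card_ord /sample_mean.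
by rewrite -[X in _ - X]mulr_natr divfK ?subrr.
Qed.

Lemma sample_ssq_center n (v : n.-tuple R) : sample_ssq (tnth v) = nsq (center v).
Proof. by apply: eq_bigr => i _; rewrite tnth_mktuple. Qed.

(** Centering one factor is enough, because a centered vector is orthogonal to constants. *)
Lemma sample_cov_center n (v w : n.+1.-tuple R) :
  \sum_(i < n.+1) (tnth v i - sample_mean (tnth v)) * (tnth w i - sample_mean (tnth w)) =
  inner v (center w).
Proof.
transitivity (inner v (center w) - sample_mean (tnth v) * \sum_(i < n.+1) tnth (center w) i).
  rewrite mulr_sumr -sumrB; apply: eq_bigr => i _.
  by rewrite !tnth_mktuple mulrBl.
by rewrite sum_center mulr0 subr0.
Qed.

Lemma sample_ssqE n (v : n.+1.-tuple R) :
  sample_ssq (tnth v) = nsq v - inner v (unit_diag n.+1) ^+ 2.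
Proof.
rewrite sample_ssq_center -inner_nsq -[X in inner X _]/(center v).
have -> : inner (center v) (center v) = inner v (center v).
  by rewrite -[RHS]sample_cov_center; apply: eq_bigr => i _; rewrite !tnth_mktuple.
have -> : inner v (center v) = nsq v - sample_mean (tnth v) * \sum_(i < n.+1) tnth v i.
  rewrite /nsq mulr_sumr -sumrB; apply: eq_bigr => i _.
  by rewrite tnth_mktuple mulrBr expr2 [X in _ - X]mulrC.
congr (_ - _); rewrite inner_unit_diag exprMn exprVn sqr_sqrtr// /sample_mean.
by rewrite expr2 mulrAC.
Qed.

Lemma sample_ssq_ge0 n (f : 'I_n -> R) : 0 <= sample_ssq f.
Proof. by apply: sumr_ge0 => i _; exact: sqr_ge0. Qed.

Definition direction n (v : n.-tuple R) : n.-tuple R :=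
  tscale (Num.sqrt (sample_ssq (tnth v)))^-1 (center v).

Lemma nsq_direction n (v : n.-tuple R) : 0 < sample_ssq (tnth v) -> nsq (direction v) = 1.
Proof.
move=> v0; rewrite tscale_nsq exprVn sqr_sqrtr ?ltW// -sample_ssq_center mulVf//.
by rewrite gt_eqF.
Qed.

Lemma inner_direction_diag n (v : n.+1.-tuple R) : inner (direction v) (unit_diag n.+1) = 0.
Proof. by rewrite innerZl inner_unit_diag sum_center mul0r mulr0. Qed.

Lemma sample_corr_lt n (x v : n.+1.-tuple R) y : 0 < y -> 0 < sample_ssq (tnth v) ->
  (sample_corr (tnth x) (tnth v) ^+ 2 < y) <->
  ~ perp_cap (unit_diag n.+1) (direction v) y x.
Proof.
move=> y0 v0; rewrite /sample_corr sample_cov_center /perp_cap /= -sample_ssqE.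
have -> : inner x (direction v) = inner x (center v) / Num.sqrt (sample_ssq (tnth v)).
  by rewrite innerZr mulrC.
set a := inner x _; set s := sample_ssq (tnth v) in v0 *.
have := sample_ssq_ge0 (tnth x); set r := sample_ssq (tnth x).
rewrite le_eqVlt => /predU1P[<-|r0].
  (* A constant x has correlation 0 by division by zero, and lies outside the cone by its strict
     inequality, so the equivalence survives. *)
  by rewrite sqrtr0 mul0r invr0 mulr0 expr0n/=; split=> // _ []; rewrite ltxx.
rewrite !exprMn !exprVn exprMn (sqr_sqrtr (ltW r0)) (sqr_sqrtr (ltW v0)) ltNge.
have -> : (y <= a ^+ 2 / (r * s)) = (y * r <= a ^+ 2 / s).
  by rewrite ler_pdivlMr ?mulr_gt0// mulrA ler_pdivlMr.
by split=> [/negP h [_ /h]//|h]; apply/negP => h'; apply: h.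
Qed.

Lemma measurable_sample_corr d (T : measurableType d) n (f g : T -> n.-tuple R) :
  measurable_fun setT f -> measurable_fun setT g ->
  measurable_fun setT (fun t => sample_corr (tnth (f t)) (tnth (g t))).
Proof.
have mmean (h : T -> n.-tuple R) : measurable_fun setT h ->
    measurable_fun setT (fun t => sample_mean (tnth (h t))).
  move=> mh; apply: measurable_funM; last exact: measurable_cst.
  by apply: measurable_sum => i; exact: measurable_tnth_comp.
have mssq (h : T -> n.-tuple R) : measurable_fun setT h ->
    measurable_fun setT (fun t => sample_ssq (tnth (h t))).
  move=> mh; apply: measurable_sum => i; apply: measurable_funX.
  by apply: measurable_funB; [exact: measurable_tnth_comp|exact: mmean].
move=> mf mg; apply: measurable_funM.
  apply: measurable_sum => i; apply: measurable_funM;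
    by apply: measurable_funB; [exact: measurable_tnth_comp|exact: mmean].
(* Inversion and the power -1 agree also at 0, where both give 0, and the power is measurable on the
   whole line. *)
have -> : (fun t => (Num.sqrt (sample_ssq (tnth (f t))) * Num.sqrt (sample_ssq (tnth (g t))))^-1) =
   (fun t => (Num.sqrt (sample_ssq (tnth (f t))) * Num.sqrt (sample_ssq (tnth (g t)))) `^ (-1)).
  by apply/funext => t; rewrite powR_inv1// mulr_ge0// sqrtr_ge0.
apply: (measurableT_comp (measurable_powR (-1))).
by apply: measurable_funM; apply: measurable_sqrt_comp; exact: mssq.
Qed.

End correlation.

Section gauss_corr.
Local Open Scope ereal_scope.
Context {R : realType} (k : nat).
Hypothesis k0 : (0 < k)%N.

Lemma perp_cap_eq0 n (e u : n.-tuple R) y : nsq e = 1%R -> nsq u = 1%R -> inner u e = 0%R ->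
  (1 < y)%R -> perp_cap e u y = set0.
Proof.
move=> e1 u1 ue y1; apply/seteqP; split=> // v [v0 yv].
have := sqr_inner_le (tadd v (topp (tscale (inner v e) e))) u1.
rewrite nsq_tadd_proj// innerDl innerNl innerZl (innerC e u) ue mulr0 subr0.
nra.
Qed.

Lemma gauss_vec_corr (mean s : R) (v : k.+2.-tuple R) y : (0 < s)%R -> (0 < y)%R ->
  (0 < sample_ssq (tnth v))%R ->
  gauss_vec mean s [set x | (sample_corr (tnth x) (tnth v) ^+ 2 < y)%R] =
  (1 - cap_tail k y)%:E.
Proof.
move=> s0 y0 v0.
have e1 := nsq_unit_diag (R := R) k.+1.
have u1 := nsq_direction v0.
have ue := inner_direction_diag v.
have mC := measurable_perp_cap (unit_diag k.+2) (direction v) y.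
have -> : [set x | (sample_corr (tnth x) (tnth v) ^+ 2 < y)%R] =
    ~` perp_cap (unit_diag k.+2) (direction v) y.
  by apply/seteqP; split=> x /= /(sample_corr_lt _ y0 v0).
have [m mE] := gauss_vec_measure mean s k.+2.
have mC1 : m (perp_cap (unit_diag k.+2) (direction v) y) = (cap_tail k y)%:E.
  rewrite mE /cap_tail; case: ifP => y1.
    (* The constant vector [mean] is this multiple of the unit diagonal. *)
    apply: (gauss_vec_perp_cap (r := Num.sqrt k.+2%:R * mean)) => //.
    - by rewrite gt_eqF.
    - by rewrite y0.
    apply: eq_from_tnth => i; rewrite tnth_mktuple !tnth_nseq.
    by field; rewrite gt_eqF// sqrtr_gt0.
  rewrite perp_cap_eq0//; last by rewrite ltNge y1.
  by rewrite -mE measure0.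
have mT : m setT = 1 by rewrite mE gauss_vecT.
have H : m setT = m (perp_cap (unit_diag k.+2) (direction v) y) +
    m (~` perp_cap (unit_diag k.+2) (direction v) y).
  by rewrite -measureU ?setUv ?setICr//; exact: measurableC.
rewrite mT mC1 in H; rewrite -mE; move: H.
case: (m _) => [r| |]// [] H; congr EFin; rewrite H; ring.
Qed.

End gauss_corr.

Section gauss_vec_probability.
Local Open Scope ereal_scope.
Context {R : realType} (mean s : R) (n : nat).

Let gauss_vec0 : gauss_vec mean s (set0 : set (n.-tuple R)) = 0.
Proof. by have [m <-] := gauss_vec_measure mean s n; exact: measure0. Qed.

Let gauss_vec_ge0 (A : set (n.-tuple R)) : 0 <= gauss_vec mean s A.
Proof. by have [m <-] := gauss_vec_measure mean s n; exact: measure_ge0. Qed.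

Let gauss_vec_sigma_additive : semi_sigma_additive (@gauss_vec R mean s n).
Proof.
have [m <-] := gauss_vec_measure mean s n; exact: measure_semi_sigma_additive.
Qed.

HB.instance Definition _ := isMeasure.Build _ _ _ (@gauss_vec R mean s n)
  gauss_vec0 gauss_vec_ge0 gauss_vec_sigma_additive.

HB.instance Definition _ := Measure_isProbability.Build _ _ _ (@gauss_vec R mean s n)
  (gauss_vecT mean s n).

End gauss_vec_probability.

(** * From independent observations to independent columns *)

Section gaussian_sample.
Local Open Scope ereal_scope.
Context {R : realType} {d : measure_display} {T : measurableType d}.
Variables (P : probability T R) (p n : nat).
Variables (Q : probability (p.-tuple R * R)%type R).
Variables (Z : 'I_n -> {RV P >-> (p.-tuple R * R)%type}).
Variables (mean s : 'I_p -> R).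
Hypothesis lawX : forall j : 'I_p, has_law Q (fun w => tnth w.1 j) (normal_prob (mean j) (s j)).
Hypothesis indX : mutually_independent Q (fun (j : 'I_p) w => tnth w.1 j).
Hypothesis indXY : independent2 Q fst snd.
Hypothesis iidZ : iid_sample Q Z.

Definition Xvec (j : 'I_p) (t : T) : n.-tuple R := [tuple obsX Z j t i | i < n].
Definition Yvec (t : T) : n.-tuple R := [tuple obsY Z t i | i < n].
Definition Xmat (t : T) : p.-tuple (n.-tuple R) := [tuple Xvec j t | j < p].

Lemma measurable_Xvec j : measurable_fun setT (Xvec j).
Proof.
apply: measurable_mktuple => i.
apply: (measurable_tnth_comp (f := fun t => (Z i t).1)).
exact: (measurableT_comp measurable_fst (@measurable_funP _ _ _ _ _ (Z i))).
Qed.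

Lemma measurable_Yvec : measurable_fun setT Yvec.
Proof.
apply: measurable_mktuple => i.
exact: (measurableT_comp measurable_snd (@measurable_funP _ _ _ _ _ (Z i))).
Qed.

Lemma measurable_Xmat : measurable_fun setT Xmat.
Proof.
apply/measurable_fun_tnthP => j; rewrite (_ : _ \o _ = Xvec j).
  exact: measurable_Xvec.
by apply/funext => t /=; rewrite tnth_mktuple.
Qed.

Let Poo : P setT < +oo. Proof. by rewrite probability_setT ltry. Qed.

Lemma design_rect (A : 'I_p -> set R) (B : set R) :
  (forall j, measurable (A j)) -> measurable B ->
  Q [set w | rect A w.1 /\ B w.2] =
  \prod_(j < p) normal_prob (mean j) (s j) (A j) * Q (snd @^-1` B).
Proof.
move=> mA mB; have -> : [set w | rect A w.1 /\ B w.2] = fst @^-1` rect A `&` snd @^-1` B :> set (p.-tuple R * R).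
  by [].
rewrite indXY//; last exact: measurable_rect.
congr (_ * _).
have -> : fst @^-1` rect A = \bigcap_(j in [set` [set: 'I_p]%SET])
    ((fun w : p.-tuple R * R => tnth w.1 j) @^-1` A j).
  apply/seteqP; split=> w /= h j; first by move=> _; exact: h.
  by apply: h; rewrite /= inE.
rewrite indX; last by move=> j _; exact: mA.
rewrite (eq_bigl xpredT) => [|j]; last by rewrite inE.
by apply: eq_bigr => j _; rewrite lawX.
Qed.

(** Observations are independent, and so are the variables within one observation. On boxes the
    probability is therefore a double product, and exchanging the two products groups it by
    variable. *)
Lemma sample_rect0 (A : 'I_p -> 'I_n -> set R) (B : 'I_n -> set R) :
  (forall j i, measurable (A j i)) -> (forall i, measurable (B i)) ->
  P ((\bigcap_(j in [set: 'I_p]) Xvec j @^-1` rect (A j)) `&` Yvec @^-1` rect B) =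
  \prod_(j < p) gauss_vec (mean j) (s j) (rect (A j)) * \prod_(i < n) Q (snd @^-1` B i).
Proof.
move=> mA mB; have [lawZ indZ] := iidZ.
pose C i := [set w : p.-tuple R * R | rect (fun j => A j i) w.1 /\ B i w.2].
have mC i : measurable (C i).
  apply: measurableI; last exact: measurable_preimage.
  by apply: measurable_preimage => //; exact: measurable_rect.
have -> : (\bigcap_(j in [set: 'I_p]) Xvec j @^-1` rect (A j)) `&` Yvec @^-1` rect B =
    \bigcap_(i in [set` [set: 'I_n]%SET]) (Z i @^-1` C i).
  apply/seteqP; split=> t /=.
    move=> [hX hY] i _; split=> [j|].
      by have := hX j I i; rewrite /= tnth_mktuple.
    by have := hY i; rewrite tnth_mktuple.
  move=> h; have hC i : C i (Z i t) by apply: h; rewrite /= inE.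
  by split=> [j _ i|i]; rewrite tnth_mktuple; case: (hC i) => h1 h2; first exact: h1.
rewrite indZ; last by move=> i _; exact: mC.
rewrite (eq_bigl xpredT) => [|j]; last by rewrite inE.
under eq_bigr => i _ do rewrite (lawZ i _ (mC i)) design_rect//.
rewrite big_split /= exchange_big /=; congr (_ * _).
by apply: eq_bigr => j _; rewrite gauss_vec_rect.
Qed.

Lemma Yvec_rect (B : 'I_n -> set R) : (forall i, measurable (B i)) ->
  P (Yvec @^-1` rect B) = \prod_(i < n) Q (snd @^-1` B i).
Proof.
move=> mB; have := sample_rect0 (A := fun _ _ => setT) (fun _ _ => measurableT) mB.
rewrite big1 => [|j _]; last first.
  by rewrite (_ : rect _ = setT) ?gauss_vecT//; apply/seteqP; split.
rewrite mul1e => <-; congr (P _); rewrite -[LHS]setTI; congr (_ `&` _).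
by apply/seteqP; split=> // t _ j _ i.
Qed.

Lemma sample_XY (D : 'I_p -> set (n.-tuple R)) (B : set (n.-tuple R)) :
  (forall j, measurable (D j)) -> measurable B ->
  P (Yvec @^-1` B `&` \bigcap_(j in [set: 'I_p]) Xvec j @^-1` D j) =
  \prod_(j < p) gauss_vec (mean j) (s j) (D j) * P (Yvec @^-1` B).
Proof.
move=> mD mB.
have mDX : measurable (\bigcap_(j in [set: 'I_p]) Xvec j @^-1` D j).
  apply: fin_bigcap_measurable => // j _; apply: measurable_preimage => //.
  exact: measurable_Xvec.
have fin : \prod_(j < p) gauss_vec (mean j) (s j) (D j) \is a fin_num.
  by apply: prode_fin_num => j _; exact: fin_num_measure.
have r0 : (0 <= fine (\prod_(j < p) gauss_vec (mean j) (s j) (D j)))%R.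
  by rewrite fine_ge0// prode_ge0 => // j _; exact: measure_ge0.
have [m mE] := pushforward_measure_exists P measurable_Yvec.
rewrite -(fineK fin) (_ : P (Yvec @^-1` B) = m B); last by rewrite mE.
apply: pi_lambda_restr => //; first exact: measurable_Yvec.
move=> {mB}B mB; rewrite fineK// mE /pushforward setIC.
have mYB : measurable (Yvec @^-1` rect B).
  by apply: measurable_preimage; [exact: measurable_Yvec|exact: measurable_rect].
have finB : P (Yvec @^-1` rect B) \is a fin_num by exact: fin_num_measure.
rewrite muleC -[X in _ = X * _](fineK finB).
pose nu j : probability (n.-tuple R) R := gauss_vec (mean j) (s j) (n := n).
(* With the box for Y fixed, restricting P to it leaves a finite measure, on which the columns of X
   can be freed. *)
suff H : forall D' : 'I_p -> set (n.-tuple R), (forall j, measurable (D' j)) ->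
    mrestr P mYB (\bigcap_(j in [set: 'I_p]) Xvec j @^-1` D' j) =
    (fine (P (Yvec @^-1` rect B)))%:E * \prod_(j < p) nu j (D' j) by exact: H.
apply: pi_lambda_family.
- exact: measurable_Xvec.
- by rewrite /= /mrestr setTI -ge0_fin_numE.
- by rewrite fine_ge0.
- move=> A mA; rewrite fineK// muleC.
  by rewrite -[RHS]/(\prod_(j < p) gauss_vec (mean j) (s j) (rect (A j)) * _) Yvec_rect// -sample_rect0.
Qed.

Lemma sample_X (D : 'I_p -> set (n.-tuple R)) : (forall j, measurable (D j)) ->
  P (\bigcap_(j in [set: 'I_p]) Xvec j @^-1` D j) =
  \prod_(j < p) gauss_vec (mean j) (s j) (D j).
Proof.
move=> mD; have := sample_XY mD measurableT.
by rewrite preimage_setT setTI probability_setT mule1.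
Qed.

(** A box for [Xmat] has arbitrary measurable sets of columns as sides, which is why [sample_XY]
    goes beyond boxes of numbers. *)
Lemma sample_independent2 : independent2 P Yvec Xmat.
Proof.
move=> B A mB mA.
have mYB : measurable (Yvec @^-1` B) by apply: measurable_preimage => //; exact: measurable_Yvec.
have finB : P (Yvec @^-1` B) \is a fin_num by exact: fin_num_measure.
have [m mE] := pushforward_measure_exists P measurable_Xmat.
rewrite setIC (_ : P (Xmat @^-1` A) = m A); last by rewrite mE.
rewrite -(fineK finB).
apply: pi_lambda_restr => //; first exact: measurable_Xmat.
- by rewrite fine_ge0.
move=> D mD; rewrite fineK// mE /pushforward.
have -> : Xmat @^-1` rect D = \bigcap_(j in [set: 'I_p]) Xvec j @^-1` D j.
  apply/seteqP; split=> t /= h j; have := h j; rewrite tnth_mktuple//.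
  by apply.
rewrite [X in P X = _]setIC muleC; apply: etrans (sample_XY mD mB) _.
by congr (_ * _); exact/esym/sample_X.
Qed.

End gaussian_sample.

Section sample.
Local Open Scope ereal_scope.
Context {R : realType} {d : measure_display} {T : measurableType d}.
Variables (P : probability T R) (p k : nat).
Hypotheses (p0 : (0 < p)%N) (k0 : (0 < k)%N).

Lemma sample_prob (Q : probability (p.-tuple R * R)%type R)
    (Z : 'I_k.+2 -> {RV P >-> (p.-tuple R * R)%type}) (y : R) :
  gaussian_design Q -> iid_sample Q Z -> corr_well_defined Z -> (0 < y)%R ->
  P [set t | (max_corr Z t ^+ 2 < y)%R] = ((1 - cap_tail k y) ^+ p)%:E.
Proof.
move=> [gaussX indX indXY] iidZ wd y0.
have [mean Hmean] := choice gaussX.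
have [s Hs] := choice Hmean.
have s0 j : (0 < s j)%R by have [] := Hs j.
have lawX j : has_law Q (fun w => tnth w.1 j) (normal_prob (mean j) (s j)) by have [] := Hs j.
pose V : {RV P >-> k.+2.-tuple R} :=
  HB.pack (Yvec Z) (isMeasurableFun.Build _ _ _ _ _ (measurable_Yvec Z)).
pose X : {RV P >-> p.-tuple (k.+2.-tuple R)} :=
  HB.pack (Xmat Z) (isMeasurableFun.Build _ _ _ _ _ (measurable_Xmat Z)).
pose E : set (k.+2.-tuple R * p.-tuple (k.+2.-tuple R)) :=
  \bigcap_(j in [set: 'I_p]) [set vx | (sample_corr (tnth (tnth vx.2 j)) (tnth vx.1) ^+ 2 < y)%R].
have mE : measurable E.
  apply: fin_bigcap_measurable => // j _.
  apply: measurable_set_lt; last exact: measurable_cst.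
  apply: measurable_funX; apply: measurable_sample_corr => //.
  exact: (measurable_tnth_comp (f := snd)).
have corrE t j : sample_corr (obsX Z j t) (obsY Z t) =
    sample_corr (tnth (tnth (Xmat Z t) j)) (tnth (Yvec Z t)).
  congr sample_corr; apply/funext => i; rewrite ?tnth_mktuple//.
have -> : [set t | (max_corr Z t ^+ 2 < y)%R] = [set t | E (V t, X t)].
  apply/seteqP; split=> t /=; rewrite /max_corr.
    by move=> /(bigmax_sqr_lt _ y0) h j _ /=; rewrite -corrE; exact: h.
  move=> h; apply/(bigmax_sqr_lt _ y0) => j; have := h j I.
  by rewrite /= -corrE.
apply: independent2_prob => //.
- exact: (sample_independent2 lawX indX indXY iidZ).
- by rewrite exprn_ge0// subr_ge0 cap_tail_le1.
move: wd; apply: filterS => t wdt.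
have v0 : (0 < sample_ssq (tnth (Yvec Z t)))%R.
  (* Well-definedness is stated column by column; as p > 0 there is one, and its denominator would
     vanish with the variation of Y. *)
  rewrite lt_neqAle sample_ssq_ge0 andbT; apply/eqP => v0.
  have := wdt (Ordinal p0); have -> : obsY Z t = tnth (Yvec Z t).
    by apply/funext => i; rewrite tnth_mktuple.
  by rewrite -v0 sqrtr0 mulr0 eqxx.
have -> : [set t' | E (V t, X t')] = \bigcap_(j in [set: 'I_p]) (Xvec Z j @^-1`
    [set x | (sample_corr (tnth x) (tnth (Yvec Z t)) ^+ 2 < y)%R]).
  by apply/seteqP; split=> t' /= h j _; have := h j I; rewrite /= tnth_mktuple.
rewrite (sample_X lawX indX indXY iidZ); last first.
  move=> j; apply: measurable_set_lt; last exact: measurable_cst.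
  apply: measurable_funX; apply: measurable_sample_corr; first exact: measurable_id.
  exact: measurable_cst.
rewrite (eq_bigr (fun=> (1 - cap_tail k y)%:E)) => [|j _]; last exact: gauss_vec_corr.
by rewrite prodEFin prodr_const card_ord.
Qed.

End sample.

(** * From cap probabilities to the limit laws *)

Section conclusion.
Context {R : realType}.

Lemma normalized_event T (M : T -> R) (p m : nat) (x : R) : (0 < m)%N -> (1 < p)%N ->
  [set t | (M t ^+ 2 - a_ p m.+1) / b_ p m.+1 < x] =
  [set t | M t ^+ 2 < a_ p m.+1 + b_ p m.+1 * x].
Proof.
move=> m0 p1; apply/seteqP; split=> t /=;
  by rewrite ltr_pdivrMr ?b_gt0// ltrBlDl [x * _]mulrC.
Qed.

(** [F p m] is the distribution function of the normalized maximum over the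
    sphere of [R ^ m.+1]. *)
Lemma max_cdf_approx (F : nat -> nat -> R) (x e : R) :
  (forall p m, (1 < p)%N -> (0 < m)%N -> 0 < a_ p m.+1 + b_ p m.+1 * x ->
    F p m = (1 - cap_tail m (a_ p m.+1 + b_ p m.+1 * x)) ^+ p) ->
  0 < e -> exists N : nat, forall p m, (N <= p)%N -> (0 < m)%N ->
    `|F p m - limit_cdf m.+1 x| <= e.
Proof.
move=> FE e0; have [N NH] := cap_prob_limit x e0.
exists (maxn N 2) => p m; rewrite geq_max => /andP[Np p1] m0.
have [xm|xm] := leP x (m%:R / 2).
  have [/andP[y0 y1] H] := NH p m Np p1 m0 xm.
  by rewrite FE// /cap_tail y1.
have y1 := level_gt1 m0 p1 xm.
rewrite FE//; last exact: lt_trans y1.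
rewrite /cap_tail ifF; last by rewrite leNgt y1.
by rewrite subr0 expr1n limit_cdf_gt// subrr normr0 ltW.
Qed.

End conclusion.

Theorem theorem3 (R : realType) :
  (forall (d : nat -> nat -> measure_display)
      (T : forall p n : nat, measurableType (d p n))
      (P : forall p n : nat, probability (T p n) R)
      (L : forall p n : nat, 'I_p -> {RV (P p n) >-> n.-tuple R})
      (U : forall p n : nat, {RV (P p n) >-> n.-tuple R}),
    (forall p n : nat, (2 <= p)%N -> (2 <= n)%N ->
       spherical_model (L p n) (U p n)) ->
    let F (p n : nat) (x : R) : R :=
      fine (P p n [set t | (max_inner (L p n) (U p n) t ^+ 2 - a_ p n) / b_ p n
                           < x]) in
    forall x : R,
      (ereal_sup [set (`|F p n x - limit_cdf n x|)%:E
                 | n in [set n : nat | (2 <= n)%N]]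
         @[p --> \oo] --> 0%E)
      /\ (F pn.1 pn.2 x @[pn --> (\oo, \oo)] --> expR (- expR (- x))))
  /\
  (forall (d : nat -> nat -> measure_display)
      (T : forall p n : nat, measurableType (d p n))
      (P : forall p n : nat, probability (T p n) R)
      (Q : forall p n : nat, probability (p.-tuple R * R)%type R)
      (Z : forall p n : nat, 'I_n -> {RV (P p n) >-> (p.-tuple R * R)%type}),
    (forall p n : nat, (2 <= p)%N -> (3 <= n)%N ->
       [/\ gaussian_design (Q p n), iid_sample (Q p n) (Z p n)
         & corr_well_defined (Z p n)]) ->
    let F (p n : nat) (x : R) : R :=
      fine (P p n [set t | (max_corr (Z p n) t ^+ 2 - a_ p n.-1) / b_ p n.-1
                           < x]) in
    forall x : R,
      (ereal_sup [set (`|F p n x - limit_cdf n.-1 x|)%:E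
                 | n in [set n : nat | (3 <= n)%N]]
         @[p --> \oo] --> 0%E)
      /\ (F pn.1 pn.2 x @[pn --> (\oo, \oo)] --> expR (- expR (- x)))).
Proof.
split=> d T P.
- move=> L U model F x.
  have FG e : 0 < e -> exists N : nat, forall p n, (N <= p)%N -> (2 <= n)%N ->
      `|F p n x - limit_cdf n x| <= e.
    move=> e0; have [|N NH] := @max_cdf_approx R (fun p m => F p m.+1 x) x e _ e0.
      move=> p m p1 m0 y0; rewrite /F normalized_event//.
      by rewrite (spherical_prob m0 (model p m.+1 p1 _) y0).
    by exists N => p [//|[//|m]] Np _; exact: NH.
  split; first exact: sup_cvg0 FG.
  exact: (double_cvg (F := fun p n => F p n x) FG (@limit_cdf_cvg R x)).
- move=> Q Z model F x.
  have FG e : 0 < e -> exists N : nat, forall p n, (N <= p)%N -> (3 <= n)%N ->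
      `|F p n x - limit_cdf n.-1 x| <= e.
    (* Centering costs one dimension: m + 2 observations give directions on the sphere of
       R^(m+1). *)
    move=> e0; have [|N NH] := @max_cdf_approx R (fun p m => F p m.+2 x) x e _ e0.
      move=> p m p1 m0 y0; have [g i c] := model p m.+2 p1 m0.
      by rewrite /F normalized_event// (sample_prob (ltnW p1) m0 g i c y0).
    by exists N => p [//|[//|[//|m]]] Np _; exact: (NH p m.+1).
  split; first exact: sup_cvg0 FG.
  apply: (double_cvg (F := fun p n => F p n x) FG).
  by rewrite -cvg_shiftS; exact: limit_cdf_cvg.
Qed.
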